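(* Let $2\le p<\infty$ and let $F$ be a function in $H^p (\mathbb{D}^\infty )$. Then there is a representative $\widetilde{F}_{1/2}$ of the restriction $F|_{\mathbb{T}^\infty_{1/2}}$, viewed as a function on the distinguished boundary $\mathbb{T}^\infty$, such that \[\widetilde{F}_{1/2}(\tau)=\lim_{\theta\to 1/2^+}F(b_\theta (\tau ))\] for almost every $\tau\in\mathbb{T}^\infty$. In fact, for every $\tau\in\mathbb{T}^\infty$, we have \[\widetilde{F}_{1/2}(\tau')=\lim_{\theta\to 1/2^+}F(b_\theta (\tau' ))\] for almost every $\tau'\in T(\tau )$.
   Context: $\mathbb{D}$ is the open unit disc, $\mathbb{T}$ the unit circle, $\mathbb{T}^\infty$ the countably infinite product of circles, equipped with its normalized Haar measure $m_\infty$; ''almost every $\tau\in\mathbb{T}^\infty$'' refers to $m_\infty$. Let $p_1=2,p_2=3,\ldots$ be the primes in increasing order. For a polynomial $F(z)=\sum b_\beta z^\beta$ in finitely many of the variables $z_1,z_2,\ldots$ set $\|F\|_{H^p(\mathbb{D}^\infty)}=\left(\int_{\mathbb{T}^\infty}|F(\tau)|^p\,dm_\infty(\tau)\right)^{1/p}$. The space $H^p(\mathbb{D}^\infty)$ is the closure of the polynomials with respect to this norm; for $p\ge 1$ it consists of all functions in $L^p(\mathbb{T}^\infty)$ whose Fourier coefficients with at least one negative index vanish. Point evaluations at points $z\in\mathbb{D}^\infty\cap\ell^2$ are bounded on polynomials in this norm, so $F(z)$ is well defined for $F\in H^p(\mathbb{D}^\infty)$ and $z\in\mathbb{D}^\infty\cap\ell^2$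 by continuous extension from polynomials. For $\tau=(\tau_1,\tau_2,\ldots)\in\mathbb{T}^\infty$ and $\theta\ge 0$, set $b_\theta(\tau)=(p_1^{-\theta}\tau_1,p_2^{-\theta}\tau_2,\ldots)$; for $\theta>1/2$ one has $b_\theta(\tau)\in\mathbb{D}^\infty\cap\ell^2$. Let $\mathbb{T}^\infty_{1/2}=b_{1/2}(\mathbb{T}^\infty)$, with measure $m_{\infty,1/2}$ the pushforward of $m_\infty$ under $b_{1/2}$; it is identified with $\mathbb{T}^\infty$ via $b_{1/2}$. For a polynomial $F$ the restriction is $F|_{\mathbb{T}^\infty_{1/2}}(\tau)=F(b_{1/2}(\tau))$, $\tau\in\mathbb{T}^\infty$; the map $F\mapsto F|_{\mathbb{T}^\infty_{1/2}}$ is a contraction from the polynomials with the $H^p(\mathbb{D}^\infty)$ norm to $L^p(\mathbb{T}^\infty_{1/2},m_{\infty,1/2})$, and $F|_{\mathbb{T}^\infty_{1/2}}$ is defined for general $F\in H^p(\mathbb{D}^\infty)$ by continuous extension. A representative of it is an everywhere defined measurable function in the corresponding almost-everywhere equivalence class. The Kronecker flow is $T_t((z_1,z_2,\ldots))=(p_1^{-it}z_1,p_2^{-it}z_2,\ldots)$, $t\in\mathbb{R}$, and $T(\tau)=\{T_t(\tau):t\in\mathbb{R}\}$ is the orbit of $\tau$, equipped with linear measure, i.e. Lebesgue measure in the parameter $t\in\mathbb{R}$; ''almost every $\tau'\in T(\tau)$'' refers to this measure. *)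

(* Defs.v *)
(* MathComp-Analysis, with complex numbers from mathcomp-real-closed and
   polynomials from multinomials (the latter loaded without Import because its
   notations clash with those of MathComp-Analysis). *)
From HB Require Import structures.
From mathcomp Require Import all_boot all_order all_algebra.
From mathcomp Require Import all_classical all_reals all_analysis.
From mathcomp Require Import complex.
From mathcomp Require mpoly.

Set Implicit Arguments.
Unset Strict Implicit.
Unset Printing Implicit Defensive.

Import Order.TTheory GRing.Theory Num.Theory.
Import numFieldNormedType.Exports.
Import ComplexField.Normc.

Local Open Scope classical_set_scope.
Local Open Scope complex_scope.
Local Open Scope ring_scope.

Lemma next_prime_ex (n : nat) : exists p, (n < p)%N && prime p.
Proof. by have [p np pp] := prime_above n; exists p; rewrite np. Qed.

Definition next_prime (n : nat) : nat := ex_minn (next_prime_ex n).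

(* Indices start at 0: [nth_prime j] is the prime p_{j+1} = 2, 3, 5, ... *)
Definition nth_prime (j : nat) : nat := iter j next_prime 2%N.

Section Torus.
Variable R : realType.

Definition circle : Type := {z : R[i] | normc z == 1}.

Definition torus : Type := nat -> circle.

Lemma circle_one_subproof : normc (1 : R[i]) == 1.
Proof. by rewrite normc1. Qed.

Definition circle_one : circle := exist _ 1 circle_one_subproof.

Lemma circle_mul_subproof (z w : circle) : normc (val z * val w) == 1.
Proof. by rewrite normcM (eqP (valP z)) (eqP (valP w)) mulr1. Qed.

Definition circle_mul (z w : circle) : circle :=
  exist _ (val z * val w) (circle_mul_subproof z w).

Definition torus_mul (s t : torus) : torus := fun j => circle_mul (s j) (t j).

HB.instance Definition _ := gen_eqMixin torus.
HB.instance Definition _ := gen_choiceMixin torus.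
HB.instance Definition _ := isPointed.Build torus (fun=> circle_one).

(* The product sigma-algebra of the Borel sigma-algebras of the circles; as the
   circle is second countable it is the Borel sigma-algebra of the product. *)
Definition torus_cylinders : set (set torus) :=
  \bigcup_j
    (preimage_set_system setT (fun t : torus => complex.Re (val (t j)))
       (@measurable _ (measurableTypeR R)) `|`
     preimage_set_system setT (fun t : torus => complex.Im (val (t j)))
       (@measurable _ (measurableTypeR R))).

HB.instance Definition _ := @isMeasurable.Build (sigma_display torus_cylinders)
  torus <<s torus_cylinders >>
  (@sigma_algebra0 _ setT torus_cylinders)
  (@sigma_algebraC _ torus_cylinders)
  (@sigma_algebra_bigcup _ setT torus_cylinders).

(* Normalized Haar measure on the compact group [torus]. *)
Definition is_haar (m : probability torus R) : Prop :=
  forall (s : torus) (A : set torus), measurable A ->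
    m (torus_mul s @^-1` A) = m A.

Definition b_ (theta : R) (t : torus) : nat -> R[i] :=
  fun j => ((nth_prime j)%:R `^ (- theta))%:C * val (t j).

Lemma cos_sin_subproof (x : R) : normc (cos x +i* sin x) == 1.
Proof. by rewrite /normc /= cos2Dsin2 sqrtr1. Qed.

Definition circle_exp (x : R) : circle :=
  exist _ (cos x +i* sin x) (cos_sin_subproof x).

(* T_t : the j-th coordinate is multiplied by p^{-it} = exp (- i t ln p). *)
Definition kronecker (t : R) (tau : torus) : torus :=
  torus_mul (fun j => circle_exp (- (t * ln (nth_prime j)%:R))) tau.

(* Polynomials in finitely many of the variables z_1, z_2, ... *)
Definition cpoly : Type := {n : nat & mpoly.mpoly n R[i]}.

Definition peval (P : cpoly) (z : nat -> R[i]) : R[i] :=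
  mpoly.meval (fun i : 'I_(tag P) => z i) (tagged P).

Definition on_torus (P : cpoly) (t : torus) : R[i] :=
  peval P (fun j => val (t j)).

Definition cmeasurable (f : torus -> R[i]) : Prop :=
  measurable_fun setT (fun t => complex.Re (f t)) /\
  measurable_fun setT (fun t => complex.Im (f t)).

Section Hardy.
Variables (m : probability torus R) (p : R).

Definition Lpnorm (f : torus -> R[i]) : \bar R :=
  Lnorm m p%:E (fun t => (normc (f t))%:E).

Definition Lpdist (f g : torus -> R[i]) : \bar R :=
  Lpnorm (fun t => f t - g t).

Definition Lp (f : torus -> R[i]) : Prop :=
  cmeasurable f /\ (Lpnorm f < +oo)%E.

(* Traces on the polynomials of the L^p-neighbourhoods of f: limits along this
   filter are limits as P tends to f in norm. *)
Definition poly_near (f : torus -> R[i]) : set_system cpoly :=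
  filter_from [set e : R | 0 < e]
    (fun e => [set P | (Lpdist (on_torus P) f < e%:E)%E]).

(* H^p as the closure of the polynomials in L^p; elements are given by
   representatives. *)
Definition Hp (f : torus -> R[i]) : Prop :=
  Lp f /\
  forall e : R, 0 < e ->
    exists P : cpoly, (Lpdist (on_torus P) f < e%:E)%E.

(* The extension by continuity of point evaluation at z from the polynomials to
   H^p; only meaningful for z in l^2 with all coordinates in the open disc. *)
Definition Hp_eval (f : torus -> R[i]) (z : nat -> R[i]) : R[i] :=
  lim ((fun P : cpoly => (peval P z : R[i]^o)) @ poly_near f).

(* g represents the image of f under the extension by continuity to H^p of the
   restriction map P |-> P \o b_{1/2}, from the H^p norm to the L^p norm. *)
Definition is_restriction (f g : torus -> R[i]) : Prop :=
  Lp g /\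
  (fun P : cpoly => Lpdist (fun t => peval P (b_ 2^-1 t)) g)
    @ poly_near f --> 0%E.

End Hardy.
End Torus.

(* Main.v *)
Require Import Defs.
From mathcomp Require Import all_boot all_order all_algebra.
From mathcomp Require Import all_classical all_reals all_analysis.
From mathcomp Require Import measurable_realfun.
From mathcomp Require Import complex.
From mathcomp Require Import zify ring lra.

Set Implicit Arguments.
Unset Strict Implicit.
Unset Printing Implicit Defensive.

Import Order.TTheory GRing.Theory Num.Theory.
Import numFieldNormedType.Exports.
Import ComplexField.Normc.
Local Open Scope classical_set_scope.
Local Open Scope ring_scope.

(* Writing z^beta as the Bohr monomial of an integer n, a function F in H^p with p >= 2 has
   square summable coefficients a_n, and along an orbit t |-> T_t tau the values at b_theta are
   the Dirichlet series sum a_n chi_n(tau) n^(- theta - i t). For every square summable sequence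
   such a series has a limit as theta tends to 1/2 from the right, for almost every t: the local
   embedding int_I |sum a_n n^(- 1/2 - i t)|^2 dt <= C sum |a_n|^2 (Schur's test) gives a weak
   type bound for the maximal function over theta, by comparing the dilations exp(- h ln n) with
   Steklov means, which the Hardy-Littlewood maximal function controls, up to a square function
   over dyadic scales. This is the claim on orbits; as Haar measure is invariant under T_t,
   Fubini turns it into the claim for almost every tau. That the radial limit represents the
   restriction follows by Fatou from the contractivity of P |-> P o b_theta on polynomials. *)

(** * Dirichlet polynomials on the critical line *)

Section Schur_test.
Variable R : realType.
Implicit Types (a b : nat -> R) (r : seq nat).
Local Notation mu := (@lebesgue_measure R).

(** The obstacle is that [theta] runs through a continuum, so bounds at each single [theta] say
    nothing about the limit. With x = ln n and a dyadic scale s such that s / 2 <= h <= s, the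
    dilation exp(- h x) is reached in three steps: the mean over [t - s, t + s], whose multiplier is
    sinc(s x); the error exp(- s x) - sinc(s x); and the expansion of exp(- h x) in powers of s - h,
    whose terms are (s x)^j / j! * exp(- s x) times the j-th power of (s - h) / s <= 1/2. With y = s
    x, the squares of the two kinds of error multipliers are O(min(y, 1/y)), the Taylor ones after
    weighting by 2^-j and summing over j, so they can be summed over all dyadic scales, and the
    local embedding turns this into a mean square bound. All multipliers are real; therefore the
    real and the imaginary part of the series are handled as two separate sums of [wave], with
    coefficients (Re, Im) and (Im, - Re). *)

Lemma is_derive_big r (f : nat -> R -> R) (df : nat -> R) (x : R) :
  (forall n, is_derive x 1 (f n) (df n)) ->
  is_derive x 1 (fun y => \sum_(n <- r) f n y) (\sum_(n <- r) df n).
Proof.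
move=> h; elim: r => [|n r ih].
  have -> : (fun y => \sum_(n <- [::]) f n y) = cst 0.
    by apply/funext => y; rewrite big_nil.
  by rewrite big_nil; exact: is_derive_cst.
have -> : (fun y => \sum_(k <- n :: r) f k y) = f n \+ (fun y => \sum_(k <- r) f k y).
  by apply/funext => y; rewrite big_cons.
by rewrite big_cons; exact: is_deriveD.
Qed.

Lemma is_derive_continuous (f df : R -> R) :
  (forall x : R, is_derive x 1 f (df x)) -> continuous f.
Proof.
by move=> h x; apply/differentiable_continuous/derivable1_diffP; case: (h x).
Qed.

Lemma FTC2_is_derive (F f : R -> R) (x y : R) : x < y ->
  (forall z : R, is_derive z 1 F (f z)) -> continuous f ->
  (\int[mu]_(z in `[x, y]) (f z)%:E = (F y - F x)%:E)%E.
Proof.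
move=> xy dF cf; have cF := is_derive_continuous dF.
rewrite (@continuous_FTC2 _ f F)//.
- exact: continuous_subspaceT.
- split.
  + by move=> z _; case: (dF z).
  + exact/cvg_at_right_filter/cF.
  + exact/cvg_at_left_filter/cF.
- by move=> z _; rewrite derive1E; case: (dF z).
Qed.

Definition lnS (n : nat) : R := ln n.+1%:R.

Lemma lnS_ge0 n : 0 <= lnS n.
Proof. by apply: ln_ge0; rewrite ler1n. Qed.

(* The real part of (a_n + i b_n) (n + 1)^(- i s). *)
Definition wave a b n (s : R) : R :=
  a n * cos (lnS n * s) + b n * sin (lnS n * s).

Lemma is_derive_cosM (x s : R) :
  is_derive s 1 (fun s => cos (x * s)) (- sin (x * s) * x).
Proof.
apply: (@is_derive1_comp _ cos (fun s => x * s)) => //.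
by apply: is_derive_eq; rewrite /GRing.scale/=; ring.
Qed.

Lemma is_derive_sinM (x s : R) :
  is_derive s 1 (fun s => sin (x * s)) (cos (x * s) * x).
Proof.
apply: (@is_derive1_comp _ sin (fun s => x * s)) => //.
by apply: is_derive_eq; rewrite /GRing.scale/=; ring.
Qed.

Lemma is_derive_wave a b n (s : R) :
  is_derive s 1 (wave a b n)
    (lnS n * (b n * cos (lnS n * s) - a n * sin (lnS n * s))).
Proof.
have dc := is_derive_cosM (lnS n) s; have ds := is_derive_sinM (lnS n) s.
by rewrite /wave; apply: is_derive_eq; rewrite /GRing.scale/=; ring.
Qed.

(* A primitive of [(1 - s ^+ 2) * cos (x * s)]. *)
Definition parabolic_prim (x s : R) : R :=
  if x == 0 then s - s ^+ 3 / 3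
  else (1 - s ^+ 2) * sin (x * s) / x - 2 * s * cos (x * s) / x ^+ 2
       + 2 * sin (x * s) / x ^+ 3.

Definition parabolic_sprim (x s : R) : R :=
  if x == 0 then 0
  else - ((1 - s ^+ 2) * cos (x * s) / x) - 2 * s * sin (x * s) / x ^+ 2
       - 2 * cos (x * s) / x ^+ 3.

Lemma is_derive_parabolic_prim (x s : R) :
  is_derive s 1 (parabolic_prim x) ((1 - s ^+ 2) * cos (x * s)).
Proof.
have dc := is_derive_cosM x s; have ds := is_derive_sinM x s.
rewrite /parabolic_prim; have [->|x0] := eqVneq x 0.
  by apply: is_derive_eq; rewrite /GRing.scale/= mul0r cos0; field.
by apply: is_derive_eq; rewrite /GRing.scale/=; field.
Qed.

Lemma is_derive_parabolic_sprim (x s : R) :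
  is_derive s 1 (parabolic_sprim x) ((1 - s ^+ 2) * sin (x * s)).
Proof.
have dc := is_derive_cosM x s; have ds := is_derive_sinM x s.
rewrite /parabolic_sprim; have [->|x0] := eqVneq x 0.
  by apply: is_derive_eq; rewrite mul0r sin0 mulr0.
by apply: is_derive_eq; rewrite /GRing.scale/=; field.
Qed.

(** The integrand (1 - s^2) sin(x s) is odd, so the sine part of the Gram matrix disappears on
    integration over [-1, 1]. *)
Lemma parabolic_sprim_even x : parabolic_sprim x 1 - parabolic_sprim x (- 1) = 0.
Proof.
rewrite /parabolic_sprim; case: eqVneq => [_|x0]; first by rewrite subrr.
by rewrite mulrN sinN cosN; field.
Qed.

(** For |x| <= 1 the integral is at most 2. For |x| > 1 the boundary terms in 1 / x vanish because
    the weight is zero at both ends, and what remains is at most 8 / x^2; then (1 + |x|)^2 <= 4 x^2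
    gives 32. *)
Lemma parabolic_kernel_bound x :
  `|parabolic_prim x 1 - parabolic_prim x (- 1)| <= 32 / (1 + `|x|) ^+ 2.
Proof.
have p1 : 0 < (1 + `|x|) ^+ 2 by rewrite exprn_gt0// ltr_pwDl.
rewrite ler_pdivlMr//; have [x1|x1] := leP `|x| 1.
  have cF := is_derive_continuous (is_derive_parabolic_prim x).
  have [z zI ->] := MVT (lt_trans (ltrN10 R) ltr01)
    (fun s _ => is_derive_parabolic_prim x s) (continuous_subspaceT cF).
  rewrite !normrM; have z1 : `|1 - z ^+ 2| <= 1.
    move: zI; rewrite in_itv/= => /andP[z0 z1].
    by rewrite ler_norml; apply/andP; split; nra.
  have c1 : `|cos (x * z)| <= 1 by rewrite ler_norml cos_geN1 cos_le1.
  have -> : `|1 - -1 : R| = 2 by rewrite opprK ger0_norm.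
  have q : `|1 - z ^+ 2| * `|cos (x * z)| <= 1 by rewrite mulr_ile1.
  have q2 : (1 + `|x|) ^+ 2 <= 4 by have := normr_ge0 x; nra.
  have := mulr_ge0 (normr_ge0 (1 - z ^+ 2)) (normr_ge0 (cos (x * z))); nra.
have x0 : x != 0 by rewrite -normr_gt0; lra.
have -> : parabolic_prim x 1 - parabolic_prim x (-1) =
    4 * (sin x - x * cos x) / x ^+ 3.
  by rewrite /parabolic_prim (negPf x0) mulr1 mulrN1 sinN cosN; field.
have nx : 0 < `|x| by rewrite normr_gt0.
have h : `|sin x - x * cos x| <= 2 * `|x|.
  rewrite (le_trans (ler_normB _ _))// normrM.
  have : `|cos x| <= 1 by rewrite ler_norml cos_geN1 cos_le1.
  have : `|sin x| <= 1 by rewrite ler_norml sin_geN1 sin_le1.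
  nra.
rewrite !normrM normfV normrX ger0_norm//.
rewrite mulrAC ler_pdivrMr ?exprn_gt0//.
have q2 : (1 + `|x|) ^+ 2 <= 4 * `|x| ^+ 2 by nra.
have := normr_ge0 (sin x - x * cos x); set A := `|sin _ - _| in h *; move=> A0.
apply: (@le_trans _ _ (4 * (2 * `|x|) * (4 * `|x| ^+ 2))).
  by rewrite ler_pM// ?mulr_ge0// ?ler_wpM2l// ltW.
by rewrite le_eqVlt; apply/orP; left; apply/eqP; ring.
Qed.

Definition wt (n : nat) : R := (Num.sqrt n.+1%:R)^-1.

Lemma wt2 n : wt n ^+ 2 = n.+1%:R^-1.
Proof. by rewrite /wt exprVn sqr_sqrtr. Qed.

Lemma wt_ge0 n : 0 <= wt n. Proof. by rewrite invr_ge0 sqrtr_ge0. Qed.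

(* Comparison with the telescoping increments of u / (1 + |u|) at u = lnS n - lnS m. *)
Lemma Schur_row (m M1 M2 : nat) :
  \sum_(M1 <= n < M2) n.+1%:R^-1 / (1 + `|lnS m - lnS n|) ^+ 2 <= 8.
Proof.
pose phi (u : R) := u / (1 + `|u|).
have nz (u : R) : 0 < 1 + `|u| by rewrite ltr_pwDl.
have phi1 u : `|phi u| <= 1.
  rewrite normrM normfV (gtr0_norm (nz u)) ler_pdivrMr// mul1r.
  by rewrite lerDr.
have phiB u v : u <= v -> (v - u) / ((1 + `|u|) * (1 + `|v|)) <= phi v - phi u.
  move=> uv; rewrite ler_pdivrMr ?mulr_gt0//.
  have -> : (phi v - phi u) * ((1 + `|u|) * (1 + `|v|)) =
    v * (1 + `|u|) - u * (1 + `|v|).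
    by rewrite /phi; field; rewrite !gt_eqF.
  suff : u * `|v| <= v * `|u| by lra.
  by case: (ger0P u); case: (ger0P v); nra.
(* The factor 4 is 2 * 2: once because 1 / (n + 1) is at most twice the increment of [lnS], once
   because 1 + |v| <= 2 (1 + |u|) for an increment of at most 1. As |phi| <= 1, the telescoped sum
   is at most 8. *)
have step n : n.+1%:R^-1 / (1 + `|lnS m - lnS n|) ^+ 2 <=
    4 * phi (lnS n.+1 - lnS m) - 4 * phi (lnS n - lnS m).
  set u := lnS n - lnS m; set v := lnS n.+1 - lnS m.
  have n0 : 0 < n.+1%:R :> R by [].
  have d1 : lnS n.+1 - lnS n <= n.+1%:R^-1.
    rewrite /lnS -ln_div ?posrE//.
    have -> : n.+2%:R / n.+1%:R = 1 + n.+1%:R^-1 :> R.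
      by rewrite -[n.+2%:R]natr1; field; rewrite gt_eqF.
    by apply: le_ln1Dx; rewrite (@lt_trans _ _ 0)// invr_gt0.
  have d2 : n.+1%:R^-1 / 2 <= lnS n.+1 - lnS n.
    rewrite -[leRHS]opprB /lnS -ln_div ?posrE//.
    have -> : n.+1%:R / n.+2%:R = 1 + (- n.+2%:R^-1) :> R.
      by rewrite -[n.+2%:R]natr1; move: n0; set N := n.+1%:R => n0; field; apply: lt0r_neq0; lra.
    rewrite lerNr (le_trans (le_ln1Dx _))//.
      by rewrite ltrN2 invf_lt1// ltr1n.
    rewrite lerN2 -invfM lef_pV2 ?posrE// ?mulr_gt0//.
    by rewrite -natrM ler_nat; lia.
  have uv : u <= v.
    rewrite lerD2r /lnS ler_ln ?posrE// ler_nat; lia.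
  have vu : v - u <= 1.
    rewrite (_ : v - u = lnS n.+1 - lnS n); last by rewrite /u /v; ring.
    by rewrite (le_trans d1)// invf_le1// ler1n.
  have := phiB _ _ uv.
  rewrite (distrC (lnS m)) -/u -mulrBr => h.
  apply: (@le_trans _ _ (4 * ((v - u) / ((1 + `|u|) * (1 + `|v|))))); last first.
    by rewrite ler_wpM2l.
  have hv : 1 + `|v| <= 2 * (1 + `|u|).
    have : `|v| <= `|u| + `|v - u| by rewrite -{1}(subrK u v) addrC ler_normD.
    rewrite (ger0_norm (x := v - u)) ?subr_ge0//; have := normr_ge0 u; lra.
  have vuE : v - u = lnS n.+1 - lnS n by rewrite /u /v; ring.
  rewrite ler_pdivrMr ?exprn_gt0//.
  apply: (@le_trans _ _ (4 * ((v - u) / ((1 + `|u|) * (2 * (1 + `|u|)))) * (1 + `|u|) ^+ 2)).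
    rewrite [leRHS](_ : _ = 2 * (v - u)).
      by rewrite vuE mulrC -ler_pdivrMr.
    by field; rewrite gt_eqF.
  rewrite ler_wpM2r ?exprn_ge0//.
  rewrite ler_wpM2l// ler_wpM2l ?subr_ge0//.
  by rewrite lef_pV2 ?posrE ?mulr_gt0// ler_wpM2l// ltW.
have [M12|/ltnW M21] := leqP M1 M2; last by rewrite big_geq.
rewrite (le_trans (ler_sum_nat (fun n _ => step n)))//.
rewrite (telescope_sumr (fun n => 4 * phi (lnS n - lnS m)))//.
have := phi1 (lnS M1 - lnS m); have := phi1 (lnS M2 - lnS m).
by rewrite !ler_norml => /andP[_ +] /andP[+ _]; lra.
Qed.

End Schur_test.

(** * The local embedding on an interval of length one *)

Section Local_embedding.
Variable R : realType.
Implicit Types (a b : nat -> R) (r : seq nat).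
Local Notation mu := (@lebesgue_measure R).
Local Notation wt := (@wt R).
Local Notation lnS := (@lnS R).

Lemma is_derive_shift (F f : R -> R) (c : R) :
  (forall z : R, is_derive z 1 F (f z)) ->
  forall z : R, is_derive z 1 (fun t => F (t - c)) (f (z - c)).
Proof.
move=> dF z; have := @is_derive1_comp _ F (fun t => t - c) z (f (z - c)) 1 (dF _).
rewrite mulr1; apply.
by apply: is_derive_eq; rewrite subr0.
Qed.

Lemma continuous_shift (f : R -> R) (c : R) :
  continuous f -> continuous (fun t => f (t - c)).
Proof.
move=> cf z; apply: (@continuous_comp _ _ _ (fun t => t - c) f); last exact: cf.
by apply: cvgB; [exact: cvg_id | exact: cvg_cst].
Qed.

Lemma continuous_wave a b n : continuous (wave a b n).
Proof. exact: (is_derive_continuous (is_derive_wave a b n)). Qed.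

Lemma continuous_bigD r (f : nat -> R -> R) :
  (forall n, continuous (f n)) -> continuous (fun t => \sum_(n <- r) f n t).
Proof.
move=> cf; elim: r => [|n r ih].
  have -> : (fun t => \sum_(n <- [::]) f n t) = cst 0.
    by apply/funext => y; rewrite big_nil.
  exact: cst_continuous.
have -> : (fun y => \sum_(k <- n :: r) f k y) = f n \+ (fun y => \sum_(k <- r) f k y).
  by apply/funext => y; rewrite big_cons.
by move=> t; apply: continuousD; [exact: cf | exact: ih].
Qed.

(** Adding the square of the imaginary part completes a squared modulus; its expansion contains only
    the differences of logarithms, on which the kernel bound decays away from the diagonal. *)
Lemma wave_energy a b r s :
  (\sum_(n <- r) wave a b n s) ^+ 2 +
  (\sum_(n <- r) (b n * cos (lnS n * s) - a n * sin (lnS n * s))) ^+ 2 =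
  \sum_(m <- r) \sum_(n <- r)
    ((a m * a n + b m * b n) * cos ((lnS m - lnS n) * s) +
     (b m * a n - a m * b n) * sin ((lnS m - lnS n) * s)).
Proof.
rewrite !expr2 !big_distrl/= -big_split/=; apply: eq_bigr => m _.
rewrite !big_distrr/= -big_split/=; apply: eq_bigr => n _.
by rewrite (mulrBl s (lnS m)) cosB sinB /wave; ring.
Qed.

(** The weights are exchanged: the energy at [m] is paired with 1 / (n + 1), so that the sum over
    [n] becomes a row sum of [Schur_row]. *)
Lemma wtM m n a b : `|wt m * a m * (wt n * a n) + wt m * b m * (wt n * b n)| <=
  ((a m ^+ 2 + b m ^+ 2) / n.+1%:R + (a n ^+ 2 + b n ^+ 2) / m.+1%:R) / 2.
Proof.
rewrite -(wt2 _ m) -(wt2 _ n); move: (wt m) (wt n) (a m) (a n) (b m) (b n) => u v x y z w.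
rewrite ler_norml; apply/andP; split.
  have := sqr_ge0 (x * v + y * u); have := sqr_ge0 (z * v + w * u); lra.
have := sqr_ge0 (x * v - y * u); have := sqr_ge0 (z * v - w * u); lra.
Qed.

Definition dirichlet_poly a b r s : R := \sum_(n <- r) wt n * wave a b n s.

Lemma continuous_dirichlet_poly a b r : continuous (dirichlet_poly a b r).
Proof.
apply: continuous_bigD => n t; apply: cvgM; first exact: cvg_cst.
exact: continuous_wave.
Qed.

(* Integrating the square against a multiple of the weight 1 - s ^+ 2, whose Fourier
   transform decays quadratically, reduces the bound to Schur's test. *)
Lemma local_embedding a b (M1 M2 : nat) (t0 : R) :
  (\int[mu]_(t in `[(t0 - 2^-1)%R, (t0 + 2^-1)%R])
     (dirichlet_poly a b (index_iota M1 M2) (t - t0) ^+ 2)%:E <=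
   (342 * \sum_(M1 <= n < M2) (a n ^+ 2 + b n ^+ 2))%:E)%E.
Proof.
pose A n := wt n * a n; pose B n := wt n * b n.
set r := index_iota M1 M2.
have polyE s : dirichlet_poly a b r s = \sum_(n <- r) wave A B n s.
  by apply: eq_bigr => n _; rewrite /wave /A /B; ring.
pose E (s : R) := \sum_(m <- r) \sum_(n <- r)
    ((A m * A n + B m * B n) * cos ((lnS m - lnS n) * s) +
     (B m * A n - A m * B n) * sin ((lnS m - lnS n) * s)).
have Ege s : dirichlet_poly a b r s ^+ 2 <= E s.
  by rewrite /E -wave_energy polyE lerDl sqr_ge0.
(* The factor 4/3 makes the weight at least 1 for |s| <= 1/2, so that [f] dominates the square
   there, and [f] stays nonnegative up to |s| = 1. *)
pose f (s : R) := 4 / 3 * ((1 - s ^+ 2) * E s).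
pose F (s : R) := 4 / 3 * \sum_(m <- r) \sum_(n <- r)
    ((A m * A n + B m * B n) * parabolic_prim (lnS m - lnS n) s +
     (B m * A n - A m * B n) * parabolic_sprim (lnS m - lnS n) s).
have dF (s : R) : is_derive s 1 F (f s).
  apply: (is_deriveZ (4 / 3)).
  have -> : (1 - s ^+ 2) * E s = \sum_(m <- r) \sum_(n <- r)
    ((A m * A n + B m * B n) * ((1 - s ^+ 2) * cos ((lnS m - lnS n) * s)) +
     (B m * A n - A m * B n) * ((1 - s ^+ 2) * sin ((lnS m - lnS n) * s))).
    rewrite /E mulr_sumr; apply: eq_bigr => m _; rewrite mulr_sumr.
    by apply: eq_bigr => n _; ring.
  apply: is_derive_big => m; apply: is_derive_big => n.
  apply: is_deriveD; apply: is_deriveZ.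
    exact: is_derive_parabolic_prim.
  exact: is_derive_parabolic_sprim.
have cf : continuous f.
  move=> s; apply: cvgM; first exact: cvg_cst.
  apply: cvgM.
    apply: cvgB; first exact: cvg_cst.
    exact: exprn_continuous.
  apply: continuous_bigD => m; apply: continuous_bigD => n {}s.
  have dc := is_derive_continuous (is_derive_cosM (lnS m - lnS n)).
  have ds := is_derive_continuous (is_derive_sinM (lnS m - lnS n)).
  by apply: cvgD; (apply: cvgM; first exact: cvg_cst); [exact: dc | exact: ds].
have mf (g : R -> R) (D : set R) : measurable D -> continuous g ->
    measurable_fun D g.
  by move=> mD cg; apply: measurable_funTS; exact: continuous_measurable_fun.
have f0 s : -1 <= s <= 1 -> 0 <= f s.
  move=> s1; rewrite /f mulr_ge0// mulr_ge0//; first by nra.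
  by rewrite (le_trans _ (Ege s))// sqr_ge0.
apply: (@le_trans _ _ (\int[mu]_(t in `[(t0 - 1)%R, (t0 + 1)%R]) (f (t - t0))%:E)%E).
  apply: (@le_trans _ _ (\int[mu]_(t in `[(t0 - 2^-1)%R, (t0 + 2^-1)%R]) (f (t - t0))%:E)%E).
    apply: ge0_le_integral => //.
    - by move=> t _; rewrite lee_fin sqr_ge0.
    - apply/measurable_EFinP; apply: (mf (fun t => dirichlet_poly a b r (t - t0) ^+ 2)) => // t; apply: (@continuous_comp _ _ _ (fun t => dirichlet_poly a b r (t - t0)) (fun x => x ^+ 2)).
        exact/continuous_shift/continuous_dirichlet_poly.
      exact: exprn_continuous.
    - apply/measurable_EFinP; apply: (mf (fun t => f (t - t0))) => //; exact: continuous_shift.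
    - move=> t /=; rewrite in_itv/= => /andP[t1 t2]; rewrite lee_fin /f.
      have := Ege (t - t0); have := sqr_ge0 (dirichlet_poly a b r (t - t0)).
      set P := _ ^+ 2; set Q := E _; set u := t - t0 => P0 PQ.
      have u1 : -2^-1 <= u <= 2^-1 by apply/andP; split; rewrite /u; lra.
      have : 1 <= 4/3 * (1 - u ^+ 2) by nra.
      nra.
  apply: ge0_subset_integral => //.
  - apply/measurable_EFinP; apply: (mf (fun t => f (t - t0))) => //; exact: continuous_shift.
  - move=> t /=; rewrite in_itv/= => /andP[t1 t2]; rewrite lee_fin f0//.
    by apply/andP; split; lra.
  - by move=> t /=; rewrite !in_itv/= => /andP[t1 t2]; apply/andP; split; lra.
rewrite (FTC2_is_derive _ (is_derive_shift t0 dF)); last 2 first.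
- lra.
- exact: continuous_shift.
rewrite lee_fin.
have -> : t0 + 1 - t0 = 1 by ring.
have -> : t0 - 1 - t0 = -1 by ring.
rewrite /F -mulrBr -sumrB.
under eq_bigr do rewrite -sumrB.
pose ab n := a n ^+ 2 + b n ^+ 2.
pose k m n := (1 + `|lnS m - lnS n|) ^- 2.
have kC m n : k m n = k n m by rewrite /k distrC.
have k0 m n : 0 <= k m n by rewrite /k invr_ge0 exprn_ge0// addr_ge0.
apply: (@le_trans _ _ (4 / 3 * \sum_(m <- r) \sum_(n <- r)
  (16 * (ab m * (n.+1%:R^-1 * k m n)) + 16 * (ab n * (m.+1%:R^-1 * k n m))))).
  rewrite ler_wpM2l//; apply: ler_sum => m _; apply: ler_sum => n _.
  rewrite opprD addrACA -!mulrBr parabolic_sprim_even mulr0 addr0.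
  rewrite (le_trans (ler_norm _))// normrM.
  apply: (@le_trans _ _ ((ab m / n.+1%:R + ab n / m.+1%:R) / 2 * (32 / (1 + `|lnS m - lnS n|) ^+ 2))).
    by rewrite ler_pM//; [exact: wtM | exact: parabolic_kernel_bound].
  rewrite (kC n m) /k /=; move: (ab m) (ab n) (n.+1%:R^-1) (m.+1%:R^-1) (_ ^- 2) => x y z w u.
  lra.
under eq_bigr do rewrite big_split/=.
rewrite big_split/= [X in _ + X]exchange_big/= -mulr2n.
have row m : \sum_(n <- r) n.+1%:R^-1 * k m n <= 8 by exact: Schur_row.
(* By symmetry of the kernel both halves have the same bound, 16 * 8 = 128 times the energy, and 4/3
   * 2 * 128 = 1024/3 < 342. *)
apply: (@le_trans _ _ (4 / 3 * (\sum_(m <- r) 128 * ab m) *+ 2)).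
  rewrite -!mulrnAr ler_wpM2l// lerMn2r; apply/orP; right.
  apply: ler_sum => m _; rewrite -mulr_sumr -mulr_sumr.
  have ab0 : 0 <= ab m by rewrite addr_ge0 ?sqr_ge0.
  by have := row m; nra.
rewrite -mulr_sumr; set S := \sum_(_ <- _) _.
have S0 : 0 <= S by apply: sumr_ge0 => n _; rewrite addr_ge0 ?sqr_ge0.
rewrite -[X in _ <= 342 * X]/S -mulr_natr; lra.
Qed.

End Local_embedding.

(** * Dyadic estimates for the multipliers *)

Section Multipliers.
Variable R : realType.

Definition sinc (y : R) : R := if y == 0 then 1 else sin y / y.

(** The mean value theorem for the sine; it reduces the size of 1 - sinc y near 0 to that of 1 - cos
    z. *)
Lemma sinc_cos (y : R) : 0 <= y -> exists2 z, 0 <= z <= y & sinc y = cos z.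
Proof.
rewrite le_eqVlt => /predU1P[<-|y0].
  by exists 0; rewrite ?lexx// /sinc eqxx cos0.
have cs : {within `[0, y], continuous (@sin R)}.
  exact: continuous_subspaceT (@continuous_sin R).
have [z + E] := MVT y0 (fun x _ => is_derive_sin x) cs.
rewrite in_itv/= => /andP[z0 zy]; exists z; first by rewrite !ltW.
by move: E; rewrite sin0 !subr0 /sinc gt_eqF// => ->; rewrite mulfK// gt_eqF.
Qed.

Lemma cosB1_le (z : R) : 0 <= z -> `|1 - cos z| <= z.
Proof.
rewrite le_eqVlt => /predU1P[<-|z0]; first by rewrite cos0 subrr normr0.
have cs : {within `[0, z], continuous (@cos R)}.
  exact: continuous_subspaceT (@continuous_cos R).
have [w _] := MVT z0 (fun x _ => is_derive_cos x) cs.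
rewrite cos0 subr0 distrC => ->.
rewrite normrM normrN (gtr0_norm z0) ler_piMl ?(ltW z0)//.
by rewrite ler_norml sin_geN1 sin_le1.
Qed.

(* Telescopes along [y / 2 ^ k], so that multipliers dominated by its increments have bounded dyadic sums. *)
Definition dyadic_gap (y : R) : R := y / (1 + y) - (y / 2) / (1 + y / 2).

Lemma dyadic_gapE (y : R) : 0 <= y -> dyadic_gap y = y / ((1 + y) * (2 + y)).
Proof. by move=> y0; rewrite /dyadic_gap; field; rewrite !gt_eqF//; lra. Qed.

(** Both terms are 1 + O(y) at 0, and each is O(1/y) at infinity: the difference is at most 2 y and,
    for y >= 1, at most 2 / y. Comparison with y / ((1 + y) (2 + y)) costs a further factor 6, hence
    24. *)
Lemma steklov_mult (y : R) : 0 <= y ->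
  (expR (- y) - sinc y) ^+ 2 <= 24 * dyadic_gap y.
Proof.
move=> y0; rewrite dyadic_gapE//.
set m := expR (- y) - sinc y.
have [z /andP[z0 zy] sE] := sinc_cos y0.
have ey0 : 0 <= expR (- y) <= 1 by rewrite expR_ge0 -expR0 ler_expR; lra.
have h1 : `|m| <= 2 * y.
  have := cosB1_le z0; have := expR_ge1Dx (- y); rewrite /m sE !ler_norml.
  by move=> ? /andP[? ?]; apply/andP; split; lra.
have h2 : 1 <= y -> `|m| * y <= 2.
  move=> y1; have yp : 0 < y by lra.
  have e1 : expR (- y) * y <= 1.
    rewrite expRN mulrC ler_pdivrMr ?expR_gt0// mul1r.
    by have := expR_ge1Dx y; lra.
  have e2 : `|sinc y * y| <= 1.
    by rewrite /sinc gt_eqF// divfK ?gt_eqF// ler_norml sin_geN1 sin_le1.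
  have -> : `|m| * y = `|expR (- y) * y - sinc y * y|.
    by rewrite -mulrBl normrM (gtr0_norm yp).
  move: e2; rewrite !ler_norml => /andP[? ?].
  have : 0 <= expR (- y) * y by rewrite mulr_ge0// expR_ge0.
  by move=> ?; apply/andP; split; lra.
rewrite mulrA ler_pdivlMr; last by rewrite mulr_gt0//; lra.
have m0 := normr_ge0 m; rewrite -real_normK ?num_real//.
have [y1|y1] := leP y 1.
  have : `|m| ^+ 2 <= 4 * y ^+ 2 by nra.
  have : (1 + y) * (2 + y) <= 6 by nra.
  have : 0 <= `|m| ^+ 2 by rewrite sqr_ge0.
  set q := (1 + y) * _; set p := `|m| ^+ 2 => p0 q6 py.
  have q0 : 0 <= q by rewrite mulr_ge0//; lra.
  apply: (@le_trans _ _ (4 * y ^+ 2 * 6)); first by rewrite ler_pM.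
  nra.
have {}h2 := h2 (ltW y1).
have : (1 + y) * (2 + y) <= 6 * y ^+ 2 by nra.
set q := (1 + y) * _ => q6.
apply: (@le_trans _ _ (`|m| ^+ 2 * (6 * y ^+ 2))); first by rewrite ler_wpM2l// sqr_ge0.
have : (`|m| * y) ^+ 2 <= 4 by have := mulr_ge0 m0 y0; nra.
rewrite exprMn; nra.
Qed.

Lemma exp_coeff_le (y : R) j : 0 <= y -> y ^+ j / j`!%:R <= expR y.
Proof.
move=> y0; case: j => [|j].
  by rewrite expr0 fact0 divr1; have := expR_ge1Dx y; lra.
by rewrite (le_trans _ (expR_ge1Dxn j y0))// lerDr.
Qed.

Lemma exp_partial_le (y : R) J : 0 <= y ->
  \sum_(0 <= j < J) y ^+ j / j`!%:R <= expR y.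
Proof.
move=> y0; rewrite /expR.
have -> : \sum_(0 <= j < J) y ^+ j / j`!%:R = series (exp_coeff y) J by [].
apply: nondecreasing_cvgn_le; last exact: is_cvg_series_exp_coeff.
by apply: nondecreasing_series => n _ _; rewrite /exp_coeff/= divr_ge0// exprn_ge0.
Qed.

(** Each y^j / j! * exp(- y) lies in [0, 1], so its square is at most itself, and the weights 2^-j
    sum the series to exp(- y) (exp(y / 2) - 1). This is O(y) at 0 and decays exponentially. *)
Lemma taylor_mult (y : R) J : 0 <= y ->
  \sum_(1 <= j < J) 2^-1 ^+ j * (y ^+ j / j`!%:R * expR (- y)) ^+ 2 <=
  4 * dyadic_gap y.
Proof.
move=> y0; rewrite dyadic_gapE//.
apply: (@le_trans _ _ (expR (- y) * (expR (y / 2) - 1))).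
  case: J => [|J].
    rewrite big_geq// mulr_ge0 ?expR_ge0// subr_ge0.
    by rewrite -expR0 ler_expR divr_ge0.
  have := @exp_partial_le (y / 2) J.+1 (divr_ge0 y0 (ler0n R 2)).
  rewrite big_ltn// expr0 fact0 divr1 -lerBrDl => h.
  apply: le_trans (ler_wpM2l (expR_ge0 (- y)) h).
  rewrite mulr_sumr; apply: ler_sum => j _.
  rewrite [(y / 2) ^+ j]exprMn !exprVn expr2.
  have p1 : y ^+ j / j`!%:R * expR (- y) <= 1.
    by rewrite expRN ler_pdivrMr ?expR_gt0// mul1r exp_coeff_le.
  have p0 : 0 <= y ^+ j / j`!%:R * expR (- y).
    by rewrite mulr_ge0 ?expR_ge0// divr_ge0// exprn_ge0.
  have : 0 <= (2 ^- j : R) by rewrite invr_ge0 exprn_ge0.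
  set p := y ^+ j / j`!%:R * expR (- y) in p0 p1 * => c0.
  rewrite [leRHS](_ : _ = 2 ^- j * p); last by rewrite /p; ring.
  by rewrite ler_wpM2l// ler_piMl.
set v := y / 2; have yE : y = v + v by rewrite /v; field.
have v0 : 0 <= v by rewrite divr_ge0.
have ev := expR_ge1Dxn 1 v0; have ev1 := expR_ge1Dx (- v).
have ep : 0 < expR (- v) by rewrite expR_gt0.
have eE : expR (- v) * expR v = 1 by rewrite -expRD addNr expR0.
have -> : expR (- y) * (expR v - 1) = expR (- v) * (1 - expR (- v)).
  by rewrite yE opprD expRD mulrBr -mulrA eE; ring.
rewrite mulrA ler_pdivlMr; last by rewrite mulr_gt0//; lra.
rewrite yE; have ev2 : expR (- v) * (1 + v + v ^+ 2 / 2) <= 1.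
  rewrite -[leRHS]eE ler_wpM2l ?(ltW ep)//.
  have : v + v ^+ 2 / 2 <= expR v - 1.
    have := exp_partial_le 3 v0; rewrite !big_nat_recr//= big_geq//.
    rewrite expr0 expr1 add0r !factE/= !muln1 !divr1; lra.
  lra.
apply: (@le_trans _ _ (expR (- v) * v * ((1 + (v + v)) * (2 + (v + v))))).
  by rewrite ler_wpM2r// ?mulr_ge0//; [lra|lra|rewrite ler_wpM2l ?(ltW ep)//; lra].
have : 2 * v * (4 * (expR (- v) * (1 + v + v ^+ 2 / 2))) <= 2 * v * 4.
  by rewrite ler_wpM2l ?mulr_ge0//; lra.
have : 0 <= v * expR (- v) by rewrite mulr_ge0 ?expR_ge0.
have : 0 <= v * (v * expR (- v)) by rewrite !mulr_ge0 ?expR_ge0.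
have : 0 <= v ^+ 2 * (v * expR (- v)) by rewrite !mulr_ge0 ?expR_ge0 ?sqr_ge0.
lra.
Qed.

(** The scales start at 1/4: for |t - t0| <= 1/4 the interval of radius h <= 1/4 around t then stays
    in the window of radius 1/2 around t0 on which the local embedding is available. *)
Definition scale (k : nat) : R := 4^-1 * 2^-1 ^+ k.

Lemma scale_gt0 k : 0 < scale k.
Proof. by rewrite mulr_gt0// ?exprn_gt0// invr_gt0. Qed.

Lemma scaleS k : scale k.+1 = scale k / 2.
Proof. by rewrite /scale exprS; ring. Qed.

Lemma sum_dyadic_gap (x : R) K : 0 <= x ->
  \sum_(0 <= k < K) dyadic_gap (scale k * x) <= 1.
Proof.
move=> x0; pose psi (y : R) := - (y / (1 + y)).
under eq_bigr => k _.
  rewrite (_ : dyadic_gap _ = psi (scale k.+1 * x) - psi (scale k * x)).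
    over.
  by rewrite /psi scaleS [scale k / 2 * x]mulrAC /dyadic_gap; ring.
rewrite (telescope_sumr (fun k => psi (scale k * x)))//.
have p k : 0 <= scale k * x by rewrite mulr_ge0// ltW// scale_gt0.
have h1 : 0 <= scale K * x / (1 + scale K * x) by rewrite divr_ge0// addr_ge0.
have h2 : scale 0 * x / (1 + scale 0 * x) <= 1.
  by rewrite ler_pdivrMr ?mul1r; have := p 0%N; lra.
rewrite /psi; lra.
Qed.

Lemma scale_between (h : R) : 0 < h <= 4^-1 ->
  exists k, scale k.+1 <= h <= scale k.
Proof.
move=> /andP[h0 h1].
have [N hN] : exists N, scale N < h.
  have /cvgrPdist_lt/(_ h h0) : scale n @[n --> \oo] --> 0.
    rewrite -[X in _ --> X](mulr0 4^-1); apply: cvgM; first exact: cvg_cst.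
    by apply: cvg_expr; rewrite ger0_norm// invf_lt1// ltr1n.
  move=> [N _ /(_ N (leqnn N))]/=; rewrite sub0r normrN gtr0_norm ?scale_gt0// => ?.
  by exists N.
have ex : exists n, scale n < h by exists N.
case: (ex_minnP ex) => -[|k] hk mk.
  by move: hk; rewrite /scale expr0 mulr1 ltNge h1.
exists k; rewrite ltW//= leNgt; apply/negP => /mk; rewrite ltnn//.
Qed.

End Multipliers.

(** * The weak type maximal inequality for one block *)

Section Maximal.
Variable R : realType.
Implicit Types (a b c : nat -> R) (r : seq nat) (t : R).
Local Notation mu := (@lebesgue_measure R).
Local Notation wt := (@wt R).
Local Notation lnS := (@lnS R).

Definition wave_prim a b n (s : R) : R :=
  if lnS n == 0 then a n * s
  else (a n * sin (lnS n * s) - b n * cos (lnS n * s)) / lnS n.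

Lemma is_derive_wave_prim a b n (s : R) :
  is_derive s 1 (wave_prim a b n) (wave a b n s).
Proof.
have dc := is_derive_cosM (lnS n) s; have ds := is_derive_sinM (lnS n) s.
rewrite /wave /wave_prim; have [E|x0] := eqVneq (lnS n) 0.
  by apply: is_derive_eq; rewrite E !mul0r cos0 sin0 mulr0 mulr1 addr0 /GRing.scale/= mulr1.
by apply: is_derive_eq; rewrite /GRing.scale/=; field.
Qed.

Lemma wave_prim_sub a b n (s h : R) : 0 < h ->
  wave_prim a b n (s + h) - wave_prim a b n (s - h) =
  2 * h * (sinc (h * lnS n) * wave a b n s).
Proof.
move=> h0; rewrite /wave_prim /sinc mulf_eq0 (gt_eqF h0)/=.
rewrite /wave; have [E|x0] := eqVneq (lnS n) 0.
  rewrite E !mul0r cos0 sin0. ring.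
have -> : lnS n * (s + h) = lnS n * s + h * lnS n by ring.
have -> : lnS n * (s - h) = lnS n * s - h * lnS n by ring.
rewrite sinD sinB cosD cosB; field.
by rewrite x0 gt_eqF.
Qed.

Definition multiplier_poly (c : nat -> R) a b r s : R :=
  dirichlet_poly (fun n => c n * a n) (fun n => c n * b n) r s.

Lemma multiplier_polyE c a b r s :
  multiplier_poly c a b r s = \sum_(n <- r) c n * (wt n * wave a b n s).
Proof. by apply: eq_bigr => n _; rewrite /wave; ring. Qed.

(** [sinc] is the Fourier transform of the uniform probability density on [-1, 1], hence the
    multiplier of the mean over an interval of radius h. *)
Lemma steklov_avg a b r t0 (t h : R) : 0 < h ->
  (\int[mu]_(s in `[(t - h)%R, (t + h)%R]) (dirichlet_poly a b r (s - t0))%:E =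
   (2 * h * multiplier_poly (fun n => sinc (h * lnS n)) a b r (t - t0))%:E)%E.
Proof.
move=> h0.
pose F (s : R) := \sum_(n <- r) wt n * wave_prim a b n s.
have dF (s : R) : is_derive s 1 F (dirichlet_poly a b r s).
  apply: is_derive_big => n; apply: is_deriveZ.
  exact: is_derive_wave_prim.
rewrite (FTC2_is_derive _ (is_derive_shift t0 dF)).
- congr EFin; rewrite multiplier_polyE /F -sumrB mulr_sumr; apply: eq_bigr => n _.
  rewrite -mulrBr (_ : t + h - t0 = t - t0 + h); last by ring.
  by rewrite (_ : t - h - t0 = t - t0 - h) ?wave_prim_sub//; ring.
- lra.
- exact/continuous_shift/continuous_dirichlet_poly.
Qed.

Section block.
Variables (a b : nat -> R) (M1 M2 : nat) (t0 : R).
Let r := index_iota M1 M2.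
Let I := `[t0 - 2^-1, t0 + 2^-1]%classic : set R.
(** Cutting off outside the window makes the function integrable on the line, so that the weak type
    inequality only sees the L^1 norm on the window. *)
Let g : R -> R := (fun t => dirichlet_poly a b r (t - t0)) \_ I.

Let cp c : continuous (fun t => multiplier_poly c a b r (t - t0)).
Proof. exact/continuous_shift/continuous_dirichlet_poly. Qed.

Let cp1 : continuous (fun t => dirichlet_poly a b r (t - t0)).
Proof. exact/continuous_shift/continuous_dirichlet_poly. Qed.

Let poly_integrable : mu.-integrable I (EFin \o (fun t => dirichlet_poly a b r (t - t0))).
Proof.
apply: continuous_compact_integrable; first exact: segment_compact.
exact: continuous_subspaceT.
Qed.

Lemma HL_block_locint : locally_integrable setT g.
Proof. exact: integrable_locally_restrict (measurable_itv _) poly_integrable. Qed.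

Lemma steklov_le_HL (t h l : R) : 0 < h <= 4^-1 -> `|t - t0| <= 4^-1 ->
  (HL_maximal g t <= l%:E)%E ->
  `|multiplier_poly (fun n => sinc (h * lnS n)) a b r (t - t0)| <= l.
Proof.
move=> /andP[h0 h1] tt HL; rewrite -lee_fin.
have tI : ball t h `<=` I.
  move=> s; rewrite ball_itv/= in_itv/= => /andP[s1 s2].
  by rewrite /I/= in_itv/=; move: tt; rewrite ler_norml => /andP[? ?]; apply/andP; split; lra.
apply: le_trans HL; apply: (@le_trans _ _ (iavg g (ball t h))); last first.
  by apply: ereal_sup_ubound => /=; exists h => //; rewrite in_itv/= h0.
rewrite /iavg lebesgue_measure_ball ?(ltW h0)// inver -mulr_natl gt_eqF ?mulr_gt0//.
have mp D : measurable D -> measurable_fun D (EFin \o (fun s => dirichlet_poly a b r (s - t0))).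
  move=> mD; apply/measurable_EFinP; apply: measurable_funTS.
  exact: continuous_measurable_fun.
have -> : (\int[mu]_(y in ball t h) `|(g y)%:E| =
    \int[mu]_(y in `[(t - h)%R, (t + h)%R]) `|(dirichlet_poly a b r (y - t0))%:E|)%E.
  rewrite [RHS]integral_itv_bndoo; last first.
    by apply: measurableT_comp => //; exact: mp.
  rewrite -ball_itv; apply: eq_integral => y /set_mem yB.
  by rewrite /g patchE mem_set//=; exact: tI.
have := le_abse_integral mu (measurable_itv `[(t - h)%R, (t + h)%R]) (mp _ (measurable_itv _)).
rewrite /= steklov_avg//= normrM gtr0_norm ?mulr_gt0// => le.
by rewrite lee_pdivlMl ?mulr_gt0// -EFinM.
Qed.

Variables (A l : R).
Hypotheses (A0 : 0 < A) (l0 : 0 < l).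
Hypothesis hA : \sum_(M1 <= n < M2) (a n ^+ 2 + b n ^+ 2) <= A ^+ 2.

Let mI : measurable I. Proof. exact: measurable_itv. Qed.

Let mpoly_measurable c (D : set R) : measurable D ->
  measurable_fun D (fun t : R => multiplier_poly c a b r (t - t0)).
Proof.
by move=> mD; apply: measurable_funTS; apply: continuous_measurable_fun; exact: cp.
Qed.

Let poly_measurable (D : set R) : measurable D ->
  measurable_fun D (fun t : R => dirichlet_poly a b r (t - t0)).
Proof.
by move=> mD; apply: measurable_funTS; apply: continuous_measurable_fun; exact: cp1.
Qed.

Let muI : mu I = 1%:E.
Proof.
rewrite lebesgue_measure_itv/= lte_fin ifT; last lra.
by rewrite -EFinB; congr EFin; lra.
Qed.

(** The pointwise inequality |x| <= A/2 + x^2 / (2 A) plays the part of Cauchy-Schwarz on a window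
    of measure 1; the constant is 1/2 + 342/2 = 171.5. *)
Let L1_bound : (\int[mu]_(t in I) `|dirichlet_poly a b r (t - t0)|%:E <= (172 * A)%:E)%E.
Proof.
apply: (@le_trans _ _ (\int[mu]_(t in I)
    ((A / 2)%:E + (2 * A)^-1%:E * (dirichlet_poly a b r (t - t0) ^+ 2)%:E))%E).
  apply: ge0_le_integral => //.
  - by apply/measurable_EFinP/measurableT_comp => //; exact: poly_measurable.
  - apply: emeasurable_funD => //; apply: emeasurable_funM => //.
    by apply/measurable_EFinP/measurable_funX; exact: poly_measurable.
  - move=> t _; rewrite -EFinM -EFinD lee_fin.
    set x := dirichlet_poly _ _ _ _; have := sqr_ge0 (`|x| - A).
    rewrite sqrrB real_normK ?num_real// => h.
    rewrite -(ler_pM2l (x := 2 * A)) ?mulr_gt0// mulrDr mulVKf ?gt_eqF ?mulr_gt0//.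
    nra.
rewrite ge0_integralD//; last 3 first.
- by move=> t _; rewrite lee_fin divr_ge0// ltW.
- by move=> t _; rewrite mule_ge0// lee_fin ?sqr_ge0// invr_ge0 mulr_ge0// ltW.
- apply: emeasurable_funM => //.
  by apply/measurable_EFinP/measurable_funX; exact: poly_measurable.
rewrite integral_cst// [X in (_ * X + _)%E]muI mule1 ge0_integralZl_EFin//; last 3 first.
- by move=> t _; rewrite lee_fin sqr_ge0.
- by apply/measurable_EFinP/measurable_funX; exact: poly_measurable.
- by rewrite invr_ge0 mulr_ge0// ltW.
apply: (@le_trans _ _ ((A / 2)%:E + (2 * A)^-1%:E * (342 * A ^+ 2)%:E)%E).
  rewrite leeD2l// lee_wpmul2l//; first by rewrite lee_fin invr_ge0 mulr_ge0// ltW.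
  apply: le_trans (local_embedding _ _ _ _ _) _; rewrite lee_fin.
  exact: (ler_wpM2l (ler0n R 342) hA).
rewrite -EFinM -EFinD lee_fin.
rewrite (_ : (2 * A)^-1 * (342 * A ^+ 2) = 171 * A); last by field; rewrite gt_eqF.
have := A0.
lra.
Qed.

Lemma HL_block_measure :
  (mu [set t | (HL_maximal g t > l%:E)%E] <= (516 * A / l)%:E)%E.
Proof.
rewrite (le_trans (maximal_inequality HL_block_locint l0))//.
(* The 3 is the weak type constant of the Hardy-Littlewood maximal function, and 516 = 3 * 172. *)
have -> : (516 * A / l)%:E = ((3 / l)%:E * (172 * A)%:E)%E.
  by rewrite -EFinM; congr EFin; field; rewrite gt_eqF.
rewrite lee_wpmul2l//; first by rewrite lee_fin divr_ge0// ltW.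
apply: le_trans L1_bound; rewrite [leRHS]integral_mkcond.
rewrite le_eqVlt; apply/orP; left; apply/eqP; apply: eq_integral => t _.
by rewrite /g !patchE; case: ifP => //=; rewrite normr0.
Qed.

Definition mult_steklov (k n : nat) : R :=
  expR (- (scale R k * lnS n)) - sinc (scale R k * lnS n).

Definition mult_taylor (k j n : nat) : R :=
  (scale R k * lnS n) ^+ j / j`!%:R * expR (- (scale R k * lnS n)).

(* Square function over the dyadic scales h = 4^-1 * 2^-k: the first term compares the
   dilation by exp(-h lnS n) with the Steklov mean over [t - h, t + h], the others are the
   Taylor coefficients of the dilation in h. *)
Definition sqfun (K : nat) (s : R) : R :=
  \sum_(0 <= k < K) (multiplier_poly (mult_steklov k) a b r s ^+ 2 +
    \sum_(1 <= j < K) 2^-1 ^+ j * multiplier_poly (mult_taylor k j) a b r s ^+ 2).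

Let mpoly_bound c :
  (\int[mu]_(t in I) (multiplier_poly c a b r (t - t0) ^+ 2)%:E <=
   (342 * \sum_(M1 <= n < M2) c n ^+ 2 * (a n ^+ 2 + b n ^+ 2))%:E)%E.
Proof.
apply: le_trans (local_embedding _ _ _ _ _) _; rewrite lee_fin.
apply: (ler_wpM2l (ler0n R 342)).
by under eq_bigr do rewrite !exprMn -mulrDr.
Qed.

Let mpoly2_measurable c : measurable_fun I (fun t : R => (multiplier_poly c a b r (t - t0) ^+ 2)%:E).
Proof. by apply/measurable_EFinP/measurable_funX; exact: mpoly_measurable. Qed.

Lemma sqfun_bound K :
  (\int[mu]_(t in I) (sqfun K (t - t0))%:E <= (9576 * A ^+ 2)%:E)%E.
Proof.
have sqE t : ((sqfun K (t - t0))%:E = \sum_(0 <= k < K)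
   ((multiplier_poly (mult_steklov k) a b r (t - t0) ^+ 2)%:E +
    \sum_(1 <= j < K) (2^-1 ^+ j)%:E * (multiplier_poly (mult_taylor k j) a b r (t - t0) ^+ 2)%:E))%E.
  rewrite /sqfun -sumEFin; apply: eq_bigr => k _; rewrite EFinD; congr (_ + _)%E.
  by rewrite -sumEFin; apply: eq_bigr => j _; rewrite EFinM.
under eq_integral do rewrite sqE.
have c0 j : 0 <= 2^-1 ^+ j :> R by rewrite exprn_ge0// invr_ge0.
rewrite ge0_integral_sum//; last 2 first.
- move=> k; apply: emeasurable_funD; first exact: mpoly2_measurable.
  by apply: emeasurable_sum => j; apply: emeasurable_funM => //; exact: mpoly2_measurable.
- move=> k t _; rewrite adde_ge0 ?lee_fin ?sqr_ge0//.
  by apply: sume_ge0 => j _; rewrite mule_ge0 ?lee_fin ?sqr_ge0.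
(* The 28 adds the constants 24 of [steklov_mult] and 4 of [taylor_mult]. The sum over [k] of the
   gaps is then at most 1, and 342 * 28 = 9576. *)
apply: (@le_trans _ _ (\sum_(0 <= k < K) (342 * \sum_(M1 <= n < M2)
    (28 * dyadic_gap (scale R k * lnS n)) * (a n ^+ 2 + b n ^+ 2))%:E)%E).
  apply: lee_sum => k _.
  rewrite ge0_integralD//; last 4 first.
  - by move=> t _; rewrite lee_fin sqr_ge0.
  - exact: mpoly2_measurable.
  - by move=> t _; apply: sume_ge0 => j _; rewrite mule_ge0 ?lee_fin ?sqr_ge0.
  - by apply: emeasurable_sum => j; apply: emeasurable_funM => //; exact: mpoly2_measurable.
  rewrite ge0_integral_sum//; last 2 first.
  - by move=> j; apply: emeasurable_funM => //; exact: mpoly2_measurable.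
  - by move=> j t _; rewrite mule_ge0 ?lee_fin ?sqr_ge0.
  apply: (@le_trans _ _ ((342 * \sum_(M1 <= n < M2)
      mult_steklov k n ^+ 2 * (a n ^+ 2 + b n ^+ 2))%:E + \sum_(1 <= j < K)
      (2^-1 ^+ j * (342 * \sum_(M1 <= n < M2) mult_taylor k j n ^+ 2 * (a n ^+ 2 + b n ^+ 2)))%:E)%E).
    apply: leeD; first exact: mpoly_bound.
    apply: lee_sum => j _; rewrite ge0_integralZl_EFin//; last 2 first.
    - by move=> t _; rewrite lee_fin sqr_ge0.
    - exact: mpoly2_measurable.
    by rewrite EFinM lee_wpmul2l ?lee_fin//; exact: mpoly_bound.
  rewrite sumEFin -EFinD lee_fin.
  under [X in _ + X <= _]eq_bigr do rewrite mulrCA mulr_sumr.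
  rewrite -mulr_sumr -mulrDr; apply: (ler_wpM2l (ler0n R 342)).
  rewrite exchange_big/= -big_split/=; apply: ler_sum => n _.
  under eq_bigr do rewrite mulrA.
  rewrite -mulr_suml -mulrDl ler_wpM2r ?addr_ge0 ?sqr_ge0//.
  have y0 : 0 <= scale R k * lnS n by rewrite mulr_ge0 ?lnS_ge0// ltW// scale_gt0.
  have := steklov_mult y0; have := taylor_mult K y0.
  rewrite -/(mult_steklov k n); lra.
rewrite sumEFin lee_fin -mulr_sumr exchange_big/=.
under eq_bigr do rewrite -mulr_suml -mulr_sumr.
apply: (@le_trans _ _ (342 * \sum_(M1 <= n < M2) 28 * (a n ^+ 2 + b n ^+ 2))).
  apply: (ler_wpM2l (ler0n R 342)); apply: ler_sum => n _; rewrite ler_wpM2r ?addr_ge0 ?sqr_ge0//.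
  by have := sum_dyadic_gap K (lnS_ge0 R n); lra.
rewrite -mulr_sumr; have := hA; rewrite -/r; lra.
Qed.

Lemma sqfun_nd K L s : (K <= L)%N -> sqfun K s <= sqfun L s.
Proof.
move=> KL; have c0 j : 0 <= 2^-1 ^+ j :> R by rewrite exprn_ge0// invr_ge0.
have t0' k j : 0 <= 2^-1 ^+ j * multiplier_poly (mult_taylor k j) a b r s ^+ 2.
  by rewrite mulr_ge0// sqr_ge0.
rewrite /sqfun [leRHS](big_cat_nat (n := K))//= -[leLHS]addr0 lerD//.
  apply: ler_sum => k _; rewrite lerD2l.
  case: K KL => [|K] KL; first by rewrite [leLHS]big_geq// sumr_ge0.
  by rewrite [leRHS](big_cat_nat (n := K.+1))//= lerDl sumr_ge0.
by apply: sumr_ge0 => k _; rewrite addr_ge0 ?sqr_ge0// sumr_ge0.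
Qed.

Let sqfun_ge0 K s : 0 <= sqfun K s.
Proof. by rewrite (le_trans _ (sqfun_nd s (leq0n K)))// /sqfun big_geq. Qed.

Let sqfun_measurable K (D : set R) : measurable D ->
  measurable_fun D (fun t : R => sqfun K (t - t0)).
Proof.
move=> mD; apply: measurable_sum => k; apply: measurable_funD.
  by apply: measurable_funX; exact: mpoly_measurable.
apply: measurable_sum => j; apply: measurable_funM => //.
by apply: measurable_funX; exact: mpoly_measurable.
Qed.

Definition sqfun_large (K : nat) : set R := I `&` [set t | l ^+ 2 < sqfun K (t - t0)].

Let sqfun_large_measurable K : measurable (sqfun_large K).
Proof.
rewrite /sqfun_large; have := sqfun_measurable K mI.
move=> /(_ mI `]l ^+ 2, +oo[%classic (measurable_itv _)).
by congr measurable; congr setI; apply/seteqP; split => t /=; rewrite in_itv/= andbT.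
Qed.

Let sqfun_large_measure K : (mu (sqfun_large K) <= (9576 * A ^+ 2 / l ^+ 2)%:E)%E.
Proof.
have l2 : 0 < l ^+ 2 by rewrite exprn_gt0.
have h : ((l ^+ 2)%:E * mu (I `&` [set t : R | (`|(sqfun K (t - t0))%:E| >= (l ^+ 2)%:E)%E])
    <= \int[mu]_(t in I) `|(sqfun K (t - t0))%:E|)%E.
  apply: (@le_integral_comp_abse _ _ R mu I mI (fun t : R => (sqfun K (t - t0))%:E) _ id) => //.
  by apply/measurable_EFinP; exact: sqfun_measurable.
rewrite mulrC EFinM -lee_pdivrMl// ?invr_gt0// invrK.
apply: (@le_trans _ _ (\int[mu]_(x in I) `|(sqfun K (x - t0))%:E|)%E).
  apply: le_trans h; rewrite lee_wpmul2l ?lee_fin ?(ltW l2)//.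
  apply: le_measure; rewrite ?inE//.
  - exact: sqfun_large_measurable.
  - apply: emeasurable_fun_c_infty => //.
    apply/measurable_EFinP; apply: measurableT_comp => //.
    exact: sqfun_measurable.
  move=> t [It lt]; split => //=; rewrite lee_fin ger0_norm//.
  by rewrite ltW.
under eq_integral do rewrite abse_EFin ger0_norm//.
exact: sqfun_bound.
Qed.

(** A single scale is one summand of the square function. Passing from squares to absolute values is
    Cauchy-Schwarz for the weights 2^-j, whose sum is at most 1, in the form |x| <= l/2 + x^2 / (2
    l). *)
Let mpoly_taylor_le k s : (forall K, sqfun K s <= l ^+ 2) ->
  `|multiplier_poly (mult_steklov k) a b r s| <= l /\
  forall J, \sum_(1 <= j < J) 2^-1 ^+ j * `|multiplier_poly (mult_taylor k j) a b r s| <= l.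
Proof.
move=> sq; have c0 j : 0 <= 2^-1 ^+ j :> R by rewrite exprn_ge0// invr_ge0.
have q0 k' j : 0 <= 2^-1 ^+ j * multiplier_poly (mult_taylor k' j) a b r s ^+ 2.
  by rewrite mulr_ge0// sqr_ge0.
have hK K : (k < K)%N -> multiplier_poly (mult_steklov k) a b r s ^+ 2 +
    \sum_(1 <= j < K) 2^-1 ^+ j * multiplier_poly (mult_taylor k j) a b r s ^+ 2 <= l ^+ 2.
  move=> kK; apply: le_trans (sq K); rewrite /sqfun.
  rewrite [leRHS](big_cat_nat (n := k) (p := K))//= ?(ltnW kK)//.
  rewrite [X in _ <= _ + X]big_ltn// addrCA lerDl addr_ge0// sumr_ge0// => i _.
    by rewrite addr_ge0 ?sqr_ge0// sumr_ge0.
  by rewrite addr_ge0 ?sqr_ge0// sumr_ge0.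
split.
  rewrite -ler_sqr ?nnegrE ?(ltW l0)// real_normK ?num_real//.
  by apply: le_trans (hK k.+1 (ltnSn k)); rewrite lerDl sumr_ge0.
(* The truncation must exceed [k] for the scale to occur, and reach [J] for all Taylor terms to
   occur. *)
move=> J; have {}hK := hK _ (leq_maxl k.+1 J).
have {hK} : \sum_(1 <= j < J) 2^-1 ^+ j * multiplier_poly (mult_taylor k j) a b r s ^+ 2 <= l ^+ 2.
  apply: le_trans hK; rewrite -[leLHS]add0r lerD ?sqr_ge0//.
  case: J => [|J]; first by rewrite [leLHS]big_geq// sumr_ge0.
  by rewrite [leRHS](big_cat_nat (n := J.+1))//= ?leq_maxr// lerDl sumr_ge0.
have half : \sum_(1 <= j < J) 2^-1 ^+ j <= 1 :> R.
  under eq_bigr => j _.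
    rewrite (_ : 2^-1 ^+ j = (- (2 * 2^-1 ^+ j.+1)) - (- (2 * 2^-1 ^+ j)) :> R).
      over.
    by rewrite exprS; field.
  case: J => [|J]; first by rewrite big_geq.
  rewrite (telescope_sumr (fun j => - (2 * 2^-1 ^+ j)))//.
  have := c0 J.+1; rewrite expr1; lra.
move=> sqJ; apply: (@le_trans _ _ (\sum_(1 <= j < J)
   (l / 2 * 2^-1 ^+ j + (2 * l)^-1 * (2^-1 ^+ j * multiplier_poly (mult_taylor k j) a b r s ^+ 2)))).
  apply: ler_sum => j _; set x := multiplier_poly _ _ _ _ _.
  rewrite [leRHS](_ : _ = 2^-1 ^+ j * (l / 2 + (2 * l)^-1 * x ^+ 2)); last by ring.
  rewrite ler_wpM2l//; have := sqr_ge0 (`|x| - l).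
  rewrite sqrrB real_normK ?num_real// => h.
  rewrite -(ler_pM2l (x := 2 * l)) ?mulr_gt0// mulrDr mulVKf ?gt_eqF ?mulr_gt0//.
  have := l0; nra.
rewrite big_split/= -!mulr_sumr.
have : (2 * l)^-1 * (\sum_(1 <= j < J) 2^-1 ^+ j * multiplier_poly (mult_taylor k j) a b r s ^+ 2) <= (2 * l)^-1 * l ^+ 2.
  by rewrite ler_wpM2l// invr_ge0 mulr_ge0// ltW.
have -> : (2 * l)^-1 * l ^+ 2 = l / 2 by field; rewrite gt_eqF.
have : l / 2 * (\sum_(1 <= j < J) 2^-1 ^+ j) <= l / 2 * 1.
  by rewrite ler_wpM2l// divr_ge0// ltW.
lra.
Qed.

(** The j-th Taylor term of exp((s - h) x), multiplied by exp(- s x), is e^j times [mult_taylor]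
    with e = (s - h) / s. Since h is at least the next scale s / 2, e <= 1/2 and the weights 2^-j
    dominate the e^j. *)
Let taylor_sum k h s J : scale R k.+1 <= h <= scale R k ->
  (forall K, sqfun K s <= l ^+ 2) ->
  `|multiplier_poly (fun n => expR (- (scale R k * lnS n)) *
      \sum_(0 <= j < J.+1) ((scale R k - h) * lnS n) ^+ j / j`!%:R) a b r s -
    multiplier_poly (fun n => expR (- (scale R k * lnS n))) a b r s| <= l.
Proof.
move=> /andP[h1 h2] sq; have [_ /(_ J.+1)] := mpoly_taylor_le k sq.
apply: le_trans.
have sk := scale_gt0 R k.
pose e := (scale R k - h) / scale R k.
have e0 : 0 <= e by rewrite divr_ge0 ?subr_ge0// ltW.
have e1 : e <= 2^-1 by rewrite ler_pdivrMr//; move: h1; rewrite scaleS; lra.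
rewrite !multiplier_polyE -sumrB.
rewrite [X in `|X|](_ : _ = \sum_(1 <= j < J.+1) e ^+ j * multiplier_poly (mult_taylor k j) a b r s).
  rewrite (le_trans (ler_norm_sum _ _ _))//; apply: ler_sum => j _.
  rewrite normrM ler_wpM2r// ger0_norm ?exprn_ge0//.
  by rewrite lerXn2r// nnegrE invr_ge0.
under [RHS]eq_bigr do rewrite multiplier_polyE mulr_sumr.
rewrite exchange_big/=; apply: eq_bigr => n _.
rewrite big_ltn// expr0 fact0 divr1 mulrDr mulr1 mulrDl addrAC subrr add0r.
rewrite mulr_sumr mulr_suml; apply: eq_bigr => j _.
rewrite /mult_taylor /e; move: (scale R k) sk => c c0.
rewrite !exprMn exprVn; field.
by rewrite expf_neq0 ?gt_eqF//= pnatr_eq0 -lt0n fact_gt0.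
Qed.

(** One [l] each for the Steklov mean, for its distance to the dilation at the dyadic scale, and for
    the Taylor sums, in which the number of terms then tends to infinity. *)
Let pointwise_bound t h : `|t - t0| <= 4^-1 -> (HL_maximal g t <= l%:E)%E ->
  (forall K, sqfun K (t - t0) <= l ^+ 2) -> 0 < h <= 4^-1 ->
  `|multiplier_poly (fun n => expR (- (h * lnS n))) a b r (t - t0)| <= 3 * l.
Proof.
move=> tt HL sq h0; have [k hk] := scale_between h0.
set s := t - t0.
have sk : 0 < scale R k <= 4^-1.
  by rewrite scale_gt0/= /scale ler_piMr// exprn_ile1// invf_le1// ler1n.
have b1 := steklov_le_HL sk tt HL.
have [b2 _] := mpoly_taylor_le k sq.
have b12 : `|multiplier_poly (fun n => expR (- (scale R k * lnS n))) a b r s| <= 2 * l.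
  have -> : multiplier_poly (fun n => expR (- (scale R k * lnS n))) a b r s =
      multiplier_poly (mult_steklov k) a b r s + multiplier_poly (fun n => sinc (scale R k * lnS n)) a b r s.
    by rewrite !multiplier_polyE -big_split; apply: eq_bigr => n _; rewrite /mult_steklov/=; ring.
  by rewrite (le_trans (ler_normD _ _))//; lra.
pose u J := multiplier_poly (fun n => expR (- (scale R k * lnS n)) *
      \sum_(0 <= j < J.+1) ((scale R k - h) * lnS n) ^+ j / j`!%:R) a b r s.
have ub J : `|u J| <= 3 * l.
  have := taylor_sum J hk sq; rewrite -/s -/(u J).
  set m := multiplier_poly _ _ _ _ _ in b12 * => ul.
  rewrite -(subrK m (u J)) (le_trans (ler_normD _ _))//; lra.
have cu : u J @[J --> \oo] --> multiplier_poly (fun n => expR (- (h * lnS n))) a b r s.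
  rewrite multiplier_polyE; under eq_fun do rewrite /u multiplier_polyE.
  apply: cvg_big => [|n _]; first exact: add_continuous.
  apply: cvgMl.
  rewrite (_ : - (h * lnS n) = - (scale R k * lnS n) + (scale R k - h) * lnS n); last by ring.
  rewrite expRD; apply: cvgMr.
  have := @is_cvg_series_exp_coeff R ((scale R k - h) * lnS n).
  by rewrite -(cvg_shiftS (series _)).
apply: (cvgr_to_le (cvg_norm cu)).
by near=> J; exact: ub.
Unshelve. all: by end_near. Qed.

(** [E] is chosen before [h], which is what makes this a maximal inequality. It joins the points of
    large maximal function to those of large square function; the latter form an increasing union
    over the truncations, so their uniform bound survives. *)
Lemma block_maximal : exists E : set R,
  [/\ measurable E,
      (mu E <= (516 * (A / l) + 9576 * (A / l) ^+ 2)%:E)%E &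
      forall t h, `|t - t0| <= 4^-1 -> ~ E t -> 0 < h <= 4^-1 ->
        `|multiplier_poly (fun n => expR (- (h * lnS n))) a b r (t - t0)| <= 3 * l].
Proof.
pose E1 := [set t | (HL_maximal g t > l%:E)%E].
pose E2 := \bigcup_K sqfun_large K.
have mE1 : measurable E1.
  rewrite -[E1]setTI; apply: emeasurable_fun_o_infty => //.
  by apply: measurable_HL_maximal; exact: HL_block_locint.
have mE2 : measurable E2 by exact: bigcupT_measurable.
exists (E1 `|` E2); split; first exact: measurableU.
  apply: (le_trans (measureU2 mu mE1 mE2)); rewrite EFinD leeD//.
    by rewrite (le_trans HL_block_measure)// mulrA.
  have nd : nondecreasing_seq sqfun_large.
    move=> K L KL; apply/subsetPset => t [It lt]; split => //=.
    exact: lt_le_trans lt (sqfun_nd _ KL).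
  have cvgE := nondecreasing_cvg_mu (mu := mu) sqfun_large_measurable mE2 nd.
  suff : (limn (mu \o sqfun_large) <= (9576 * (A / l) ^+ 2)%:E)%E.
    by rewrite (cvg_lim _ cvgE).
  apply: lime_le; first by apply/cvg_ex; eexists; exact: cvgE.
  apply: nearW => K /=; rewrite (le_trans (sqfun_large_measure K))//.
  by rewrite lee_fin expr_div_n [leRHS]mulrA.
move=> t h tt /not_orP[nE1 nE2] h0; apply: pointwise_bound => //.
  by rewrite leNgt; apply/negP.
move=> K; rewrite leNgt; apply/negP => lK; apply: nE2; exists K => //; split => //.
by rewrite /I/= in_itv/=; move: tt; rewrite ler_norml => /andP[? ?]; apply/andP; split; lra.
Qed.

End block.
End Maximal.

(** * Almost everywhere radial limits of Dirichlet series *)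

Section AlmostEverywhere.
Variable R : realType.
Implicit Types (a b : nat -> R) (t : R).
Local Notation mu := (@lebesgue_measure R).
Local Notation wt := (@wt R).
Local Notation lnS := (@lnS R).

Lemma wt_expR n : wt n = expR (- (2^-1 * lnS n)).
Proof.
apply/eqP; rewrite -(@eqrXn2 _ 2)// ?wt_ge0 ?expR_ge0//; apply/eqP.
rewrite wt2 -expRM_natl mulrN mulrA divff// mul1r expRN lnK// posrE//.
Qed.

(** The integral test in telescoped form: with c = s - 1, the term (n + 2)^(- s) is at most the
    decrease of x^(- c) / c from x = n + 1 to x = n + 2. *)
Lemma is_cvg_zeta (s : R) : 1 < s -> cvgn (series (fun n => expR (- (s * lnS n)))).
Proof.
move=> s1; set c := s - 1; have c0 : 0 < c by rewrite subr_gt0.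
apply: nondecreasing_is_cvgn.
  by apply: nondecreasing_series => n _ _; exact: expR_ge0.
exists (1 + c^-1) => _ [N _ <-].
have e1 : expR (- (s * lnS 0)) = 1 by rewrite /lnS ln1 mulr0 oppr0 expR0.
case: N => [|N]; first by rewrite /series/= big_geq// addr_ge0// invr_ge0 ltW.
rewrite /series/= big_ltn// e1 lerD2l big_add1/=.
apply: (@le_trans _ _ (\sum_(0 <= n < N)
    (- (c^-1 * expR (- (c * lnS n.+1))) - - (c^-1 * expR (- (c * lnS n)))))).
  apply: ler_sum => n _.
  rewrite [leRHS](_ : _ = c^-1 * (expR (- (c * lnS n)) - expR (- (c * lnS n.+1)))); last by ring.
  rewrite -(ler_pM2l c0) mulVKf ?gt_eqF//.
  have d2 : n.+2%:R^-1 <= lnS n.+1 - lnS n.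
    rewrite -[leRHS]opprB /lnS -ln_div ?posrE//.
    have -> : n.+1%:R / n.+2%:R = 1 + (- n.+2%:R^-1) :> R.
      have : 0 < n.+1%:R :> R by [].
      rewrite -[n.+2%:R]natr1; set N' := n.+1%:R => n0; field.
      by apply: lt0r_neq0; lra.
    by rewrite lerNr (le_trans (le_ln1Dx _))// ltrN2 invf_lt1// ltr1n.
  have -> : - (s * lnS n.+1) = - (c * lnS n.+1) - lnS n.+1 by rewrite /c; ring.
  have -> : - (c * lnS n) = - (c * lnS n.+1) + c * (lnS n.+1 - lnS n) by ring.
  have eS : expR (- lnS n.+1) = n.+2%:R^-1 by rewrite expRN /lnS lnK// posrE.
  rewrite !expRD eS mulrCA -[X in _ <= _ - X]mulr1 -mulrBr.
  rewrite ler_wpM2l ?expR_ge0// lerBrDl (le_trans _ (expR_ge1Dx _))//.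
  by rewrite lerD2l ler_pM2l.
rewrite (telescope_sumr (fun n => - (c^-1 * expR (- (c * lnS n)))))//.
rewrite [X in _ - - (_ * X)](_ : _ = 1) ?mulr1; last first.
  by rewrite /lnS ln1 mulr0 oppr0 expR0.
by rewrite opprK gerDr oppr_le0 mulr_ge0 ?expR_ge0// invr_ge0 ltW.
Qed.

Definition dterm a b (theta s : R) : nat -> R :=
  fun n => expR (- (theta * lnS n)) * wave a b n s.

Definition dsum a b (theta s : R) : R := limn (series (dterm a b theta s)).

Lemma dterm_block a b M1 M2 h s :
  \sum_(M1 <= n < M2) dterm a b (2^-1 + h) s n =
  multiplier_poly (fun n => expR (- (h * lnS n))) a b (index_iota M1 M2) s.
Proof.
rewrite multiplier_polyE; apply: eq_bigr => n _.
by rewrite /dterm wt_expR mulrDl opprD expRD; ring.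
Qed.

Lemma continuous_dterm_block a b M1 M2 s :
  continuous (fun theta : R => \sum_(M1 <= n < M2) dterm a b theta s n).
Proof.
apply: continuous_bigD => n theta; apply: cvgM; last exact: cvg_cst.
apply: (@continuous_comp _ _ _ (fun th : R => - (th * lnS n)) (@expR R)).
  by apply: cvgN; apply: cvgM; [exact: cvg_id|exact: cvg_cst].
exact: continuous_expR.
Qed.

Section summable.
Variables (a b : nat -> R) (B : R).
Hypothesis hB : forall N, \sum_(0 <= n < N) (a n ^+ 2 + b n ^+ 2) <= B.

Let ab0 n : 0 <= a n ^+ 2 + b n ^+ 2.
Proof. by rewrite addr_ge0 ?sqr_ge0. Qed.

Lemma is_cvg_energy : cvgn (series (fun n => a n ^+ 2 + b n ^+ 2)).
Proof.
apply: nondecreasing_is_cvgn.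
  by apply: nondecreasing_series => n _ _.
by exists B => _ [N _ <-]; exact: hB.
Qed.

(** The terms are at most n^(- 2 theta) + a^2 + b^2 by the arithmetic-geometric mean inequality, and
    2 theta > 1. *)
Lemma is_cvg_dterm theta s : 2^-1 < theta -> cvgn (series (dterm a b theta s)).
Proof.
move=> th; apply: normed_cvg.
apply: (@series_le_cvg _ _ (fun n => expR (- (2 * theta * lnS n)) + (a n ^+ 2 + b n ^+ 2))).
- by move=> n; rewrite /=.
- by move=> n; rewrite addr_ge0 ?expR_ge0.
- move=> n /=; rewrite /dterm normrM (ger0_norm (expR_ge0 _)).
  set e := expR _; set w := wave _ _ _ _.
  have -> : expR (- (2 * theta * lnS n)) = e ^+ 2.
    by rewrite /e -expRM_natl; congr expR; ring.
  have e0 : 0 <= e by exact: expR_ge0.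
  have c1 : `|cos (lnS n * s)| <= 1 by rewrite ler_norml cos_geN1 cos_le1.
  have s1 : `|sin (lnS n * s)| <= 1 by rewrite ler_norml sin_geN1 sin_le1.
  have w1 : `|w| <= `|a n| + `|b n|.
    rewrite (le_trans (ler_normD _ _))// !normrM.
    by rewrite lerD// ler_piMr.
  rewrite -(real_normK (num_real (a n))) -(real_normK (num_real (b n))).
  have := normr_ge0 (a n); have := normr_ge0 (b n).
  move: (`|a n|) (`|b n|) w1 => x y w1 y0 x0.
  apply: (@le_trans _ _ (e * (x + y))); first by rewrite ler_wpM2l.
  have := sqr_ge0 (e - (x + y)); have := sqr_ge0 (x - y); nra.
- rewrite (_ : (fun n => _) = (fun n => expR (- (2 * theta * lnS n))) \+ (fun n => a n ^+ 2 + b n ^+ 2))//.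
  rewrite seriesD; apply: is_cvgD; last exact: is_cvg_energy.
  by apply: is_cvg_zeta; lra.
Qed.

(* Cuts the index set into blocks whose energy decays geometrically, so that Borel-Cantelli
   applies to the exceptional sets of [block_maximal]. *)
Lemma block_points : exists M : nat -> nat,
  [/\ {homo M : m n / (m <= n)%N}, forall k, (k <= M k)%N &
      forall k N, \sum_(M k <= n < N) (a n ^+ 2 + b n ^+ 2) <= (4^-1 ^+ k) ^+ 2].
Proof.
have tail k : exists m, forall N, \sum_(m <= n < N) (a n ^+ 2 + b n ^+ 2) <= (4^-1 ^+ k) ^+ 2.
  have e0 : 0 < (4^-1 ^+ k) ^+ 2 :> R by rewrite !exprn_gt0// invr_gt0.
  have nd : nondecreasing_seq (series (fun n => a n ^+ 2 + b n ^+ 2)).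
    by apply: nondecreasing_series => n _ _.
  have /cvgrPdist_lt/(_ _ e0) [m _ hm] := is_cvg_energy.
  exists m => N; have [Nm|/ltnW mN] := leqP N m; first by rewrite big_geq// ltW.
  have := hm m (leqnn m); rewrite /= ger0_norm; last first.
    by rewrite subr_ge0 nondecreasing_cvgn_le//; exact: is_cvg_energy.
  have := nondecreasing_cvgn_le nd is_cvg_energy N.
  have -> : series (fun n => a n ^+ 2 + b n ^+ 2) N =
    series (fun n => a n ^+ 2 + b n ^+ 2) m + \sum_(m <= n < N) (a n ^+ 2 + b n ^+ 2).
    by rewrite /series/= -big_cat_nat.
  lra.
have [m hm] := choice tail.
exists (fun k => \sum_(0 <= i < k.+1) (m i).+1)%N; split.
- by move=> i j ij; rewrite [leqRHS](big_cat_nat (n := i.+1))//= leq_addr.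
- elim=> [//|k ih]; apply: leq_ltn_trans ih _.
  by rewrite [ltnRHS]big_nat_recr//= addnS ltnS leq_addr.
- move=> k N; set Mk := (\sum_(0 <= i < k.+1) _)%N.
  have mMk : (m k <= Mk)%N.
    by rewrite /Mk big_nat_recr//= (leq_trans (leqnSn _))// leq_addl.
  have [NM|/ltnW MN] := leqP N Mk.
    by rewrite big_geq// sqr_ge0.
  apply: le_trans (hm k N); rewrite [leRHS](big_cat_nat (n := Mk))//= lerDr.
  by rewrite sumr_ge0.
Qed.

Lemma ae_cvg_dsum t0 :
  {ae mu, forall t, `|t - t0| <= 4^-1 ->
     cvg (dsum a b theta (t - t0) @[theta --> (2^-1 : R)^'+])}.
Proof.
have [M [Mh Mk MB]] := block_points.
(* The energy of block k is at most 16^-k, so A = 4^-k; with the threshold l = 2^-k the ratio A / l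
   is again 2^-k, and both the thresholds and the measures of the exceptional sets are summable. *)
pose l k : R := 2^-1 ^+ k; pose A k : R := 4^-1 ^+ k.
have l0 k : 0 < l k by rewrite exprn_gt0// invr_gt0.
have A0 k : 0 < A k by rewrite exprn_gt0// invr_gt0.
have [E hE] := choice (fun k => block_maximal t0 (A0 k) (l0 k) (MB k (M k.+1))).
have mE k : measurable (E k) by case: (hE k).
exists (lim_sup_set E); split.
- by apply: bigcapT_measurable => n; apply: bigcup_measurable => k _; exact: mE.
- apply: lim_sup_set_cvg0 => //.
  have Ale k : A k / l k = l k.
    by rewrite /A /l -expr_div_n; congr (_ ^+ _); field.
  (* As l <= 1, the quadratic term is absorbed in the linear one: 516 + 9576 = 10092. *)
  have h1 : (\sum_(0 <= k <oo) mu (E k) <= \sum_(0 <= k <oo) (geometric 10092 2^-1 k)%:E)%E.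
    apply: lee_nneseries => // k _; have [_ + _] := hE k.
    move=> /le_trans; apply; rewrite lee_fin Ale /geometric/= -/(l k).
    have : l k <= 1 by rewrite exprn_ile1// invf_le1// ler1n.
    by have := l0 k; nra.
  apply: (le_lt_trans h1).
  have := @cvg_geometric_series R 10092 2^-1; rewrite ger0_norm// invf_lt1// ltr1n => /(_ isT) cg.
  rewrite (_ : limn _ = (10092 / (1 - 2^-1))%:E) ?ltry//.
  apply/cvg_lim => //; under eq_fun do rewrite sumEFin.
  by apply/fine_cvgP; split; [exact: nearW|exact: cg].
- move=> t /= /not_implyP[tt ncv] n _; apply: contrapT => nE; apply: ncv.
  have {}nE k : (n <= k)%N -> ~ E k t by move=> nk Ek; apply: nE; exists k.
  set s := t - t0.
  have step k theta : (n <= k)%N -> 2^-1 < theta <= 2^-1 + 4^-1 ->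
      `|\sum_(M k <= i < M k.+1) dterm a b theta s i| <= 3 * l k.
    move=> nk /andP[th1 th2]; have [_ _ /(_ t (theta - 2^-1) tt (nE k nk))] := hE k.
    rewrite -dterm_block addrCA subrr addr0; apply.
    by apply/andP; split; lra.
  (* The block bounds 3 l telescope because 3 l(i) = 6 l(i) - 6 l(i + 1). *)
  have steps k j theta : (n <= k)%N -> 2^-1 < theta <= 2^-1 + 4^-1 ->
      `|series (dterm a b theta s) (M (k + j)%N) - series (dterm a b theta s) (M k)| <=
      6 * l k - 6 * l (k + j)%N.
    move=> nk th; elim: j => [|j ih]; first by rewrite addn0 !subrr normr0.
    rewrite addnS (_ : series _ (M (k + j).+1%N) = series (dterm a b theta s) (M (k + j)%N) +
      \sum_(M (k + j)%N <= i < M (k + j).+1%N) dterm a b theta s i); last first.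
      by rewrite /series/= -big_cat_nat//=; exact: Mh.
    rewrite addrAC (le_trans (ler_normD _ _))//.
    have := step (k + j)%N theta (leq_trans nk (leq_addr _ _)) th.
    have : l (k + j).+1%N = l (k + j)%N / 2 by rewrite /l exprS mulrC.
    lra.
  have dist k theta : (n <= k)%N -> 2^-1 < theta <= 2^-1 + 4^-1 ->
      `|dsum a b theta s - series (dterm a b theta s) (M k)| <= 6 * l k.
    move=> nk th; have /andP[th1 _] := th.
    have cM : series (dterm a b theta s) (M (k + j)%N) @[j --> \oo] --> dsum a b theta s.
      have hM : M (k + j)%N @[j --> \oo] --> \oo.
        apply/cvgnyPge => N; exists N => // j /= Nj.
        by rewrite (leq_trans Nj)// (leq_trans _ (Mk _))// leq_addl.
      have hS : series (dterm a b theta s) N @[N --> \oo] --> dsum a b theta s.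
        exact: is_cvg_dterm.
      exact: cvg_comp hM hS.
    have cD : `|series (dterm a b theta s) (M (k + j)%N) - series (dterm a b theta s) (M k)|
        @[j --> \oo] --> `|dsum a b theta s - series (dterm a b theta s) (M k)|.
      by apply: cvg_norm; apply: cvgB => //; exact: cvg_cst.
    apply: (cvgr_to_le cD); apply: nearW => j.
    by apply: le_trans (steps k j theta nk th) _; rewrite gerBl mulr_ge0// ltW.
  apply/cauchy_cvgP/cauchy_exP => e e0.
  have [k nk lk] : exists2 k, (n <= k)%N & 6 * l k < e / 2.
    have /cvgrPdist_lt/(_ (e / 12)) : l k @[k --> \oo] --> 0.
      by apply: cvg_expr; rewrite ger0_norm// invf_lt1// ltr1n.
    rewrite divr_gt0// => /(_ isT) [N _ hN].
    exists (maxn n N); first exact: leq_maxl.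
    have := hN (maxn n N) (leq_maxr _ _); rewrite /= sub0r normrN gtr0_norm//; lra.
  (* The centre is a partial sum at [theta] = 1/2 itself: the tail beyond block k is small uniformly
     in [theta], and the finite head is continuous in [theta] up to the critical line. *)
  exists (series (dterm a b 2^-1 s) (M k)).
  have cS := @continuous_dterm_block a b 0 (M k) s 2^-1.
  have /cvgrPdist_lt/(_ _ [elaborate (divr_gt0 e0 (ltr0n R 2))]) nS := cvg_at_right_filter cS.
  suff : \forall theta \near (2^-1 : R)^'+,
      `|series (dterm a b 2^-1 s) (M k) - dsum a b theta s| < e.
    by apply: filterS => theta; rewrite -ball_normE.
  near=> theta.
  have th : 2^-1 < theta <= 2^-1 + 4^-1.
    apply/andP; split; first by near: theta; exact: nbhs_right_gt.
    by near: theta; apply: nbhs_right_le; lra.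
  have d1 := dist k theta nk th.
  have d2 : `|series (dterm a b 2^-1 s) (M k) - series (dterm a b theta s) (M k)| < e / 2.
    by near: theta; exact: nS.
  rewrite -(subrKA (series (dterm a b theta s) (M k))) (le_lt_trans (ler_normD _ _))//.
  by rewrite [`|_ - dsum _ _ _ _|]distrC; lra.
Unshelve. all: by end_near. Qed.

End summable.

(* The coefficients seen from the base point c instead of 0. *)
Definition rot1 a b (c : R) (n : nat) : R :=
  a n * cos (lnS n * c) + b n * sin (lnS n * c).

Definition rot2 a b (c : R) (n : nat) : R :=
  b n * cos (lnS n * c) - a n * sin (lnS n * c).

Lemma rot_energy a b c n :
  rot1 a b c n ^+ 2 + rot2 a b c n ^+ 2 = a n ^+ 2 + b n ^+ 2.
Proof.
have := cos2Dsin2 (lnS n * c); rewrite /rot1 /rot2.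
move: (cos _) (sin _) => x y xy.
transitivity ((a n ^+ 2 + b n ^+ 2) * (x ^+ 2 + y ^+ 2)); first by ring.
by rewrite xy mulr1.
Qed.

Lemma wave_rot a b c n t :
  wave (rot1 a b c) (rot2 a b c) n (t - c) = wave a b n t.
Proof.
rewrite /wave /rot1 /rot2 mulrBr cosB sinB.
have := cos2Dsin2 (lnS n * c).
move: (cos (lnS n * c)) (sin (lnS n * c)) (cos (lnS n * t)) (sin (lnS n * t)) => x y z w.
move=> xy; transitivity ((a n * z + b n * w) * (x ^+ 2 + y ^+ 2)); first by ring.
by rewrite xy mulr1.
Qed.

Theorem ae_cvg_dsumT a b (B : R) :
  (forall N, \sum_(0 <= n < N) (a n ^+ 2 + b n ^+ 2) <= B) ->
  {ae mu, forall t, cvg (dsum a b theta t @[theta --> (2^-1 : R)^'+])}.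
Proof.
move=> hB; have h (c : R) : {ae mu, forall t, `|t - c| <= 4^-1 ->
     cvg (dsum a b theta t @[theta --> (2^-1 : R)^'+])}.
  have hBc N : \sum_(0 <= n < N) (rot1 a b c n ^+ 2 + rot2 a b c n ^+ 2) <= B.
    by under eq_bigr do rewrite rot_energy.
  have := ae_cvg_dsum hBc c; apply: negligibleS => t /= nt ht; apply: nt => tc; move: (ht tc).
  rewrite (_ : (fun theta => dsum (rot1 a b c) (rot2 a b c) theta (t - c)) =
    (fun theta => dsum a b theta t))//.
  apply/funext => theta; rewrite /dsum; congr (limn (series _)).
  by apply/funext => n; rewrite /dterm wave_rot.
(* The windows of radius 1/4 around the points n / 4 and - n / 4 cover the line, and there are
   countably many of them. *)
have h1 := ae_foralln (fun n => h (n%:R / 4)).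
have h2 := ae_foralln (fun n => h (- (n%:R / 4))).
have := negligibleU h1 h2; apply: negligibleS => t nt.
apply: contrapT => /not_orP[/contrapT {}h1 /contrapT {}h2]; apply: nt.
have := truncn_itv (mulr_ge0 (ler0n R 4) (normr_ge0 t)).
move: (Num.truncn _) => n /andP[n1 n2].
have [t0|t0] := leP 0 t.
  apply: (h1 n); move: n1 n2; rewrite (ger0_norm t0) -[n.+1%:R]natr1 => n1 n2.
  by rewrite ler_norml; apply/andP; split; lra.
apply: (h2 n); move: n1 n2; rewrite (ltr0_norm t0) -[n.+1%:R]natr1 => n1 n2.
by rewrite ler_norml; apply/andP; split; lra.
Qed.

End AlmostEverywhere.

(** * Continuity to the right of the critical line *)

Section ContinuityOffLine.
Variable R : realType.
Implicit Types (a b : nat -> R).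
Local Notation lnS := (@lnS R).

Lemma dterm_bound a b (theta1 theta s : R) n : theta1 <= theta ->
  `|dterm a b theta s n| <= expR (- (2 * theta1 * lnS n)) + (a n ^+ 2 + b n ^+ 2).
Proof.
move=> th; rewrite /dterm normrM (ger0_norm (expR_ge0 _)).
apply: (@le_trans _ _ (expR (- (theta1 * lnS n)) * `|wave a b n s|)).
  by rewrite ler_wpM2r// ler_expR lerN2 ler_wpM2r// lnS_ge0.
set e := expR _; set w := wave _ _ _ _.
have -> : expR (- (2 * theta1 * lnS n)) = e ^+ 2.
  by rewrite /e -expRM_natl; congr expR; ring.
have e0 : 0 <= e by exact: expR_ge0.
have c1 : `|cos (lnS n * s)| <= 1 by rewrite ler_norml cos_geN1 cos_le1.
have s1 : `|sin (lnS n * s)| <= 1 by rewrite ler_norml sin_geN1 sin_le1.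
have w1 : `|w| <= `|a n| + `|b n|.
  by rewrite (le_trans (ler_normD _ _))// !normrM lerD// ler_piMr.
rewrite -(real_normK (num_real (a n))) -(real_normK (num_real (b n))).
have := normr_ge0 (a n); have := normr_ge0 (b n).
move: (`|a n|) (`|b n|) w1 => x y w1 y0 x0.
apply: (@le_trans _ _ (e * (x + y))); first by rewrite ler_wpM2l.
have := sqr_ge0 (e - (x + y)); have := sqr_ge0 (x - y); nra.
Qed.

Variables (a b : nat -> R) (B : R).
Hypothesis hB : forall N, \sum_(0 <= n < N) (a n ^+ 2 + b n ^+ 2) <= B.

(** Weierstrass' test: the majorant from [dterm_bound] depends neither on [theta >= theta1] nor on
    [s]. *)
Lemma dsum_tail (theta1 e : R) : 2^-1 < theta1 -> 0 < e ->
  exists N, forall theta s, theta1 <= theta ->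
    `|dsum a b theta s - series (dterm a b theta s) N| <= e.
Proof.
move=> th1 e0; pose u n := expR (- (2 * theta1 * lnS n)) + (a n ^+ 2 + b n ^+ 2).
have u0 n : 0 <= u n by rewrite addr_ge0 ?expR_ge0// addr_ge0 ?sqr_ge0.
have cu : cvgn (series u).
  rewrite (_ : u = (fun n => expR (- (2 * theta1 * lnS n))) \+ (fun n => a n ^+ 2 + b n ^+ 2))//.
  rewrite seriesD; apply: is_cvgD; last exact: is_cvg_energy hB.
  by apply: is_cvg_zeta; lra.
have nd : nondecreasing_seq (series u) by apply: nondecreasing_series => n _ _.
have /cvgrPdist_lt/(_ _ e0) [N _ hN] := cu.
exists N => theta s th.
have th2 : 2^-1 < theta by exact: lt_le_trans th.
have cS : series (dterm a b theta s) k @[k --> \oo] --> dsum a b theta s.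
  by have := @is_cvg_dterm R a b B hB theta s th2.
have cD : `|series (dterm a b theta s) k - series (dterm a b theta s) N|
    @[k --> \oo] --> `|dsum a b theta s - series (dterm a b theta s) N|.
  by apply: cvg_norm; apply: cvgB => //; exact: cvg_cst.
apply: (cvgr_to_le cD); exists N => // k /= Nk.
rewrite /series/= (big_cat_nat (n := N))//= addrAC subrr add0r.
rewrite (le_trans (ler_norm_sum _ _ _))//.
apply: (@le_trans _ _ (\sum_(N <= i < k) u i)).
  by apply: ler_sum => i _; exact: dterm_bound.
have := hN N (leqnn N); rewrite /= ger0_norm; last by rewrite subr_ge0 nondecreasing_cvgn_le.
have := nondecreasing_cvgn_le nd cu k.
have -> : series u k = series u N + \sum_(N <= i < k) u i.
  by rewrite /series/= -big_cat_nat.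
lra.
Qed.

(** Continuity in [theta] is what later reduces the existence of the radial limit to countably many
    conditions, and so makes the set of convergence measurable. *)
Lemma continuous_dsum (theta0 s : R) : 2^-1 < theta0 ->
  dsum a b theta s @[theta --> theta0] --> dsum a b theta0 s.
Proof.
move=> th0; apply/cvgrPdist_le => e e0.
pose th1 := (theta0 + 2^-1) / 2.
have e3 : 0 < e / 3 by rewrite divr_gt0.
have h1 : 2^-1 < th1 by rewrite /th1; lra.
have h2 : th1 < theta0 by rewrite /th1; lra.
have [N hN] := dsum_tail h1 e3.
have /cvgrPdist_le/(_ _ e3) nS := @continuous_dterm_block R a b 0 N s theta0.
near=> theta.
have t1 : th1 <= theta by rewrite ltW//; near: theta; exact: lt_nbhsr.
have d0 := hN theta0 s (ltW h2); have d1 := hN theta s t1.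
have d2 : `|series (dterm a b theta0 s) N - series (dterm a b theta s) N| <= e / 3.
  by near: theta; exact: nS.
move: d0 d1 d2; move: (dsum _ _ _ _) (dsum _ _ _ _) (series _ _) (series _ _) => x y z w.
rewrite !ler_norml => /andP[? ?] /andP[? ?] /andP[? ?].
by apply/andP; split; lra.
Unshelve. all: by end_near. Qed.

End ContinuityOffLine.

(** * Bohr's correspondence *)

Section Primes.
Local Open Scope nat_scope.

Lemma nth_primeS j : nth_prime j.+1 = next_prime (nth_prime j).
Proof. by []. Qed.

Lemma nth_prime_prime j : prime (nth_prime j).
Proof. by case: j => [//|j]; rewrite nth_primeS /next_prime; case: ex_minnP => p /andP[]. Qed.

Lemma nth_prime_ltS j : nth_prime j < nth_prime j.+1.
Proof. by rewrite nth_primeS /next_prime; case: ex_minnP => p /andP[]. Qed.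

Lemma nth_prime_lt : {homo nth_prime : i j / i < j}.
Proof. exact: (homo_ltn ltn_trans nth_prime_ltS). Qed.

Lemma nth_prime_inj : injective nth_prime.
Proof.
move=> i j ij; have [/nth_prime_lt|/nth_prime_lt|//] := ltngtP i j.
- by rewrite ij ltnn.
- by rewrite ij ltnn.
Qed.

Lemma nth_prime_gt j : j < nth_prime j.
Proof. by elim: j => [//|j ih]; exact: leq_ltn_trans ih (nth_prime_ltS j). Qed.

Lemma nth_prime_surj q : prime q -> exists j, nth_prime j = q.
Proof.
move=> pq; have ex : exists j, q <= nth_prime j by exists q; rewrite ltnW// nth_prime_gt.
case: (ex_minnP ex) => -[|j] qj jmin.
  by exists 0%N; apply/eqP; rewrite eqn_leq prime_gt1.
exists j.+1; apply/eqP; rewrite eqn_leq qj andbT nth_primeS /next_prime.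
case: ex_minnP => r _; apply; rewrite pq andbT ltnNge; apply/negP => /jmin.
by rewrite ltnn.
Qed.

Lemma logn_nth_prime_big j n : n < j.+1 -> logn (nth_prime j) n = 0.
Proof.
move=> nj; case: n nj => [|n] nj; first by rewrite logn0.
apply/eqP; rewrite -leqn0 leqNgt logn_gt0 mem_primes; apply/negP.
move=> /and3P[_ _ /(dvdn_leq (ltn0Sn n))]; rewrite leqNgt => /negP; apply.
exact: leq_trans nj (nth_prime_gt j).
Qed.

Lemma logn_prod_nth_prime K (e : nat -> nat) j :
  logn (nth_prime j) (\prod_(0 <= i < K) nth_prime i ^ e i) = if j < K then e j else 0.
Proof.
have pos L : 0 < \prod_(0 <= i < L) nth_prime i ^ e i.
  by rewrite prodn_gt0// => i; rewrite expn_gt0 prime_gt0// nth_prime_prime.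
elim: K => [|K ih]; first by rewrite big_geq// logn1.
rewrite big_nat_recr//= lognM// ?expn_gt0 ?prime_gt0 ?nth_prime_prime//.
rewrite ih lognX logn_prime ?nth_prime_prime// (inj_eq nth_prime_inj).
case: (ltngtP j K) => [jK|jK|->]; rewrite ?muln0 ?addn0.
- by rewrite ltnS ltnW.
- by rewrite ltnS leqNgt jK.
- by rewrite ltnSn muln1 add0n.
Qed.

Lemma prod_nth_prime n K : n.+1 <= K ->
  \prod_(0 <= j < K) nth_prime j ^ logn (nth_prime j) n.+1 = n.+1.
Proof.
move=> nK; apply: eqn_from_log => //.
  by rewrite prodn_gt0// => i; rewrite expn_gt0 prime_gt0// nth_prime_prime.
move=> q; have [pq|npq] := boolP (prime q); last by rewrite lognE (negPf npq)/= lognE (negPf npq).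
have [j <-] := nth_prime_surj pq; rewrite logn_prod_nth_prime.
case: ltnP => // Kj; rewrite logn_nth_prime_big// ltnS.
exact: leq_trans nK Kj.
Qed.

Lemma logn_nth_prime_inj m n :
  (forall j, logn (nth_prime j) m.+1 = logn (nth_prime j) n.+1) -> m = n.
Proof.
move=> h; apply: succn_inj; apply: eqn_from_log => // q.
have [pq|npq] := boolP (prime q); last by rewrite lognE (negPf npq)/= lognE (negPf npq).
by have [j <-] := nth_prime_surj pq; exact: h.
Qed.

End Primes.

Section Monomials.
Variable R : realType.
Local Notation C := R[i].
Implicit Types (z w : nat -> C) (c : nat -> C).
Local Notation lnS := (@lnS R).

(* [mon n z] is the monomial of Bohr's correspondence attached to the integer [n.+1]. *)
Definition mon (n : nat) z : C :=
  \prod_(0 <= j < n.+1) z j ^+ logn (nth_prime j) n.+1.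

Lemma mon_wide n K z : (n.+1 <= K)%N ->
  mon n z = \prod_(0 <= j < K) z j ^+ logn (nth_prime j) n.+1.
Proof.
move=> nK; rewrite [RHS](big_cat_nat (n := n.+1))//= [X in _ * X]big_nat_cond.
rewrite [X in _ * X]big1 ?mulr1// => j /andP[/andP[nj _] _].
by rewrite logn_nth_prime_big.
Qed.

Lemma monM n z w : mon n (fun j => z j * w j) = mon n z * mon n w.
Proof. by rewrite /mon -big_split/=; apply: eq_bigr => j _; rewrite exprMn. Qed.

(** Unique factorization recovers the exponents; the predecessor appears because the index n stands
    for the integer n + 1. *)
Lemma mon_num (k : nat) (e : nat -> nat) z :
  mon (\prod_(0 <= i < k) nth_prime i ^ e i)%N.-1 z = \prod_(0 <= i < k) z i ^+ e i.
Proof.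
set N := (\prod_(_ <= _ < _) _)%N.
have N0 : (0 < N)%N by rewrite prodn_gt0// => i; rewrite expn_gt0 prime_gt0// nth_prime_prime.
rewrite (@mon_wide _ (maxn k N)) prednK ?leq_maxr//.
rewrite (big_cat_nat (n := k))//= ?leq_maxl// [X in _ * X]big_nat_cond.
rewrite [X in _ * X]big1 ?mulr1; last first.
  by move=> j /andP[/andP[kj _] _]; rewrite logn_prod_nth_prime ltnNge kj.
by rewrite !big_mkord; apply: eq_bigr => j _; rewrite logn_prod_nth_prime ltn_ord.
Qed.

(** Coefficients belonging to the same integer are added up. That [c] vanishes from [M] on allows
    the sums of two polynomials to be brought to a common length. *)
Lemma sum_mon_group (T : Type) (r : seq T) (f : T -> C) (num : T -> nat) :
  exists c, exists M, (forall n, (M <= n)%N -> c n = 0) /\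
  forall z, \sum_(m <- r) f m * mon (num m) z = \sum_(0 <= n < M) c n * mon n z.
Proof.
elim: r => [|m r [c [M [cM ih]]]].
  by exists (fun=> 0), 0%N; split=> // z; rewrite big_nil big_geq.
exists (fun n => c n + (n == num m)%:R * f m), (maxn M (num m).+1); split=> [n|z].
  rewrite geq_max => /andP[Mn mn]; rewrite cM// add0r.
  by rewrite gtn_eqF// mul0r.
under [RHS]eq_bigr do rewrite mulrDl; rewrite big_split/= big_cons ih [LHS]addrC.
congr (_ + _).
  rewrite [RHS](big_cat_nat (n := M))//= ?leq_maxl//.
  rewrite [X in _ = _ + X]big_nat_cond [X in _ = _ + X]big1 ?addr0//.
  by move=> n /andP[/andP[Mn _] _]; rewrite cM// mul0r.
rewrite (bigD1_seq (num m)) ?iota_uniq//=; last by rewrite mem_index_iota leq_maxr.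
rewrite eqxx mul1r big1 ?addr0// => n /negPf ->.
by rewrite !mul0r.
Qed.

Lemma peval_mon (P : cpoly R) : exists c, exists M,
  (forall n, (M <= n)%N -> c n = 0) /\
  forall z, peval P z = \sum_(0 <= n < M) c n * mon n z.
Proof.
(* The exponents are continued by 0 beyond the number of variables. *)
case: P => k p; pose ex (m : mpoly.multinom k) (i : nat) : nat :=
  odflt 0%N (omap (fun i : 'I_k => mpoly.fun_of_multinom m i) (insub i)).
pose num (m : mpoly.multinom k) : nat := (\prod_(0 <= i < k) nth_prime i ^ ex m i)%N.-1.
have [c [M [cM h]]] := sum_mon_group (mpoly.msupp p) (fun m => mpoly.mcoeff m p) num.
exists c, M; split=> // z; rewrite -h /peval/= mpoly.mevalE.
apply: eq_bigr => m _; congr (_ * _); rewrite mon_num big_mkord.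
apply: eq_bigr => i _; congr (_ ^+ _); rewrite /ex insubT//= => ik.
by congr (mpoly.fun_of_multinom m _); apply/val_inj.
Qed.

Lemma normc_mon n z : normc (mon n z) =
  \prod_(0 <= j < n.+1) normc (z j) ^+ logn (nth_prime j) n.+1.
Proof.
rewrite /mon; elim/big_ind2 : _ => [|x a y b <- <-|j _]; rewrite ?normc1 ?normcM//.
elim: (logn _ _) => [|e ih]; first by rewrite !expr0 normc1.
by rewrite !exprS normcM ih.
Qed.

Lemma sum_ln_nth_prime n :
  \sum_(0 <= j < n.+1) ln (nth_prime j)%:R *+ logn (nth_prime j) n.+1 = lnS n :> R.
Proof.
have pp j : 0 < (nth_prime j)%:R :> R by rewrite ltr0n prime_gt0// nth_prime_prime.
have pe j e : 0 < (nth_prime j ^ e)%:R :> R.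
  by rewrite ltr0n expn_gt0 prime_gt0// nth_prime_prime.
have aux K (e : nat -> nat) : \sum_(0 <= j < K) ln (nth_prime j)%:R *+ e j =
    ln (\prod_(0 <= j < K) (nth_prime j ^ e j)%:R) :> R.
  elim: K => [|K ih]; first by rewrite !big_geq// ln1.
  rewrite !big_nat_recr//= lnM ?posrE//; last by apply: prodr_gt0 => i _.
  by rewrite ih natrX lnXn.
by rewrite aux -natr_prod prod_nth_prime.
Qed.

(** The image of the unit of the torus under [b_]. As monomials are multiplicative, dilating the
    variables multiplies the n-th coefficient by [mon n (diam theta)]. *)
Definition diam (theta : R) : nat -> C := fun j => ((nth_prime j)%:R `^ (- theta))%:C%C.

Lemma mon_diam n theta : mon n (diam theta) = (expR (- (theta * lnS n)))%:C%C.
Proof.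
rewrite -sum_ln_nth_prime mulr_sumr -sumrN expR_sum rmorph_prod.
apply: eq_bigr => j _; rewrite /diam -rmorphXn; congr (_%:C%C).
have pp : 0 < (nth_prime j)%:R :> R by rewrite ltr0n prime_gt0// nth_prime_prime.
by rewrite /powR gt_eqF// -expRM_natl; congr expR; rewrite -mulr_natl; ring.
Qed.

Lemma mon_b n theta (t : torus R) :
  mon n (b_ theta t) = (expR (- (theta * lnS n)))%:C%C * mon n (fun j => val (t j)).
Proof. by rewrite -mon_diam -monM. Qed.

Definition chi (n : nat) (t : torus R) : C := mon n (fun j => val (t j)).

Lemma normc_chi n t : normc (chi n t) = 1.
Proof.
rewrite normc_mon big1_idem//= ?mulr1// => j _.
by rewrite (eqP (valP (t j))) expr1n.
Qed.

Lemma chiM n s t : chi n (torus_mul s t) = chi n s * chi n t.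
Proof. by rewrite /chi -monM. Qed.

Lemma circle_expD (x y : R) :
  val (circle_exp (x + y)) = val (circle_exp x) * val (circle_exp y).
Proof. by rewrite /= cosD sinD; apply/eqP; rewrite eq_complex/= addrC eqxx/= addrC mulrC. Qed.

Lemma circle_exp0 : val (@circle_exp R 0) = 1.
Proof. by rewrite /= cos0 sin0. Qed.

Lemma circle_expMn (x : R) k : val (circle_exp (x *+ k)) = val (circle_exp x) ^+ k.
Proof.
elim: k => [|k ih]; first by rewrite mulr0n expr0 circle_exp0.
by rewrite mulrS exprS circle_expD ih.
Qed.

(** The flow acts on the n-th character through (n + 1)^(- i t), by taking logarithms in the prime
    factorization; this is what turns an orbit into a vertical line. *)
Lemma chi_kronecker n t tau :
  chi n (kronecker t tau) = val (circle_exp (- (t * lnS n))) * chi n tau.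
Proof.
rewrite chiM; congr (_ * _).
rewrite -sum_ln_nth_prime mulr_sumr -sumrN /chi /mon.
have aux K (e : nat -> nat) :
    \prod_(0 <= j < K) val (circle_exp (- (t * ln (nth_prime j)%:R))) ^+ e j =
    val (circle_exp (\sum_(0 <= j < K) - (t * (ln (nth_prime j)%:R *+ e j)))).
  elim: K => [|K ih]; first by rewrite !big_geq// circle_exp0.
  rewrite !big_nat_recr// circle_expD ih; congr (_ * _).
  by rewrite -circle_expMn mulNrn mulrnAr.
exact: aux.
Qed.

End Monomials.

(** * Measurability and invariant integration on the torus *)

Section Torus_measurability.
Variable R : realType.
Local Notation C := R[i].
Local Notation torus := (torus R).

Lemma measurable_coord (j : nat) :
  measurable_fun setT (fun t : torus => complex.Re (val (t j))) /\
  measurable_fun setT (fun t : torus => complex.Im (val (t j))).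
Proof.
split=> _ B mB; rewrite setTI; apply: sub_sigma_algebra; exists j => //; [left|right];
  by exists B => //; rewrite setTI.
Qed.

Lemma measurable_to_torus d (T : measurableType d) (f : T -> torus) :
  (forall j, measurable_fun setT (fun x => complex.Re (val (f x j)))) ->
  (forall j, measurable_fun setT (fun x => complex.Im (val (f x j)))) ->
  measurable_fun setT f.
Proof.
move=> mRe mIm; apply: (measurability (@torus_cylinders R)) => //.
move=> _ [_ [j _ [[B mB <-]|[B mB <-]] <-]]; rewrite !setTI.
- by have := mRe j measurableT B mB; rewrite setTI.
- by have := mIm j measurableT B mB; rewrite setTI.
Qed.

(** [cmeasurable] over an arbitrary domain; the product of the line and the torus is needed for
    Fubini's theorem. *)
Definition cmfun d (T : measurableType d) (f : T -> C) : Prop :=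
  measurable_fun setT (fun x => complex.Re (f x)) /\
  measurable_fun setT (fun x => complex.Im (f x)).

Section cmfun.
Context d (T : measurableType d).
Implicit Types f g : T -> C.

Lemma cReD (x y : C) : complex.Re (x + y) = complex.Re x + complex.Re y.
Proof. by case: x y => [? ?] [? ?]. Qed.
Lemma cImD (x y : C) : complex.Im (x + y) = complex.Im x + complex.Im y.
Proof. by case: x y => [? ?] [? ?]. Qed.
Lemma cReM (x y : C) : complex.Re (x * y) = complex.Re x * complex.Re y - complex.Im x * complex.Im y.
Proof. by case: x y => [? ?] [? ?]. Qed.
Lemma cImM (x y : C) : complex.Im (x * y) = complex.Re x * complex.Im y + complex.Im x * complex.Re y.
Proof. by case: x y => [? ?] [? ?]. Qed.

Lemma cmfun_cst (z : C) : cmfun (fun _ : T => z).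
Proof. by split; exact: measurable_cst. Qed.

Lemma cmfunD f g : cmfun f -> cmfun g -> cmfun (fun x => f x + g x).
Proof.
move=> [f1 f2] [g1 g2]; split.
- by under eq_fun do rewrite cReD; exact: measurable_funD.
- by under eq_fun do rewrite cImD; exact: measurable_funD.
Qed.

Lemma cmfunM f g : cmfun f -> cmfun g -> cmfun (fun x => f x * g x).
Proof.
move=> [f1 f2] [g1 g2]; split.
- by under eq_fun do rewrite cReM; apply: measurable_funB; exact: measurable_funM.
- by under eq_fun do rewrite cImM; apply: measurable_funD; exact: measurable_funM.
Qed.

Lemma cmfunB f g : cmfun f -> cmfun g -> cmfun (fun x => f x - g x).
Proof.
move=> mf mg; rewrite (_ : (fun x => _) = (fun x => f x + (-1) * g x)).
  by apply: cmfunD => //; apply: cmfunM => //; exact: cmfun_cst.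
by apply/funext => x; rewrite mulN1r.
Qed.

Lemma cmfun_sum (I : Type) (r : seq I) (F : I -> T -> C) :
  (forall i, cmfun (F i)) -> cmfun (fun x => \sum_(i <- r) F i x).
Proof.
move=> mF; elim: r => [|i r ih].
  by under eq_fun do rewrite big_nil; exact: cmfun_cst.
by under eq_fun do rewrite big_cons; exact: cmfunD.
Qed.

Lemma cmfun_prod (I : Type) (r : seq I) (F : I -> T -> C) :
  (forall i, cmfun (F i)) -> cmfun (fun x => \prod_(i <- r) F i x).
Proof.
move=> mF; elim: r => [|i r ih].
  by under eq_fun do rewrite big_nil; exact: cmfun_cst.
by under eq_fun do rewrite big_cons; exact: cmfunM.
Qed.

Lemma cmfunX f k : cmfun f -> cmfun (fun x => f x ^+ k).
Proof.
move=> mf; elim: k => [|k ih]; first by under eq_fun do rewrite expr0; exact: cmfun_cst.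
by under eq_fun do rewrite exprS; exact: cmfunM.
Qed.

Lemma measurable_normc f : cmfun f -> measurable_fun setT (fun x => normc (f x)).
Proof.
move=> [f1 f2]; rewrite (_ : (fun x => _) =
    (fun x => Num.sqrt (complex.Re (f x) ^+ 2 + complex.Im (f x) ^+ 2))); last first.
  by apply/funext => x; case: (f x).
apply: (measurableT_comp (f := @Num.sqrt R)).
  by apply: continuous_measurable_fun; exact: sqrt_continuous.
by apply: measurable_funD; exact: measurable_funX.
Qed.

End cmfun.

Lemma cmfun_chi n : cmfun (@chi R n).
Proof. by apply: cmfun_prod => j; apply: cmfunX; exact: measurable_coord. Qed.

Lemma cmfun_comp d (T : measurableType d) d' (T' : measurableType d')
  (f : T' -> C) (g : T -> T') : measurable_fun setT g -> cmfun f -> cmfun (f \o g).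
Proof. by move=> mg [f1 f2]; split; [exact: measurableT_comp f1 mg|exact: measurableT_comp f2 mg]. Qed.

Lemma measurable_torus_mul (s : torus) : measurable_fun setT (torus_mul s).
Proof.
have h j : cmfun (fun t : torus => val (torus_mul s t j)).
  by apply: cmfunM; [exact: cmfun_cst|exact: measurable_coord].
by apply: measurable_to_torus => j; case: (h j).
Qed.

Lemma measurable_kronecker :
  measurable_fun setT (fun x : measurableTypeR R * torus => kronecker x.1 x.2).
Proof.
have h j : cmfun (fun x : measurableTypeR R * torus => val (kronecker x.1 x.2 j)).
  apply: cmfunM; last exact: (cmfun_comp measurable_snd (measurable_coord j)).
  have mx : measurable_fun setT (fun x : measurableTypeR R * torus => - (x.1 * ln (nth_prime j)%:R)).
    under eq_fun do rewrite -mulrN.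
    by apply: measurable_funM => //; exact: measurable_fst.
  split=> /=.
  - by apply: (measurableT_comp (f := @cos R) _ mx); apply: continuous_measurable_fun; exact: continuous_cos.
  - by apply: (measurableT_comp (f := @sin R) _ mx); apply: continuous_measurable_fun; exact: continuous_sin.
by apply: measurable_to_torus => j; case: (h j).
Qed.

Section haar.
Variables (m : probability torus R) (hm : is_haar m).

Lemma ge0_integral_torus_mul (s : torus) (f : torus -> \bar R) :
  measurable_fun setT f -> (forall t, (0 <= f t)%E) ->
  (\int[m]_t f (torus_mul s t) = \int[m]_t f t)%E.
Proof.
move=> mf f0; have ms := measurable_torus_mul s.
have := ge0_integral_pushforward ms m measurableT mf (fun t _ => f0 t).
rewrite preimage_setT => <-; apply: eq_measure_integral => A mA _.
exact: hm.
Qed.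

Lemma integral_torus_mul (s : torus) (f : torus -> \bar R) :
  measurable_fun setT f ->
  (\int[m]_t f (torus_mul s t) = \int[m]_t f t)%E.
Proof.
move=> mf; rewrite integralE [in RHS]integralE; congr (_ - _)%E.
- rewrite -(ge0_integral_torus_mul s (measurable_funepos mf))//.
  by apply: eq_integral => t _; rewrite !funeposE.
- rewrite -(ge0_integral_torus_mul s (measurable_funeneg mf))//.
  by apply: eq_integral => t _; rewrite !funenegE.
Qed.

End haar.
End Torus_measurability.

(** * The norm of H^p *)

Section Lp.
Variables (R : realType) (m : probability (torus R) R) (p : R).
Hypothesis p2 : 2 <= p.
Local Notation C := R[i].
Local Notation torus := (torus R).
Implicit Types f g : torus -> C.

Let p0 : 0 < p. Proof. exact: lt_le_trans p2. Qed.
Let p1 : 1 <= p. Proof. by apply: le_trans p2; rewrite ler1n. Qed.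

Lemma normc_ge0 (z : C) : 0 <= normc z. Proof. by case: z => a b; exact: sqrtr_ge0. Qed.

Lemma measurable_normc_powR f (q : R) : cmfun f ->
  measurable_fun setT (fun t => (normc (f t) `^ q)%:E).
Proof.
move=> mf; apply/measurable_EFinP.
by apply: (measurableT_comp (f := (@powR R)^~ q)); [exact: measurable_powR|exact: measurable_normc].
Qed.

Lemma Lpnorm_powR f : (Lpnorm m p f `^ p = \int[m]_t (normc (f t) `^ p)%:E)%E.
Proof.
rewrite /Lpnorm (poweR_Lnorm _ _ (lt0r_neq0 p0)); apply: eq_integral => t _.
by rewrite gee0_abs ?lee_fin ?normc_ge0.
Qed.

Lemma Lpnorm_ge0 f : (0 <= Lpnorm m p f)%E. Proof. exact: Lnorm_ge0. Qed.

Lemma poweR_le (x y : \bar R) (q : R) : 0 < q -> (0 <= x)%E -> (x <= y)%E -> (x `^ q <= y `^ q)%E.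
Proof.
move=> q0 x0 xy; apply: gt0_ler_poweR => //; first exact: ltW.
- by rewrite in_itv/= x0 leey.
- by rewrite in_itv/= (le_trans x0 xy) leey.
Qed.

Lemma Lpnorm_leP f (B : R) : 0 <= B ->
  (Lpnorm m p f <= B%:E)%E = (\int[m]_t (normc (f t) `^ p)%:E <= (B `^ p)%:E)%E.
Proof.
move=> B0; rewrite -Lpnorm_powR -poweR_EFin; apply/idP/idP => h.
  by apply: poweR_le => //; exact: Lpnorm_ge0.
have := @poweR_le _ _ p^-1 _ (poweR_ge0 _ _) h.
rewrite invr_gt0 => /(_ p0); rewrite -!poweRrM divff ?gt_eqF// !poweRe1//.
exact: Lpnorm_ge0.
Qed.

Lemma LpnormD f g : cmfun f -> cmfun g ->
  (Lpnorm m p (fun t => (f t + g t)%R) <= Lpnorm m p f + Lpnorm m p g)%E.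
Proof.
move=> mf mg.
have mf' := measurable_normc mf; have mg' := measurable_normc mg.
have := @minkowski_EFin _ _ R m (fun t => normc (f t)) (fun t => normc (g t)) p mf' mg' p1.
apply: le_trans; rewrite /Lpnorm unlock; apply: poweR_le; first by rewrite invr_gt0.
  by apply: integral_ge0 => t _; exact: poweR_ge0.
apply: ge0_le_integral => //.
- by move=> t _; exact: poweR_ge0.
- under eq_fun do rewrite gee0_abs ?lee_fin ?normc_ge0//.
  by apply: measurable_normc_powR; exact: cmfunD.
- under eq_fun do rewrite gee0_abs ?lee_fin ?addr_ge0 ?normc_ge0//.
  apply/measurable_EFinP.
  by apply: (measurableT_comp (f := (@powR R)^~ p)); [exact: measurable_powR|exact: measurable_funD].
- move=> t _; apply: poweR_le => //.
  by rewrite !gee0_abs ?lee_fin ?addr_ge0 ?normc_ge0// le_normcD.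
Qed.

Lemma LpnormZ (c : R) f : 0 <= c -> cmfun f ->
  (Lpnorm m p (fun t => c%:C%C * f t)%R = c%:E * Lpnorm m p f)%E.
Proof.
move=> c0 mf; rewrite /Lpnorm unlock.
have nc (t : torus) : normc (c%:C%C * f t) = c * normc (f t).
  by rewrite normcM /normc/= expr0n/= addr0 sqrtr_sqr ger0_norm.
under eq_integral => t _.
  rewrite gee0_abs ?lee_fin ?normc_ge0// nc poweR_EFin powRM ?normc_ge0// EFinM.
  over.
rewrite ge0_integralZl_EFin//; last 3 first.
- by move=> t _; rewrite lee_fin powR_ge0.
- exact: measurable_normc_powR.
- exact: powR_ge0.
set J := (\int[m]_t _)%E.
have J0 : (0 <= J)%E by apply: integral_ge0 => t _; rewrite lee_fin powR_ge0.
have cp0 : (0 <= (c `^ p)%:E)%E by rewrite lee_fin powR_ge0.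
have -> := poweRM p^-1 cp0 J0.
have -> : ((c `^ p)%:E `^ p^-1)%E = c%:E.
  by rewrite poweR_EFin -powRrM divff ?(lt0r_neq0 p0)// powRr1.
have -> // : J = (\int[m]_t (`|(normc (f t))%:E| `^ p))%E.
by apply: eq_integral => t _; rewrite gee0_abs ?lee_fin ?normc_ge0.
Qed.

Lemma Lpnorm_torus_mul (hm : is_haar m) (s : torus) f : cmfun f ->
  Lpnorm m p (fun t => f (torus_mul s t)) = Lpnorm m p f.
Proof.
move=> mf; rewrite /Lpnorm unlock.
have mF : measurable_fun setT (fun t => (`|(normc (f t))%:E| `^ p)%E).
  under eq_fun do rewrite gee0_abs ?lee_fin ?normc_ge0//.
  exact: measurable_normc_powR.
by have -> := ge0_integral_torus_mul hm s mF (fun t => poweR_ge0 _ _).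
Qed.

Lemma limn_einf_le (u : (\bar R)^nat) (B : \bar R) :
  (forall n, (u n <= B)%E) -> (limn_einf u <= B)%E.
Proof.
move=> uB; rewrite limn_einf_lim; apply: lime_le; first exact: is_cvg_einfs.
apply: nearW => n; apply: le_trans (uB n).
by apply: ereal_inf_lbound; exists n => /=.
Qed.

Lemma powR_cvg_pos (q x : R) : 0 < x -> y `^ q @[y --> x] --> x `^ q.
Proof.
move=> x0; have E : {near x, (fun y => expR (q * ln y)) =1 (fun y => y `^ q)}.
  by near=> y; rewrite /powR gt_eqF//; near: y; exact: lt_nbhsr.
rewrite [X in _ --> X](_ : _ = expR (q * ln x)); last by rewrite /powR gt_eqF.
have cl : q * ln y @[y --> x] --> q * ln x by apply: cvgMr; exact: continuous_ln.
have ce := cvg_comp _ _ cl (@continuous_expR R (q * ln x)).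
exact: cvg_trans (near_eq_cvg E) ce.
Unshelve. all: by end_near. Qed.

(** Closed balls are stable under almost everywhere convergence of the moduli. Limits of norm bounds
    are all taken in this way, so no dominating function has to be found. *)
Lemma Lpnorm_fatou (f_ : nat -> torus -> C) f (B : R) : 0 <= B ->
  (forall k, cmfun (f_ k)) -> cmfun f ->
  (forall k, (Lpnorm m p (f_ k) <= B%:E)%E) ->
  {ae m, forall t, normc (f_ k t) @[k --> \oo] --> normc (f t)} ->
  (Lpnorm m p f <= B%:E)%E.
Proof.
move=> B0 mf_ mf fB fcv; rewrite Lpnorm_leP//.
pose u k t := (normc (f_ k t) `^ p)%:E.
have mu_ k : measurable_fun setT (u k) by exact: measurable_normc_powR.
have mlim : measurable_fun setT (fun t => limn_einf (u ^~ t)).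
  apply: measurableT_comp => //.
  apply: (measurable_fun_limn_esup (f := fun k t => - u k t)%E) => k.
  exact: measurableT_comp.
have le : (\int[m]_t (normc (f t) `^ p)%:E <= \int[m]_t limn_einf (u ^~ t))%E.
  apply: ae_ge0_le_integral => //.
  - by move=> t _; rewrite lee_fin powR_ge0.
  - exact: measurable_normc_powR.
  - move=> t _; rewrite limn_einf_lim; apply: lime_ge; first exact: is_cvg_einfs.
    by apply: nearW => n; apply: le_ereal_inf_tmp => _ [k _ <-]; rewrite lee_fin powR_ge0.
  - apply: negligibleS fcv => t /= nt cvt; apply: nt => _.
    (* Where the limit is 0 the bound is trivial, the powers being nonnegative; elsewhere the power
       function is continuous. *)
    have := normc_ge0 (f t); rewrite le_eqVlt => /predU1P[f0|f0].
      rewrite -f0 powR0 ?gt_eqF// limn_einf_lim; apply: lime_ge; first exact: is_cvg_einfs.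
      by apply: nearW => n; apply: le_ereal_inf_tmp => _ [k _ <-]; rewrite lee_fin powR_ge0.
    have : u k t @[k --> \oo] --> (normc (f t) `^ p)%:E.
      have c2 : normc (f_ k t) `^ p @[k --> \oo] --> normc (f t) `^ p.
        exact: cvg_comp cvt (powR_cvg_pos f0).
      by apply/fine_cvgP; split; [exact: nearW|exact: c2].
    by move=> /cvg_limn_einf_sup[-> _].
apply: le_trans le _.
apply: le_trans (fatou _ measurableT mu_ _) _; first by move=> k t _; rewrite lee_fin powR_ge0.
by apply: limn_einf_le => k; rewrite -Lpnorm_leP.
Qed.

(** In place of Hölder's inequality: x^2 <= e^2 for x <= e, and x^2 <= e^(2 - p) x^p for x > e
    because p >= 2. Integrating over a space of mass 1 gives e^2 twice. *)
Lemma L2_le_Lp f (e : R) : 0 < e -> cmfun f -> (Lpnorm m p f <= e%:E)%E ->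
  (\int[m]_t (normc (f t) ^+ 2)%:E <= (2 * e ^+ 2)%:E)%E.
Proof.
move=> e0 mf; rewrite Lpnorm_leP ?(ltW e0)// => fe.
have ep : 0 < e `^ (2 - p) by exact: powR_gt0.
apply: (@le_trans _ _ (\int[m]_t ((e ^+ 2)%:E + (e `^ (2 - p))%:E * (normc (f t) `^ p)%:E))%E).
  apply: ge0_le_integral => //.
  - by move=> t _; rewrite lee_fin sqr_ge0.
  - by apply/measurable_EFinP/measurable_funX; exact: measurable_normc.
  - by apply: emeasurable_funD => //; apply: emeasurable_funM => //; exact: measurable_normc_powR.
  - move=> t _; rewrite -EFinM -EFinD lee_fin.
    have x0 := normc_ge0 (f t); move: (normc (f t)) x0 => x x0.
    have [xe|ex] := leP x e.
      by rewrite (@le_trans _ _ (e ^+ 2)) ?lerXn2r ?nnegrE ?(ltW e0)// lerDl mulr_ge0// powR_ge0.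
    have xp : 0 < x by exact: lt_trans ex.
    apply: (@le_trans _ _ (e `^ (2 - p) * x `^ p)); last by rewrite lerDr sqr_ge0.
    have -> : x ^+ 2 = x `^ (2 - p) * x `^ p.
      by rewrite -powRD ?subrK ?powR_mulrn ?(ltW xp)// (gt_eqF xp) implybT.
    rewrite ler_wpM2r ?powR_ge0// /powR !gt_eqF// ler_expR.
    by rewrite ler_wnM2l ?subr_le0// ler_ln ?posrE// ltW.
rewrite ge0_integralD//; last 3 first.
- by move=> t _; rewrite lee_fin sqr_ge0.
- by move=> t _; rewrite mule_ge0 ?lee_fin ?powR_ge0.
- by apply: emeasurable_funM => //; exact: measurable_normc_powR.
have -> : (\int[m]_t (e ^+ 2)%:E = (e ^+ 2)%:E)%E.
  rewrite integral_cst// -[RHS]mule1; congr (_ * _)%E; exact: probability_setT.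
rewrite ge0_integralZl_EFin//; last 3 first.
- by move=> t _; rewrite lee_fin powR_ge0.
- exact: measurable_normc_powR.
- exact: powR_ge0.
rewrite (_ : 2 * e ^+ 2 = e ^+ 2 + e `^ (2 - p) * e `^ p); last first.
  by rewrite -powRD ?subrK ?powR_mulrn ?(ltW e0)// ?(gt_eqF e0) ?implybT//; ring.
by rewrite EFinD leeD2l// EFinM lee_wpmul2l// lee_fin ltW.
Qed.

End Lp.

(** * Orthogonality of the characters *)

Section Parseval.
Variable R : realType.
Local Notation C := R[i].
Local Notation torus := (torus R).
Implicit Types c : nat -> C.

Definition dpoly c (M : nat) (t : torus) : C := \sum_(0 <= n < M) c n * chi n t.

Lemma cmfun_dpoly c M : cmfun (dpoly c M).
Proof.
by apply: cmfun_sum => n; apply: cmfunM; [exact: cmfun_cst|exact: cmfun_chi].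
Qed.

Definition rot (j : nat) (x : R) : torus :=
  fun k => if k == j then circle_exp x else circle_one R.

Lemma chi_rot n j x : chi n (rot j x) = val (circle_exp x) ^+ logn (nth_prime j) n.+1.
Proof.
rewrite /chi (@mon_wide _ n (maxn j.+1 n.+1)) ?leq_maxr// big_mkord.
have jK : (j < maxn j.+1 n.+1)%N by exact: leq_maxl.
rewrite (bigD1 (Ordinal jK))//= {1}/rot eqxx big1 ?mulr1// => k kj.
have {}kj : (k != j :> nat) by apply: contra kj => /eqP kj; exact/eqP/val_inj.
by rewrite /rot (negPf kj) /= expr1n.
Qed.

Lemma normc_conjc (z : C) : normc (conjc z) = normc z.
Proof. by case: z => a b; rewrite /normc/= sqrrN. Qed.

Lemma Re_mul_conjc (z : C) : complex.Re (z * conjc z) = normc z ^+ 2.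
Proof.
by case: z => a b; rewrite /normc/= sqr_sqrtr ?addr_ge0 ?sqr_ge0//; ring.
Qed.

Lemma norm_Re_le (z : C) : `|complex.Re z| <= normc z.
Proof.
by case: z => a b; rewrite /normc/= -sqrtr_sqr ler_sqrt ?addr_ge0 ?sqr_ge0// lerDl sqr_ge0.
Qed.

Lemma conjc_circle_exp (x : R) : conjc (val (circle_exp x)) = val (circle_exp (- x)).
Proof. by rewrite /= cosN sinN. Qed.

Lemma Re_sum (I : Type) (r : seq I) (F : I -> C) :
  complex.Re (\sum_(i <- r) F i) = \sum_(i <- r) complex.Re (F i).
Proof. by elim/big_rec2 : _ => // i x y _ <-; rewrite cReD. Qed.

Definition gram c (k l : nat) (t : torus) : R :=
  complex.Re (c k * conjc (c l) * (chi k t * conjc (chi l t))).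

Lemma normc_dpoly2 c M t :
  normc (dpoly c M t) ^+ 2 = \sum_(0 <= k < M) \sum_(0 <= l < M) gram c k l t.
Proof.
rewrite -Re_mul_conjc /dpoly rmorph_sum mulr_suml Re_sum; apply: eq_bigr => k _.
rewrite mulr_sumr Re_sum; apply: eq_bigr => l _; congr complex.Re.
by rewrite rmorphM; ring.
Qed.

Lemma gram_diag c k t : gram c k k t = normc (c k) ^+ 2.
Proof.
rewrite /gram -Re_mul_conjc; congr complex.Re.
have -> : chi k t * conjc (chi k t) = 1; last by rewrite mulr1.
have := Re_mul_conjc (chi k t); rewrite normc_chi expr1n => h.
by move: h; case: (chi k t) => a b /= h; apply/eqP; rewrite eq_complex/= h eqxx/=; apply/eqP; ring.
Qed.

(* Rotating by s changes the sign of the cross term, so its Haar integral vanishes. *)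
Lemma exists_rot_neg k l : k != l ->
  exists s : torus, chi k s * conjc (chi l s) = -1.
Proof.
move=> kl; have [j hj] : exists j, logn (nth_prime j) k.+1 != logn (nth_prime j) l.+1.
  apply: contrapT => /forallNP h; move/eqP: kl; apply; apply: logn_nth_prime_inj => j.
  by apply/eqP/negPn/negP/h.
set e := logn _ _ in hj; set f := logn _ _ in hj.
(* A prime with different exponents e and f in the two integers: rotating its coordinate by pi / (e
   - f) changes the phase of the cross term by exactly pi. *)
exists (rot j (pi / (e%:R - f%:R))); rewrite !chi_rot -!/e -!/f -!circle_expMn.
rewrite conjc_circle_exp -circle_expD.
have -> : pi / (e%:R - f%:R) *+ e - (pi / (e%:R - f%:R)) *+ f = pi :> R.
  set q := pi / _; rewrite -(mulr_natr q e) -(mulr_natr q f) -mulrBr /q divfK//.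
  by rewrite subr_eq0 eqr_nat.
by rewrite /= cospi sinpi; apply/eqP; rewrite eq_complex/= oppr0 !eqxx.
Qed.

Variables (m : probability torus R) (hm : is_haar m).

Lemma measurable_gram c k l : measurable_fun setT (gram c k l).
Proof.
have [h _] : cmfun (fun t => c k * conjc (c l) * (chi k t * conjc (chi l t))).
  apply: cmfunM; first exact: cmfun_cst.
  apply: cmfunM; first exact: cmfun_chi.
  have [h1 h2] := cmfun_chi R l; split.
  - rewrite (_ : (fun t => _) = (fun t => complex.Re (chi l t)))//.
    by apply/funext => t; case: (chi l t).
  - rewrite (_ : (fun t => _) = (fun t => (-1) * complex.Im (chi l t))); first exact: measurable_funM.
    by apply/funext => t; case: (chi l t) => a b; rewrite /= mulN1r.
exact: h.
Qed.

Lemma gram_integrable c k l : m.-integrable setT (EFin \o gram c k l).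
Proof.
apply: measurable_bounded_integrable => //.
- by rewrite (le_lt_trans (probability_le1 _ _))// ltry.
- exact: measurable_gram.
exists (normc (c k) * normc (c l)); split; first by rewrite num_real.
move=> N hN t _; rewrite /= (le_trans (norm_Re_le _))// !normcM !normc_conjc !normc_chi !mulr1.
exact: ltW.
Qed.

Lemma integral_gram c k l : k != l -> (\int[m]_t (gram c k l t)%:E = 0)%E.
Proof.
move=> kl; have [s hs] := exists_rot_neg kl.
have mg : measurable_fun setT (EFin \o gram c k l) by apply/measurable_EFinP; exact: measurable_gram.
have h := integral_torus_mul hm s mg.
have fin := integrable_fin_num measurableT (gram_integrable c k l).
move: h fin; rewrite /=.
under eq_integral => t _.
  rewrite (_ : gram c k l (torus_mul s t) = - gram c k l t); first over.
  rewrite /gram !chiM rmorphM.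
  have -> : chi k s * chi k t * (conjc (chi l s) * conjc (chi l t)) =
    (chi k s * conjc (chi l s)) * (chi k t * conjc (chi l t)) by ring.
  rewrite hs mulN1r mulrN; by case: (_ * _).
under eq_integral do rewrite EFinN.
rewrite integralN/=; last first.
  exact: integrable_add_def (gram_integrable c k l).
case: (\int[m]_t _)%E => // x /= [xx] _; congr EFin.
lra.
Qed.

Lemma parseval c M :
  (\int[m]_t (normc (dpoly c M t) ^+ 2)%:E = (\sum_(0 <= n < M) normc (c n) ^+ 2)%:E)%E.
Proof.
under eq_integral do rewrite normc_dpoly2 -sumEFin.
rewrite integral_sum//=; last first.
  move=> k; rewrite (_ : (fun t => _) = (fun t => \sum_(0 <= l < M) (gram c k l t)%:E)%E).
    by apply: integrable_sum => // l _; exact: gram_integrable.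
  by apply/funext => t; rewrite sumEFin.
rewrite -sumEFin; apply: eq_big_nat => k /andP[_ kM].
under eq_integral do rewrite -sumEFin.
rewrite integral_sum//=; last by move=> l; exact: gram_integrable.
rewrite (bigD1_seq k) ?iota_uniq//=; last by rewrite mem_index_iota kM.
rewrite big1 ?adde0; last by move=> l lk; apply: integral_gram; rewrite eq_sym.
under eq_integral do rewrite gram_diag.
by rewrite integral_cst// -[RHS]mule1; congr (_ * _)%E; exact: probability_setT.
Qed.

End Parseval.

(** * Contractivity of dilations *)

Section Contraction.
Variable R : realType.
Local Notation C := R[i].
Local Notation torus := (torus R).
Implicit Types c : nat -> C.

Definition omega (N : nat) : C := val (circle_exp (2 * pi / N%:R : R)).

Lemma omega_expE N k : omega N ^+ k = val (circle_exp (2 * pi / N%:R *+ k : R)).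
Proof. by rewrite circle_expMn. Qed.

Lemma omegaN N : (0 < N)%N -> omega N ^+ N = 1.
Proof.
move=> N0; rewrite omega_expE -(mulr_natr _ N) divfK ?pnatr_eq0 -?lt0n//.
by rewrite /= mulrC mulr_natr cos2pi sin2pi.
Qed.

Lemma omega_conj N : omega N * conjc (omega N) = 1.
Proof. by rewrite conjc_circle_exp -circle_expD subrr circle_exp0. Qed.

Lemma omega_neq1 N k : (0 < k < N)%N -> omega N ^+ k != 1.
Proof.
move=> /andP[k0 kN]; apply/negP => /eqP; rewrite omega_expE => -[+ _].
set y : R := pi * k%:R / N%:R.
have -> : 2 * pi / N%:R *+ k = y *+ 2 :> R.
  by rewrite -(mulr_natr _ k) -(mulr_natr _ 2) /y; ring.
have N0 : 0 < N%:R :> R by rewrite ltr0n (leq_trans _ kN)// ltnS ltnW.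
have y0 : 0 < y < pi.
  have k0' : 0 < k%:R :> R by rewrite ltr0n.
  apply/andP; split; first exact: divr_gt0 (mulr_gt0 (pi_gt0 R) k0') N0.
  by rewrite ltr_pdivrMr// ltr_pM2l ?pi_gt0// ltr_nat.
have := sin_gt0_pi y0; have := cos2Dsin2 y; rewrite cos_mulr2n.
nra.
Qed.

Lemma omega_neq0 N : omega N != 0.
Proof.
by apply/negP => /eqP o0; have := omega_conj N; rewrite o0 mul0r => /eqP; rewrite eq_sym oner_eq0.
Qed.

Lemma omega_inj N a b : (a < N)%N -> (b < N)%N -> omega N ^+ a = omega N ^+ b -> a = b.
Proof.
have o0 : omega N != 0 := omega_neq0 N.
have aux x y : (x < y)%N -> (y < N)%N -> omega N ^+ x <> omega N ^+ y.
  move=> xy yN; rewrite -(subnK (ltnW xy)) exprD -{1}[_ ^+ x]mul1r => /mulIf h.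
  have := @omega_neq1 N (y - x); rewrite subn_gt0 xy/= (leq_ltn_trans (leq_subr _ _) yN).
  by move=> /(_ isT); rewrite -h ?eqxx// expf_neq0.
by move=> aN bN; have [ab|ab|//] := ltngtP a b => h; case: (aux _ _ ab _) => //.
Qed.

Lemma conjc_omega N : conjc (omega N) = (omega N)^-1.
Proof. by apply: (mulfI (omega_neq0 N)); rewrite omega_conj divff// omega_neq0. Qed.

Lemma omega_sum N a b : (a < N)%N -> (b < N)%N ->
  \sum_(0 <= l < N) (omega N ^+ a / omega N ^+ b) ^+ l =
  if a == b then N%:R else 0 :> C.
Proof.
move=> aN bN; have N0 : (0 < N)%N by exact: leq_ltn_trans aN.
have ob : omega N ^+ b != 0 by rewrite expf_neq0// omega_neq0.
set x := _ / _.
have [ab|ab] := eqVneq a b.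
  have -> : x = 1 by rewrite /x ab divff.
  by under eq_bigr do rewrite expr1n; rewrite big_mkord sumr_const card_ord.
have xN : x ^+ N = 1.
  by rewrite /x expr_div_n -!exprM ![(_ * N)%N]mulnC !exprM omegaN// !expr1n divr1.
have x1 : x - 1 != 0.
  rewrite subr_eq0; apply: contra ab => /eqP x1; apply/eqP.
  by apply: (omega_inj aN bN); rewrite -[RHS]mul1r -x1 /x divfK.
have := subrX1 x N; rewrite xN subrr -(big_mkord xpredT (fun i => x ^+ i)) => /esym/eqP.
by rewrite mulf_eq0 (negPf x1) => /eqP.
Qed.

(** A truncation of 1 / (1 - r z) at the root of unity z = omega^l. Since (1 - r^2) / |1 - r z|^2 is
    the Poisson kernel, [weight] is a truncated Poisson kernel on the N-th roots of unity. *)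
Definition kernel_poly (r : R) K N l : C :=
  \sum_(0 <= i < K) (r ^+ i)%:C%C * (omega N ^+ l) ^+ i.

(* A positive discrete kernel on the N-th roots of unity whose transform tends to r ^+ k:
   the dilation of one variable by r is a limit of means of rotations, hence contractive. *)
Definition weight (r : R) K N l : R :=
  (1 - r ^+ 2) / N%:R * normc (kernel_poly r K N l) ^+ 2.

Lemma weight_ge0 r K N l : 0 <= r < 1 -> 0 <= weight r K N l.
Proof.
move=> /andP[r0 r1]; rewrite mulr_ge0 ?sqr_ge0// divr_ge0//.
by rewrite subr_ge0 expr_le1// ltW.
Qed.

Lemma normc2C (z : C) : (normc z ^+ 2)%:C%C = z * conjc z.
Proof.
rewrite -Re_mul_conjc; case: z => a b; apply/eqP; rewrite eq_complex/= eqxx/=.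
by apply/eqP; ring.
Qed.

Lemma sum_weight r K N k : (k <= K)%N -> (K + k <= N)%N -> (0 < N)%N ->
  \sum_(0 <= l < N) (weight r K N l)%:C%C * (omega N ^+ l) ^+ k =
  (r ^+ k * (1 - (r ^+ 2) ^+ (K - k)))%:C%C.
Proof.
move=> kK KN N0.
transitivity (((1 - r ^+ 2) / N%:R)%:C%C * \sum_(0 <= i < K) \sum_(0 <= j < K)
   (r ^+ (i + j))%:C%C *
   \sum_(0 <= l < N) (omega N ^+ (i + k) / omega N ^+ j) ^+ l).
  under eq_bigr => l _.
    rewrite /weight rmorphM/= normc2C /kernel_poly rmorph_sum big_distrl/=.
    under eq_bigr do rewrite big_distrr/=.
    over.
  rewrite /= mulr_sumr.
  under [RHS]eq_bigr do rewrite mulr_sumr.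
  under [RHS]eq_bigr => i _ do under eq_bigr do rewrite mulr_sumr mulr_sumr.
  under [RHS]eq_bigr do rewrite exchange_big/=.
  rewrite [RHS]exchange_big/=; apply: eq_bigr => l _.
  rewrite mulr_sumr mulr_suml; apply: eq_bigr => i _.
  rewrite mulr_sumr mulr_suml; apply: eq_bigr => j _.
  have -> : ((r ^+ j)%:C%C * omega N ^+ l ^+ j)^*%C = (r ^+ j)%:C%C / omega N ^+ j ^+ l.
    transitivity (((r ^+ j)%:C^*)%C * conjc (omega N) ^+ l ^+ j).
      by rewrite -!rmorphXn -rmorphM.
    by rewrite conjc_real conjc_omega -exprM mulnC exprM exprVn exprVn.
  rewrite exprD rmorphM expr_div_n [omega N ^+ (i + k)]exprD exprMn.
  by rewrite -!exprM ![(l * _)%N]mulnC; ring.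
(* [K + k <= N] keeps both exponents below N, so orthogonality selects j = i + k without wrapping
   around modulo N. *)
under eq_big_nat => i /andP[_ iK].
  under eq_big_nat => j /andP[_ jK].
    rewrite omega_sum; [|lia|lia].
    over.
  over.
rewrite /=.
(* The index j = i + k stays below K only for i < K - k; this truncation produces the factor 1 -
   r^(2 (K - k)). *)
have row i : (i < K)%N -> \sum_(0 <= j < K) (r ^+ (i + j))%:C%C * (if (i + k)%N == j then N%:R else 0) =
   if (i < K - k)%N then (r ^+ k * (r ^+ 2) ^+ i)%:C%C * N%:R else 0 :> C.
  move=> iK; case: ifPn => ik.
    rewrite (bigD1_seq (i + k)%N) ?iota_uniq ?mem_index_iota//=; last lia.
    rewrite eqxx big1 ?addr0; last by move=> j /negPf; rewrite eq_sym => ->; rewrite mulr0.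
    congr (_%:C%C * _); rewrite -exprM -exprD; congr (_ ^+ _); lia.
  rewrite big_nat big1// => j jK.
  by rewrite ifF ?mulr0//; apply/negbTE/eqP; lia.
rewrite (eq_big_nat _ _ (F2 := fun i => if (i < K - k)%N then (r ^+ k * (r ^+ 2) ^+ i)%:C%C * N%:R else 0)); last first.
  by move=> i /andP[_ iK]; exact: row.
rewrite (big_cat_nat (n := (K - k)%N))//= ?leq_subr//.
rewrite [X in _ * (_ + X)]big_nat [X in _ * (_ + X)]big1 ?addr0; last first.
  by move=> i /andP[ik _]; rewrite ltnNge ik.
rewrite (eq_big_nat _ _ (F2 := fun i => (r ^+ k * N%:R)%:C%C * ((r ^+ 2) ^+ i)%:C%C)); last first.
  move=> i /andP[_ ->]; rewrite !rmorphM/= rmorph_nat; ring.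
rewrite -mulr_sumr -rmorph_sum -!rmorphM/=; congr (_%:C%C).
have := subrX1 (r ^+ 2) (K - k)%N; rewrite -(big_mkord xpredT (fun i => (r ^+ 2) ^+ i)) => h.
rewrite mulrA [X in X * _]mulrACA.
rewrite (_ : (1 - r ^+ 2) * r ^+ k * (N%:R^-1 * N%:R) = - r ^+ k * (r ^+ 2 - 1)); last first.
  by rewrite mulVf ?pnatr_eq0 -?lt0n//; ring.
by rewrite -mulrA -h; ring.
Qed.

End Contraction.

Section Contraction_Lp.
Variables (R : realType) (m : probability (torus R) R) (hm : is_haar m).
Variables (p : R) (p2 : 2 <= p).
Local Notation C := R[i].
Local Notation torus := (torus R).
Implicit Types c : nat -> C.
Local Notation lnS := (@lnS R).

Lemma Lpnorm0 : Lpnorm m p (fun=> 0) = 0%E.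
Proof.
rewrite /Lpnorm (eq_Lnorm _ _ (g := cst 0%E)); last by move=> t; rewrite normc0.
apply: Lnorm0; rewrite eqe; apply: lt0r_neq0; have := p2; lra.
Qed.

Lemma Lpnorm_sum (I : Type) (r : seq I) (w : I -> R) (f : I -> torus -> C) (B : \bar R) :
  (forall i, 0 <= w i) -> (forall i, cmfun (f i)) ->
  (forall i, Lpnorm m p (f i) = B) ->
  (Lpnorm m p (fun t => \sum_(i <- r) (w i)%:C%C * f i t)%R <= (\sum_(i <- r) w i)%R%:E * B)%E.
Proof.
move=> w0 mf fB; elim: r => [|i r ih].
  under [X in Lpnorm _ _ X]eq_fun do rewrite big_nil.
  by rewrite big_nil mul0e Lpnorm0.
under [X in Lpnorm _ _ X]eq_fun do rewrite big_cons.
have mw j : cmfun (fun t => (w j)%:C%C * f j t).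
  by apply: cmfunM => //; exact: cmfun_cst.
apply: le_trans (LpnormD m p2 (mw i) (cmfun_sum _ mw)) _.
rewrite big_cons EFinD ge0_muleDl ?lee_fin ?sumr_ge0// leeD//.
by rewrite LpnormZ// fB.
Qed.

Lemma cvg_normc (f_ : nat -> C) (z : C) :
  complex.Re (f_ k) @[k --> \oo] --> complex.Re z ->
  complex.Im (f_ k) @[k --> \oo] --> complex.Im z ->
  normc (f_ k) @[k --> \oo] --> normc z.
Proof.
move=> cr ci.
have E w : normc w = Num.sqrt (complex.Re w ^+ 2 + complex.Im w ^+ 2) :> R by case: w.
rewrite E; under eq_fun do rewrite E.
have cs : complex.Re (f_ k) ^+ 2 + complex.Im (f_ k) ^+ 2 @[k --> \oo] -->
    complex.Re z ^+ 2 + complex.Im z ^+ 2.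
  by apply: cvgD; rewrite !expr2; under eq_fun do rewrite expr2; exact: cvgM.
exact: cvg_comp cs (@sqrt_continuous R _).
Qed.

Lemma Im_sum (I : Type) (r : seq I) (F : I -> C) :
  complex.Im (\sum_(i <- r) F i) = \sum_(i <- r) complex.Im (F i).
Proof. by elim/big_rec2 : _ => // i x y _ <-; rewrite cImD. Qed.

Definition cscale c (s : nat -> R) (n : nat) : C := c n * (s n)%:C%C.

Lemma Re_dpoly_scale c s M t :
  complex.Re (dpoly (cscale c s) M t) = \sum_(0 <= n < M) s n * complex.Re (c n * chi n t).
Proof.
rewrite Re_sum; apply: eq_bigr => n _; rewrite /cscale mulrAC mulrC.
by case: (c n * chi n t) => a b; rewrite /=; ring.
Qed.

Lemma Im_dpoly_scale c s M t :
  complex.Im (dpoly (cscale c s) M t) = \sum_(0 <= n < M) s n * complex.Im (c n * chi n t).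
Proof.
rewrite Im_sum; apply: eq_bigr => n _; rewrite /cscale mulrAC mulrC.
by case: (c n * chi n t) => a b; rewrite /=; ring.
Qed.

Lemma cvg_normc_dpoly_scale c (s_ : nat -> nat -> R) s M t :
  (forall n, (n < M)%N -> s_ k n @[k --> \oo] --> s n) ->
  normc (dpoly (cscale c (s_ k)) M t) @[k --> \oo] --> normc (dpoly (cscale c s) M t).
Proof.
move=> cs; have aux (F : nat -> R) : \sum_(0 <= n < M) s_ k n * F n @[k --> \oo] -->
    \sum_(0 <= n < M) s n * F n.
  under eq_fun do rewrite big_mkord; rewrite big_mkord.
  apply: cvg_big => [|n _]; first exact: add_continuous.
  by apply: cvgMl; exact: cs.
apply: cvg_normc.
  by rewrite Re_dpoly_scale; under eq_fun do rewrite Re_dpoly_scale; exact: aux.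
by rewrite Im_dpoly_scale; under eq_fun do rewrite Im_dpoly_scale; exact: aux.
Qed.

Section one_variable.
Variables (j : nat) (r : R) (r01 : 0 <= r < 1).

Let v n := logn (nth_prime j) n.+1.

Let trunc K n : R := r ^+ v n * (1 - (r ^+ 2) ^+ (K - v n)).

(** The truncated dilation is a combination of rotations with nonnegative weights of total mass 1 -
    r^(2 K) <= 1, the case k = 0 of [sum_weight]; rotations preserve the norm and Minkowski's
    inequality applies. *)
Lemma Lpnorm_trunc c M K : (M <= K)%N -> (0 < K)%N ->
  (Lpnorm m p (dpoly (cscale c (trunc K)) M) <= Lpnorm m p (dpoly c M))%E.
Proof.
move=> MK K0; pose N := (K + K)%N; have N0 : (0 < N)%N by rewrite addn_gt0 K0.
pose f l (t : torus) := dpoly c M (torus_mul (rot j (2 * pi / N%:R *+ l)) t).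
have fE t : dpoly (cscale c (trunc K)) M t =
    \sum_(0 <= l < N) (weight r K N l)%:C%C * f l t.
  under [RHS]eq_bigr do rewrite mulr_sumr.
  rewrite exchange_big/=; apply: eq_big_nat => n /andP[_ nM].
  have vK : (v n <= K)%N.
    by rewrite ltnW// (leq_trans (ltn_logl _ (ltn0Sn n)))// (leq_trans nM).
  rewrite /cscale -(@sum_weight R r K N (v n))// ?leq_add2l//.
  rewrite mulr_sumr mulr_suml; apply: eq_bigr => l _.
  by rewrite chiM chi_rot -omega_expE; ring.
rewrite (funext fE).
have mf l : cmfun (f l).
  exact: (cmfun_comp (measurable_torus_mul (rot j (2 * pi / N%:R *+ l))) (cmfun_dpoly c M)).
have fB l : Lpnorm m p (f l) = Lpnorm m p (dpoly c M).
  exact: (Lpnorm_torus_mul p hm _ (cmfun_dpoly c M)).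
apply: le_trans (Lpnorm_sum _ (fun l => weight_ge0 K N l r01) mf fB) _.
rewrite -[leRHS]mul1e lee_wpmul2r ?Lpnorm_ge0// lee_fin.
have := @sum_weight R r K N 0 (leq0n _); rewrite addn0 leq_addr => /(_ isT N0).
under eq_bigr do rewrite expr0 mulr1.
rewrite -rmorph_sum => -[->]; rewrite expr0 mul1r gerBl exprn_ge0// exprn_ge0//.
by case/andP: r01.
Qed.

(** As the truncation K tends to infinity the factors 1 - r^(2 (K - v n)) tend to 1. The choice K =
    (k + M).+1 keeps K above all exponents that occur. *)
Lemma Lpnorm_dilate1 c M :
  (Lpnorm m p (dpoly (cscale c (fun n => (r ^+ v n)%R)) M) <= Lpnorm m p (dpoly c M))%E.
Proof.
have := Lpnorm_ge0 m p (dpoly c M); case B : (Lpnorm m p (dpoly c M)) => [b| |]//; last first.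
  by move=> _; rewrite leey.
rewrite lee_fin => b0.
apply: (@Lpnorm_fatou R m p p2 (fun k => dpoly (cscale c (trunc (k + M).+1)) M)) => //.
- by move=> k; exact: cmfun_dpoly.
- exact: cmfun_dpoly.
- by move=> k; rewrite -B Lpnorm_trunc// ltnW// ltnS leq_addl.
apply: aeW => t; apply: cvg_normc_dpoly_scale => n nM.
rewrite /trunc -[X in _ --> X]mulr1; apply: cvgMr.
rewrite -[X in _ --> X]subr0; apply: cvgB; first exact: cvg_cst.
have r2 : `|r ^+ 2| < 1.
  by case/andP: r01 => r0 r1; rewrite ger0_norm ?exprn_ge0// expr_lt1.
have h : (r ^+ 2) ^+ k @[k --> \oo] --> (0 : R) by exact: cvg_expr.
have vM : (v n <= M)%N by rewrite ltnW// (leq_trans (ltn_logl _ (ltn0Sn n))).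
have -> : (fun k => (r ^+ 2) ^+ ((k + M).+1 - v n)) =
    (fun k => (r ^+ 2) ^+ (k + (M.+1 - v n))).
  by apply/funext => k; rewrite addnBA ?addnS// ltnW.
by rewrite (@cvg_shiftn (M.+1 - v n)%N).
Qed.

End one_variable.

Lemma Lpnorm_dilate (r : nat -> R) c M J : (forall j, 0 <= r j < 1) ->
  (Lpnorm m p (dpoly (cscale c (fun n => (\prod_(0 <= j < J) r j ^+ logn (nth_prime j) n.+1)%R)) M)
   <= Lpnorm m p (dpoly c M))%E.
Proof.
move=> r01; elim: J => [|J ih].
  rewrite (_ : cscale _ _ = c)//; apply/funext => n.
  by rewrite /cscale big_geq// mulr1.
apply: le_trans ih; rewrite (_ : cscale c (fun n => \prod_(0 <= j < J.+1) _) =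
    cscale (cscale c (fun n => \prod_(0 <= j < J) r j ^+ logn (nth_prime j) n.+1))
      (fun n => r J ^+ logn (nth_prime J) n.+1)).
  exact: Lpnorm_dilate1.
by apply/funext => n; rewrite /cscale big_nat_recr//= rmorphM mulrA.
Qed.

Lemma Lpnorm_b (theta : R) c M : 0 < theta ->
  (Lpnorm m p (dpoly (cscale c (fun n => expR (- (theta * lnS n))%R)) M)
   <= Lpnorm m p (dpoly c M))%E.
Proof.
move=> th; pose r j : R := (nth_prime j)%:R `^ (- theta).
have r01 j : 0 <= r j < 1.
  rewrite powR_ge0/= /r powRN invf_lt1 ?powR_gt0 ?ltr0n ?prime_gt0 ?nth_prime_prime//.
  have p1 : 1 < (nth_prime j)%:R :> R by rewrite ltr1n prime_gt1// nth_prime_prime.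
  have := gt0_ltr_powR th _ _ p1; rewrite powR1; apply; rewrite nnegrE//.
(* Integers up to M have all their prime factors among the first M primes, so dilating M variables
   is enough. *)
have := @Lpnorm_dilate r c M M r01.
rewrite (_ : dpoly (cscale c (fun n => \prod_(0 <= j < M) _)) M =
  dpoly (cscale c (fun n => expR (- (theta * lnS n)))) M)//.
apply/funext => t; apply: eq_big_nat => n /andP[_ nM]; rewrite /cscale -mon_diam.
rewrite (mon_wide _ nM) rmorph_prod; congr (_ * _ * _); apply: eq_bigr => j _.
by rewrite rmorphXn.
Qed.

End Contraction_Lp.

(** * Functions in H^p and their values *)

Section Coefficients.
Variables (R : realType) (m : probability (torus R) R) (hm : is_haar m).
Variables (p : R) (p2 : 2 <= p).
Local Notation C := R[i].
Local Notation torus := (torus R).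
Local Notation lnS := (@lnS R).
Implicit Types P Q : cpoly R.

Lemma normcB_sym (x y : C) : normc (x - y) = normc (y - x).
Proof. by rewrite -normcN opprB. Qed.

Lemma dpoly_wide (c : nat -> C) M N t : (M <= N)%N -> (forall n, (M <= n)%N -> c n = 0) ->
  dpoly c N t = dpoly c M t.
Proof.
move=> MN c0; rewrite /dpoly (big_cat_nat (n := M))//= [X in _ + X]big_nat.
by rewrite [X in _ + X]big1 ?addr0// => n /andP[Mn _]; rewrite c0// mul0r.
Qed.

Definition bohr_spec (P : cpoly R) (cM : (nat -> C) * nat) : Prop :=
  (forall n, (cM.2 <= n)%N -> cM.1 n = 0) /\
  forall z, peval P z = \sum_(0 <= n < cM.2) cM.1 n * mon n z.

Lemma bohr_ex : exists B : cpoly R -> (nat -> C) * nat, forall P, bohr_spec P (B P).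
Proof.
have h P : exists cM, bohr_spec P cM.
  by have [c [M [h1 h2]]] := peval_mon P; exists (c, M).
by have [B hB] := choice h; exists B.
Qed.

Definition bohr : cpoly R -> (nat -> C) * nat := projT1 (cid bohr_ex).
Definition bohr_coef P := (bohr P).1.
Definition bohr_bound P := (bohr P).2.

Lemma bohrP P : bohr_spec P (bohr P).
Proof. exact: (projT2 (cid bohr_ex)). Qed.

Lemma on_torusE P t : on_torus P t = dpoly (bohr_coef P) (bohr_bound P) t.
Proof. by rewrite /on_torus (bohrP P).2. Qed.

Lemma peval_bE P theta t : peval P (b_ theta t) =
  dpoly (cscale (bohr_coef P) (fun n => expR (- (theta * lnS n)))) (bohr_bound P) t.
Proof.
rewrite (bohrP P).2; apply: eq_bigr => n _; rewrite mon_b /cscale /bohr_coef /chi.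
by rewrite mulrA.
Qed.

Lemma cmfun_on_torus P : cmfun (on_torus P).
Proof. by rewrite (funext (on_torusE P)); exact: cmfun_dpoly. Qed.

Lemma cmfun_peval_b P theta : cmfun (fun t => peval P (b_ theta t)).
Proof. by rewrite (funext (peval_bE P theta)); exact: cmfun_dpoly. Qed.

Lemma peval_bB P Q theta t : peval P (b_ theta t) - peval Q (b_ theta t) =
  dpoly (cscale (fun n => bohr_coef P n - bohr_coef Q n) (fun n => expR (- (theta * lnS n))))
    (maxn (bohr_bound P) (bohr_bound Q)) t.
Proof.
have h P' M : (bohr_bound P' <= M)%N -> peval P' (b_ theta t) =
    dpoly (cscale (bohr_coef P') (fun n => expR (- (theta * lnS n)))) M t.
  move=> PM; rewrite peval_bE; apply/esym/dpoly_wide => // n Pn.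
  by rewrite /cscale /bohr_coef (bohrP P').1// mul0r.
rewrite (h P _ (leq_maxl (bohr_bound P) (bohr_bound Q))) (h Q _ (leq_maxr (bohr_bound P) (bohr_bound Q))) -sumrB; apply: eq_bigr => n _.
by rewrite /cscale; ring.
Qed.

Lemma on_torusB P Q t : on_torus P t - on_torus Q t =
  dpoly (fun n => bohr_coef P n - bohr_coef Q n) (maxn (bohr_bound P) (bohr_bound Q)) t.
Proof.
have h P' M : (bohr_bound P' <= M)%N -> on_torus P' t = dpoly (bohr_coef P') M t.
  move=> PM; rewrite on_torusE; apply/esym/dpoly_wide => // n Pn.
  by rewrite /bohr_coef (bohrP P').1.
rewrite (h P _ (leq_maxl (bohr_bound P) (bohr_bound Q))) (h Q _ (leq_maxr (bohr_bound P) (bohr_bound Q))) -sumrB; apply: eq_bigr => n _.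
by ring.
Qed.

Lemma Lpdist_b P Q theta : 0 < theta ->
  (Lpdist m p (fun t => peval P (b_ theta t)) (fun t => peval Q (b_ theta t)) <=
   Lpdist m p (on_torus P) (on_torus Q))%E.
Proof.
move=> th; rewrite /Lpdist (funext (peval_bB P Q theta)) (funext (on_torusB P Q)).
exact: Lpnorm_b.
Qed.

Lemma LpdistC f g : Lpdist m p f g = Lpdist m p g f.
Proof. by apply: eq_Lnorm => t; rewrite normcB_sym. Qed.

Lemma Lpdist_triangle (f g h : torus -> C) : cmfun f -> cmfun g -> cmfun h ->
  (Lpdist m p f h <= Lpdist m p f g + Lpdist m p g h)%E.
Proof.
move=> mf mg mh; rewrite {1}/Lpdist.
rewrite (_ : (fun t => f t - h t) = (fun t => (f t - g t) + (g t - h t))).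
  by apply: LpnormD => //; exact: cmfunB.
by apply/funext => t; rewrite addrA subrK.
Qed.

(** Parseval for the difference of two polynomials, after [L2_le_Lp]; this is where p >= 2 passes to
    the coefficients. *)
Lemma coef_dist P Q (e : R) N : 0 < e ->
  (Lpdist m p (on_torus P) (on_torus Q) <= e%:E)%E ->
  \sum_(0 <= n < N) normc (bohr_coef P n - bohr_coef Q n) ^+ 2 <= 2 * e ^+ 2.
Proof.
move=> e0 h; set M := maxn N (maxn (bohr_bound P) (bohr_bound Q)).
have h2 := @L2_le_Lp R m p p2 _ _ e0 (cmfunB (cmfun_on_torus P) (cmfun_on_torus Q)) h.
have E t : normc (on_torus P t - on_torus Q t) =
    normc (dpoly (fun n => bohr_coef P n - bohr_coef Q n) M t).
  rewrite on_torusB (@dpoly_wide _ (maxn (bohr_bound P) (bohr_bound Q)) M)// ?leq_maxr// => n.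
  by rewrite geq_max => /andP[h3 h4]; rewrite /bohr_coef (bohrP P).1// (bohrP Q).1// subrr.
move: h2; under eq_integral do rewrite E; rewrite (parseval hm) lee_fin.
apply: le_trans; rewrite [leRHS](big_cat_nat (n := N))//= ?leq_maxl// lerDl.
by apply: sumr_ge0 => n _; exact: sqr_ge0.
Qed.

Variables (F : torus -> C) (hF : Hp m p F).

Let mF : cmfun F. Proof. by case: hF => -[]. Qed.

Lemma approx_ex : exists P_ : nat -> cpoly R,
  forall k, (Lpdist m p (on_torus (P_ k)) F < (k.+1%:R^-1)%:E)%E.
Proof.
have h k : exists P : cpoly R, (Lpdist m p (on_torus P) F < (k.+1%:R^-1)%:E)%E.
  by case: hF => _; apply; rewrite invr_gt0.
by have [P_ hP] := choice h; exists P_.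
Qed.

Definition approx : nat -> cpoly R := projT1 (cid approx_ex).

Lemma approxP k : (Lpdist m p (on_torus (approx k)) F < (k.+1%:R^-1)%:E)%E.
Proof. exact: (projT2 (cid approx_ex)). Qed.

Lemma approx_dist P (e : R) k : (Lpdist m p (on_torus P) F <= e%:E)%E ->
  (Lpdist m p (on_torus P) (on_torus (approx k)) <= (e + k.+1%:R^-1)%:E)%E.
Proof.
move=> h; apply: le_trans (Lpdist_triangle (cmfun_on_torus P) mF (cmfun_on_torus _)) _.
by rewrite EFinD leeD// LpdistC ltW// approxP.
Qed.

Lemma coef_approx P (e : R) k N : 0 < e -> (Lpdist m p (on_torus P) F <= e%:E)%E ->
  k.+1%:R^-1 <= e ->
  \sum_(0 <= n < N) normc (bohr_coef P n - bohr_coef (approx k) n) ^+ 2 <= 8 * e ^+ 2.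
Proof.
move=> e0 h ke; have h2 := approx_dist k h.
have e2 : 0 < e + e by lra.
have := @coef_dist P (approx k) (e + e) N e2.
rewrite (_ : 2 * (e + e) ^+ 2 = 8 * e ^+ 2); last by ring.
by apply; apply: le_trans h2 _; rewrite lee_fin lerD2l.
Qed.

Lemma near_invS (e : R) : 0 < e -> \forall k \near \oo, k.+1%:R^-1 <= e.
Proof. by move=> e0; near=> k; rewrite ltW//; near: k; exact: near_infty_natSinv_lt (PosNum e0).
Unshelve. all: by end_near. Qed.

Lemma cvg_part (f : C -> R) n :
  (forall x y, f (x - y) = f x - f y) -> (forall x, `|f x| <= normc x) ->
  cvg (f (bohr_coef (approx k) n) @[k --> \oo]).
Proof.
move=> fB fn; apply/cauchy_cvgP/cauchy_exP => e e0.
(* The divisor 4 is chosen so that 8 (e / 4)^2 = e^2 / 2 < e^2. *)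
have e8 : 0 < e / 4 by rewrite divr_gt0.
have [K _ hK] := near_invS e8.
exists (f (bohr_coef (approx K) n)); exists K => // k Kk; rewrite -ball_normE/= -fB.
apply: le_lt_trans (fn _) _.
have h := @coef_approx (approx K) (e / 4) k n.+1 e8.
have {}h : normc (bohr_coef (approx K) n - bohr_coef (approx k) n) ^+ 2 <= 8 * (e / 4) ^+ 2.
  apply: le_trans (h _ _); last exact: hK.
    by rewrite big_nat_recr//= lerDr sumr_ge0// => i _; exact: sqr_ge0.
  by apply: le_trans (ltW (approxP K)) _; rewrite lee_fin; apply: hK => /=.
have n0 := normc_ge0 (bohr_coef (approx K) n - bohr_coef (approx k) n).
rewrite -ltr_sqr ?nnegrE ?(ltW e0)//; apply: le_lt_trans h _; nra.
Qed.

(** Coefficients are taken as limits along the approximating polynomials instead of as Fourier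
    integrals, so that the l^2 estimates pass to the limit term by term. *)
Definition coefRe n := limn (fun k => complex.Re (bohr_coef (approx k) n)).
Definition coefIm n := limn (fun k => complex.Im (bohr_coef (approx k) n)).
Definition coef n : C := (coefRe n +i* coefIm n)%C.

Lemma norm_Im_le (z : C) : `|complex.Im z| <= normc z.
Proof.
by case: z => a b; rewrite /normc/= -sqrtr_sqr ler_sqrt ?addr_ge0 ?sqr_ge0// lerDr sqr_ge0.
Qed.

Lemma cReB (x y : C) : complex.Re (x - y) = complex.Re x - complex.Re y.
Proof. by case: x y => [? ?] [? ?]. Qed.

Lemma cImB (x y : C) : complex.Im (x - y) = complex.Im x - complex.Im y.
Proof. by case: x y => [? ?] [? ?]. Qed.

Lemma cvg_coefRe n : complex.Re (bohr_coef (approx k) n) @[k --> \oo] --> coefRe n.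
Proof. by have := @cvg_part (@complex.Re R) n cReB (@norm_Re_le R). Qed.

Lemma cvg_coefIm n : complex.Im (bohr_coef (approx k) n) @[k --> \oo] --> coefIm n.
Proof. by have := @cvg_part (@complex.Im R) n cImB norm_Im_le. Qed.

Lemma coef_near P (e : R) N : 0 < e -> (Lpdist m p (on_torus P) F <= e%:E)%E ->
  \sum_(0 <= n < N) normc (bohr_coef P n - coef n) ^+ 2 <= 8 * e ^+ 2.
Proof.
move=> e0 h.
have cv : \sum_(0 <= n < N) normc (bohr_coef P n - bohr_coef (approx k) n) ^+ 2 @[k --> \oo] -->
    \sum_(0 <= n < N) normc (bohr_coef P n - coef n) ^+ 2.
  apply: cvg_big => [|n _]; first exact: add_continuous.
  have cn : normc (bohr_coef P n - bohr_coef (approx k) n) @[k --> \oo] --> normc (bohr_coef P n - coef n).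
    apply: cvg_normc.
    - rewrite cReB; under eq_fun do rewrite cReB.
      by apply: cvgB; [exact: cvg_cst|exact: cvg_coefRe].
    - rewrite cImB; under eq_fun do rewrite cImB.
      by apply: cvgB; [exact: cvg_cst|exact: cvg_coefIm].
  by rewrite expr2; under eq_fun do rewrite expr2; exact: cvgM.
apply: (cvgr_to_le cv); near=> k; apply: coef_approx => //.
by near: k; exact: near_invS.
Unshelve. all: by end_near. Qed.

Lemma normcB_sqr (x y : C) : normc y ^+ 2 <= 2 * normc x ^+ 2 + 2 * normc (x - y) ^+ 2.
Proof.
have h : normc y <= normc x + normc (x - y).
  have E : y = x + (y - x) by rewrite addrC subrK.
  rewrite [X in normc X <= _]E (le_trans (le_normcD _ _))// lerD2l.
  by rewrite normcB_sym.
have := normc_ge0 x; have := normc_ge0 y; have := normc_ge0 (x - y).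
move: (normc x) (normc y) (normc (x - y)) h => u v w h w0 v0 u0.
have := sqr_ge0 (u - w); nra.
Qed.

Lemma coef_energy : exists B : R, forall N, \sum_(0 <= n < N) normc (coef n) ^+ 2 <= B.
Proof.
have h N := @coef_near (approx 0) 1 N ltr01.
(* Comparison with the first approximant, at distance at most 1 from F: 16 = 2 * 8 with 8 from
   [coef_near]. *)
exists (2 * \sum_(0 <= n < bohr_bound (approx 0)) normc (bohr_coef (approx 0) n) ^+ 2 + 16) => N.
apply: (@le_trans _ _ (\sum_(0 <= n < N)
   (2 * normc (bohr_coef (approx 0) n) ^+ 2 + 2 * normc (bohr_coef (approx 0) n - coef n) ^+ 2))).
  by apply: ler_sum => n _; exact: normcB_sqr.
rewrite big_split/= -!mulr_sumr lerD//; last first.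
  have : (Lpdist m p (on_torus (approx 0)) F <= 1%:E)%E.
    by have := ltW (approxP 0); rewrite invr1.
  move=> /(h N); rewrite expr1n; lra.
rewrite ler_wpM2l//; set D := bohr_bound _.
have c0 n : (D <= n)%N -> normc (bohr_coef (approx 0) n) ^+ 2 = 0.
  by move=> Dn; rewrite /bohr_coef (bohrP (approx 0)).1// normc0 expr0n.
have [ND|/ltnW DN] := leqP N D.
  by rewrite [leRHS](big_cat_nat (n := N))//= lerDl sumr_ge0// => i _; exact: sqr_ge0.
rewrite [leLHS](big_cat_nat (n := D))//= [X in _ + X]big_nat [X in _ + X]big1 ?addr0//.
by move=> n /andP[Dn _]; rewrite c0.
Qed.

End Coefficients.

(** * Point evaluations as Dirichlet series *)

Section Evaluation.
Variables (R : realType) (m : probability (torus R) R) (hm : is_haar m).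
Variables (p : R) (p2 : 2 <= p).
Local Notation C := R[i].
Local Notation torus := (torus R).
Local Notation lnS := (@lnS R).
Variables (F : torus -> C) (hF : Hp m p F).
Local Notation a := (coef hF).

Definition term_re (tau : torus) n : R := complex.Re (a n * chi n tau).
Definition term_im (tau : torus) n : R := complex.Im (a n * chi n tau).

Lemma normc_sqr (z : C) : normc z ^+ 2 = complex.Re z ^+ 2 + complex.Im z ^+ 2.
Proof. by case: z => x y; rewrite /normc/= sqr_sqrtr// addr_ge0 ?sqr_ge0. Qed.

Lemma term_energy : exists B : R,
  (forall tau N, \sum_(0 <= n < N) (term_re tau n ^+ 2 + term_im tau n ^+ 2) <= B) /\
  (forall tau N, \sum_(0 <= n < N) (term_im tau n ^+ 2 + (- term_re tau n) ^+ 2) <= B).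
Proof.
have [B hB] := coef_energy hm p2 hF; exists B; split=> tau N; apply: le_trans (hB N);
  apply: ler_sum => n _; rewrite /term_re /term_im.
- by rewrite -normc_sqr normcM normc_chi mulr1.
- by rewrite sqrrN addrC -normc_sqr normcM normc_chi mulr1.
Qed.

Definition Sre theta tau : R := dsum (term_re tau) (term_im tau) theta 0.
(** Multiplication by - i makes the imaginary part a real part, with coefficients (Im, - Re). At
    [s = 0] only the first sequence enters the sum; the second one comes in along the orbit. *)
Definition Sim theta tau : R := dsum (term_im tau) (fun n => - term_re tau n) theta 0.

Lemma dterm0 (x y : nat -> R) theta n : dterm x y theta 0 n = expR (- (theta * lnS n)) * x n.
Proof. by rewrite /dterm /wave mulr0 cos0 sin0 mulr1 mulr0 addr0. Qed.

Lemma Re_circle_expM (y : R) (u : C) :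
  complex.Re (val (circle_exp (- y)) * u) = cos y * complex.Re u + sin y * complex.Im u.
Proof. by rewrite cReM /= cosN sinN; ring. Qed.

Lemma Im_circle_expM (y : R) (u : C) :
  complex.Im (val (circle_exp (- y)) * u) = cos y * complex.Im u - sin y * complex.Re u.
Proof. by rewrite cImM /= cosN sinN; ring. Qed.

Lemma Sre_kronecker theta t tau : Sre theta (kronecker t tau) = dsum (term_re tau) (term_im tau) theta t.
Proof.
congr (limn (series _)); apply/funext => n; rewrite dterm0 /dterm; congr (_ * _).
by rewrite /wave /term_re /term_im chi_kronecker mulrCA Re_circle_expM [lnS n * t]mulrC; ring.
Qed.

Lemma Sim_kronecker theta t tau :
  Sim theta (kronecker t tau) = dsum (term_im tau) (fun n => - term_re tau n) theta t.
Proof.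
congr (limn (series _)); apply/funext => n; rewrite dterm0 /dterm; congr (_ * _).
by rewrite /wave /term_re /term_im chi_kronecker mulrCA Im_circle_expM [lnS n * t]mulrC; ring.
Qed.

(** The real-linear [f] stands for the real or the imaginary part. Writing d for the coefficient
    error and w = n^(- theta), w d <= d^2 / (2 e) + e w^2; as the d^2 sum to at most 8 e^2, the
    bound is linear in [e] and uniform in [tau]. *)
Lemma eval_bound_part (f : C -> R) (tau : torus) (y : nat -> R) theta :
  2^-1 < theta ->
  (exists B, forall N, \sum_(0 <= n < N) (f (a n * chi n tau) ^+ 2 + y n ^+ 2) <= B) ->
  (forall u v, f (u + v) = f u + f v) -> (forall u, `|f u| <= normc u) ->
  (forall (s : R) u, f (s%:C%C * u) = s * f u) ->
  forall P e, 0 < e -> (Lpdist m p (on_torus P) F <= e%:E)%E ->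
  `|f (peval P (b_ theta tau)) - dsum (fun n => f (a n * chi n tau)) y theta 0| <=
    e * (8 + limn (series (fun n => expR (- (2 * theta * lnS n))))).
Proof.
move=> th hB fD fn fZ P e e0 h; have [B {}hB] := hB.
have f0 : f 0 = 0 by have := fD 0 0; rewrite addr0; lra.
have fsum (N : nat) (G : nat -> C) : f (\sum_(0 <= n < N) G n) = \sum_(0 <= n < N) f (G n).
  by elim/big_rec2 : _ => // i u v _ <-; rewrite fD.
set x := fun n => f (a n * chi n tau); set Z := limn _.
have cS : series (dterm x y theta 0) k @[k --> \oo] --> dsum x y theta 0.
  by have := @is_cvg_dterm R x y B hB theta 0 th.
have cD : `|f (peval P (b_ theta tau)) - series (dterm x y theta 0) k|
    @[k --> \oo] --> `|f (peval P (b_ theta tau)) - dsum x y theta 0|.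
  by apply: cvg_norm; apply: cvgB => //; exact: cvg_cst.
apply: (cvgr_to_le cD); exists (bohr_bound P) => // N /= PN.
have E : f (peval P (b_ theta tau)) - series (dterm x y theta 0) N =
    \sum_(0 <= n < N) expR (- (theta * lnS n)) * f ((bohr_coef P n - a n) * chi n tau).
  rewrite peval_bE -(@dpoly_wide R _ (bohr_bound P) N)//; last first.
    by move=> n Pn; rewrite /cscale /bohr_coef (bohrP P).1// mul0r.
  rewrite /dpoly fsum /series/= -sumrB; apply: eq_bigr => n _.
  rewrite dterm0 /x /cscale mulrAC mulrC fZ -mulrBr; congr (_ * _).
  have fB u v : f (u - v) = f u - f v.
    have := fD (u - v) v; rewrite subrK => ->; ring.
  by rewrite -fB mulrBl.
rewrite E (le_trans (ler_norm_sum _ _ _))//.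
apply: (@le_trans _ _ (\sum_(0 <= n < N)
   ((2 * e)^-1 * normc (bohr_coef P n - a n) ^+ 2 + e * expR (- (2 * theta * lnS n))))).
  apply: ler_sum => n _; rewrite normrM (ger0_norm (expR_ge0 _)).
  have d1 : `|f ((bohr_coef P n - a n) * chi n tau)| <= normc (bohr_coef P n - a n).
    by rewrite (le_trans (fn _))// normcM normc_chi mulr1.
  have -> : expR (- (2 * theta * lnS n)) = expR (- (theta * lnS n)) ^+ 2.
    by rewrite -expRM_natl; congr expR; ring.
  have := expR_ge0 (- (theta * lnS n)); move: (expR _) => w w0.
  have := normc_ge0 (bohr_coef P n - a n); move: (normc _) d1 => d d1 d0.
  apply: (@le_trans _ _ (w * d)); first by rewrite ler_wpM2l.
  rewrite -(ler_pM2l (x := 2 * e)) ?mulr_gt0// mulrDr mulVKf ?gt_eqF ?mulr_gt0//.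
  have := sqr_ge0 (e * w - d); have := sqr_ge0 (e * w); nra.
rewrite big_split/= -!mulr_sumr.
have h1 := coef_near hm p2 hF N e0 h.
have nd : nondecreasing_seq (series (fun n => expR (- (2 * theta * lnS n)))).
  by apply: nondecreasing_series => n _ _; exact: expR_ge0.
have cz : cvgn (series (fun n => expR (- (2 * theta * lnS n)))) by apply: is_cvg_zeta; lra.
have h2 := nondecreasing_cvgn_le nd cz N.
have h3 : (2 * e)^-1 * \sum_(0 <= n < N) normc (bohr_coef P n - a n) ^+ 2 <= (2 * e)^-1 * (8 * e ^+ 2).
  by rewrite ler_wpM2l// invr_ge0 mulr_ge0// ltW.
have h4 : (2 * e)^-1 * (8 * e ^+ 2) = 4 * e by field; rewrite gt_eqF.
have h5 : e * series (fun n => expR (- (2 * theta * lnS n))) N <= e * Z by rewrite ler_pM2l.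
rewrite h4 in h3; move: h5; rewrite /series/=; lra.
Qed.

Definition eval_const (theta : R) : R := 8 + limn (series (fun n => expR (- (2 * theta * lnS n)))).

Lemma eval_bound theta tau P e : 2^-1 < theta -> 0 < e ->
  (Lpdist m p (on_torus P) F <= e%:E)%E ->
  `|complex.Re (peval P (b_ theta tau)) - Sre theta tau| <= e * eval_const theta /\
  `|complex.Im (peval P (b_ theta tau)) - Sim theta tau| <= e * eval_const theta.
Proof.
move=> th e0 h; have [B [hB1 hB2]] := term_energy; split.
- apply: (@eval_bound_part (@complex.Re R) tau (term_im tau) theta th) => //.
  + by exists B => N; exact: hB1.
  + exact: cReD.
  + exact: norm_Re_le.
  + by move=> s [u v] /=; ring.
- apply: (@eval_bound_part (@complex.Im R) tau (fun n => - term_re tau n) theta th) => //.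
  + by exists B => N; exact: hB2.
  + exact: cImD.
  + exact: norm_Im_le.
  + by move=> s [u v] /=; ring.
Qed.

Lemma cvg_complex (T : Type) (FF : set_system T) (FFF : Filter FF) (f : T -> C) (z : C) :
  complex.Re (f x) @[x --> FF] --> complex.Re z ->
  complex.Im (f x) @[x --> FF] --> complex.Im z ->
  (f x : C^o) @[x --> FF] --> (z : C^o).
Proof.
move=> cr ci; apply/cvgrPdist_lt => -[e e'] eps0.
(* The norm of a complex number is itself an element of [R[i]], and so is the tolerance; being
   positive forces it to be real. *)
have : 0 < e /\ e' = 0 by move: eps0; rewrite ltcE/= => /andP[/eqP -> ->].
move=> [e0 ->]; have e2 : 0 < e / 2 by rewrite divr_gt0.
move/cvgrPdist_lt : cr => /(_ _ e2) cr; move/cvgrPdist_lt : ci => /(_ _ e2) ci.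
near=> x.
have h1 : `|complex.Re z - complex.Re (f x)| < e / 2 by near: x.
have h2 : `|complex.Im z - complex.Im (f x)| < e / 2 by near: x.
rewrite -[`|_|]/((normc (z - f x))%:C%C) ltcE/= eqxx/=.
have : normc (z - f x) <= `|complex.Re (z - f x)| + `|complex.Im (z - f x)|.
  move: (z - f x) => -[u v]; rewrite /normc/= -ler_sqr ?nnegrE ?addr_ge0 ?sqrtr_ge0//.
  rewrite sqr_sqrtr ?addr_ge0 ?sqr_ge0// -(real_normK (num_real u)) -(real_normK (num_real v)).
  by have := normr_ge0 u; have := normr_ge0 v; nra.
by rewrite cReB cImB; lra.
Unshelve. all: by end_near. Qed.

Lemma poly_near_Filter : ProperFilter (poly_near m p F).
Proof.
apply: filter_from_proper.
  apply: filter_from_filter; first by exists 1 => /=.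
  move=> e1 e2 /= e10 e20; exists (Num.min e1 e2); first by rewrite /= lt_min e10.
  move=> P /= h; split; apply: lt_le_trans h _; rewrite lee_fin.
    by rewrite ge_min lexx.
  by rewrite ge_min lexx orbT.
by move=> e e0; have [_ /(_ e e0) [P hP]] := hF; exists P.
Qed.

(** The bound of [eval_bound] holds for every polynomial close to F, so it identifies the limit
    along the whole filter [poly_near] and not just along [approx]. *)
Lemma Hp_evalE theta tau : 2^-1 < theta ->
  Hp_eval m p F (b_ theta tau) = (Sre theta tau +i* Sim theta tau)%C.
Proof.
move=> th; have PF := poly_near_Filter.
have Z0 : 0 < eval_const theta.
  rewrite ltr_pwDl//; apply: limr_ge; first by apply: is_cvg_zeta; lra.
  by apply: nearW => n; apply: sumr_ge0 => i _; exact: expR_ge0.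
have near_small (e : R) : 0 < e -> poly_near m p F [set P |
    `|complex.Re (peval P (b_ theta tau)) - Sre theta tau| <= e /\
    `|complex.Im (peval P (b_ theta tau)) - Sim theta tau| <= e].
  move=> e0; exists (e / eval_const theta); first by rewrite /= divr_gt0.
  move=> P /= /ltW h.
  have := @eval_bound theta tau P (e / eval_const theta) th (divr_gt0 e0 Z0) h.
  by rewrite divfK ?gt_eqF.
suff h : (peval P (b_ theta tau) : C^o) @[P --> poly_near m p F] -->
    ((Sre theta tau +i* Sim theta tau)%C : C^o).
  exact: (cvg_lim (@norm_hausdorff _ C^o) h).
apply: cvg_complex => /=.
- apply/cvgrPdist_le => e e0; apply: filterS (near_small e e0) => P /= [h _].
  by rewrite distrC.
- apply/cvgrPdist_le => e e0; apply: filterS (near_small e e0) => P /= [_ h].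
  by rewrite distrC.
Qed.

End Evaluation.

(** * From orbits to the torus *)

Section RadialLimits.
Variables (R : realType) (m : probability (torus R) R) (hm : is_haar m).
Local Notation torus := (torus R).

(* Haar measure is invariant under each T_t, so Fubini on [0, 1] x T^oo computes m(N). *)
Lemma haar_null_of_orbits (N : set torus) : measurable N ->
  (forall tau, (@lebesgue_measure R).-negligible [set t | N (kronecker t tau)]) ->
  m N = 0%E.
Proof.
move=> mN hN; pose I : set (measurableTypeR R) := `[0, 1]%classic.
have mI : measurable I by exact: measurable_itv.
pose B : set (measurableTypeR R * torus) := [set x | I x.1 /\ N (kronecker x.1 x.2)].
have mB : measurable B.
  rewrite (_ : B = (setT `&` (fst @^-1` I)) `&`
    (setT `&` ((fun x : measurableTypeR R * torus => kronecker x.1 x.2) @^-1` N))).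
    apply: measurableI; first exact: (@measurable_fst _ _ (measurableTypeR R) torus measurableT I mI).
    exact: (@measurable_kronecker R measurableT N mN).
  by rewrite !setTI.
have mf : measurable_fun setT (fun x => (\1_B x : R)%:E).
  by apply/measurable_EFinP; exact: measurable_indic.
have := @fubini_tonelli _ _ _ _ R lebesgue_measure m (fun x => (\1_B x : R)%:E) mf
  (fun x => ltac:(by rewrite lee_fin)).
have -> : (\int[lebesgue_measure]_x \int[m]_y (\1_B (x, y))%:E =
    \int[lebesgue_measure]_x ((\1_I x)%:E * m N))%E.
  apply: eq_integral => t _.
  have mk : measurable (kronecker t @^-1` N).
    by have := measurable_torus_mul (fun j => circle_exp (- (t * ln (nth_prime j)%:R)))
      measurableT mN; rewrite setTI.
  have [It|nIt] := pselect (I t).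
    rewrite indicE mem_set// mul1e.
    under eq_integral => tau _.
      rewrite (_ : \1_B (t, tau) = \1_(kronecker t @^-1` N) tau :> R); first over.
      rewrite !indicE; congr ((_ : bool)%:R); apply/idP/idP; rewrite !inE.
        by case.
      by [].
    rewrite integral_indic// setIT.
    exact: hm.
  rewrite indicE memNset// mul0e integral0_eq// => tau _.
  by rewrite indicE memNset// => -[].
(* In the other order the inner integral is the measure of the times in [0, 1] at which the orbit of
   [tau] is in [N], which is null by hypothesis. *)
have -> : (\int[m]_y \int[lebesgue_measure]_x (\1_B (x, y))%:E = 0)%E.
  rewrite integral0_eq// => tau _.
  have mS : measurable (ysection B tau) by exact: measurable_ysection.
  under eq_integral => t _.
    rewrite (_ : \1_B (t, tau) = \1_(ysection B tau) t :> R); first over.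
    by rewrite !indicE; congr ((_ : bool)%:R); rewrite mem_ysection.
  rewrite integral_indic// setIT; apply/(negligibleP lebesgue_measure mS).
  apply: negligibleS (hN tau) => t; rewrite /ysection/= inE => -[_ //].
rewrite ge0_integralZr//; last by apply/measurable_EFinP; exact: measurable_indic.
rewrite integral_indic// setIT [X in (X * _)%E](_ : _ = 1%E) ?mul1e//.
have h : @lebesgue_measure R `[0, 1]%classic = 1%E.
  by rewrite lebesgue_measure_itv/= lte_fin ltr01 oppr0 adde0.
exact: h.
Qed.

End RadialLimits.

(** * Measurability of the radial limit *)

Section MeasurableRadialLimit.
Variables (R : realType) (m : probability (torus R) R) (hm : is_haar m).
Local Notation torus := (torus R).
Variable f : R -> torus -> R.
Hypothesis mf : forall theta, 2^-1 < theta -> measurable_fun setT (f theta).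
Hypothesis f_continuous : forall tau (theta0 : R), 2^-1 < theta0 ->
  f theta tau @[theta --> theta0] --> f theta0 tau.

Let x_ (k : nat) : R := 2^-1 + k.+1%:R^-1.

Let half_lt k : 2^-1 < x_ k.
Proof. by rewrite ltrDl. Qed.

Lemma cvg_half_right : x_ k @[k --> \oo] --> (2^-1 : R)^'+.
Proof.
have h : x_ k @[k --> \oo] --> (2^-1 : R).
  rewrite -[X in _ --> X]addr0; apply: cvgD; first exact: cvg_cst.
  exact: cvg_harmonic.
move=> A /= [e /= e0 hA]; move/cvgrPdist_lt : h => /(_ e e0).
by apply: filterS => k hk; apply: hA.
Qed.

(** An upper limit along one sequence is defined and measurable everywhere, and it equals the radial
    limit wherever that exists; [fine] sends infinite values to 0. *)
Definition radial (tau : torus) : R := fine (limn_esup (fun k => (f (x_ k) tau)%:E)).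

Lemma measurable_radial : measurable_fun setT radial.
Proof.
apply: (@measurableT_comp _ _ _ _ _ _ fine) => //.
by apply: measurable_fun_limn_esup => k; apply/measurable_EFinP; exact: mf (half_lt k).
Qed.

Lemma radial_cvg tau : cvg (f theta tau @[theta --> (2^-1 : R)^'+]) ->
  f theta tau @[theta --> (2^-1 : R)^'+] --> radial tau.
Proof.
move=> /cvg_ex[l hl]; suff -> : radial tau = l by [].
have h : (f (x_ k) tau)%:E @[k --> \oo] --> l%:E.
  apply/fine_cvgP; split; first exact: nearW.
  exact: (cvg_comp _ _ cvg_half_right hl).
rewrite /radial is_cvg_limn_esupE; last by apply/cvg_ex; exists l%:E.
by rewrite (cvg_lim _ h).
Qed.

(** An enumeration of the rationals. Indices coding no rational yield 0, which the condition
    [0 < q_ n] in [good] excludes. *)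
Let q_ (n : nat) : R := ratr (odflt 0%R (unpickle n) : rat).

(* Restricting to rational q makes the set measurable; continuity in theta restores all q. *)
Definition good : set torus :=
  \bigcap_e \bigcup_k \bigcap_n [set tau |
    (0 < q_ n < k.+1%:R^-1) ==> (`|radial tau - f (2^-1 + q_ n) tau| <= e.+1%:R^-1)].

Lemma measurable_good : measurable good.
Proof.
apply: bigcapT_measurable => e; apply: bigcupT_measurable => k; apply: bigcapT_measurable => n.
have [/andP[q0 _]|_] := boolP (0 < q_ n < k.+1%:R^-1); last first.
  by rewrite (_ : [set _ | _] = setT)//; apply/seteqP; split.
rewrite /= -[X in measurable X]setTI.
have h : measurable_fun setT (fun tau => `|radial tau - f (2^-1 + q_ n) tau| <= e.+1%:R^-1).
  apply: measurable_fun_ler; last exact: measurable_cst.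
  apply: measurableT_comp => //; apply: measurable_funB; first exact: measurable_radial.
  by apply: mf; rewrite ltrDl.
have := h measurableT [set true] ltac:(by []).
by congr measurable; rewrite !setTI; apply/seteqP; split => tau /=.
Qed.

Lemma goodP tau : good tau <-> f theta tau @[theta --> (2^-1 : R)^'+] --> radial tau.
Proof.
split=> [h|/cvgrPdist_le h e _]; last first.
  have [d /= d0 hd] := h (e.+1%:R^-1) ltac:(by rewrite invr_gt0).
  have [K _ hK] := near_infty_natSinv_lt (PosNum d0).
  exists K => // n _; apply/implyP => /andP[q0 qK].
  apply: hd; rewrite /= ?ltrDl// opprD addrA subrr sub0r normrN gtr0_norm//.
  exact: lt_trans qK (hK K (leqnn K)).
apply/cvgrPdist_le => e e0; have [E _ hE] := near_infty_natSinv_lt (PosNum e0).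
have [K _ hK] := h E I; near=> theta.
have th : 2^-1 < theta by near: theta; exact: nbhs_right_gt.
have th2 : theta < 2^-1 + K.+1%:R^-1 by near: theta; apply: nbhs_right_lt; rewrite ltrDl.
rewrite leNgt; apply/negP => lt.
have c : `|radial tau - f y tau| @[y --> theta] --> `|radial tau - f theta tau|.
  by apply: cvg_norm; apply: cvgB; [exact: cvg_cst|exact: f_continuous].
have [d /= d0 hd] := cvgr_gt _ c _ lt.
(* A strict violation at [theta] persists, by continuity, at some rational shift slightly to the
   left of [theta] and still to the right of 1/2. *)
have [q] : exists q : rat, ratr q \in `](Num.max (theta - d) 2^-1 - 2^-1), (theta - 2^-1)[.
  by apply: rat_in_itvoo; rewrite ltrD2r gt_max th gtrBl d0.
rewrite in_itv/= ltrBlDr gt_max => /andP[/andP[q1 q2] q3].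
have qE : q_ (pickle q) = ratr q by rewrite /q_ pickleK.
have := hK (pickle q) I; rewrite /= qE => /implyP hq.
have {}hq : `|radial tau - f (2^-1 + ratr q) tau| <= E.+1%:R^-1 by apply: hq; rewrite (lt_trans q3) ?ltrBlDl// andbT; lra.
have : e < `|radial tau - f (2^-1 + ratr q) tau|.
  by apply: hd; rewrite /= gtr0_norm; lra.
rewrite ltNge => /negP; apply; apply: le_trans hq _; exact: ltW (hE E (leqnn E)).
Unshelve. all: by end_near. Qed.

Hypothesis ae_orbit : forall tau, {ae @lebesgue_measure R, forall t,
  cvg (f theta (kronecker t tau) @[theta --> (2^-1 : R)^'+])}.

Lemma radial_ae_orbit tau : {ae @lebesgue_measure R, forall t,
  f theta (kronecker t tau) @[theta --> (2^-1 : R)^'+] --> radial (kronecker t tau)}.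
Proof.
by apply: negligibleS (ae_orbit tau) => t /= nh h; apply: nh; exact: radial_cvg.
Qed.

Lemma radial_ae : {ae m, forall tau,
  f theta tau @[theta --> (2^-1 : R)^'+] --> radial tau}.
Proof.
have E : [set tau | ~ (f theta tau @[theta --> (2^-1 : R)^'+] --> radial tau)] = ~` good.
  by apply/seteqP; split => tau /= h; contradict h; apply/goodP.
have mN : measurable (~` good) by apply: measurableC; exact: measurable_good.
exists (~` good); split => //; last by rewrite -E.
apply: (haar_null_of_orbits hm mN) => tau; apply: negligibleS (radial_ae_orbit tau) => t.
by move=> /= nh h; apply: nh; apply/goodP.
Qed.

End MeasurableRadialLimit.

(** * The radial limit represents the restriction *)

Section Restriction.
Variables (R : realType) (m : probability (torus R) R) (hm : is_haar m).
Variables (p : R) (p2 : 2 <= p).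
Local Notation C := R[i].
Local Notation torus := (torus R).
Local Notation lnS := (@lnS R).
Variables (F : torus -> C) (hF : Hp m p F).

Lemma cmfun_term n : cmfun (fun tau : torus => coef hF n * chi n tau).
Proof. by apply: cmfunM; [exact: cmfun_cst|exact: cmfun_chi]. Qed.

Lemma measurable_dsum (x y : torus -> nat -> R) theta :
  (forall n, measurable_fun setT (x ^~ n)) ->
  (exists B, forall tau N, \sum_(0 <= n < N) (x tau n ^+ 2 + y tau n ^+ 2) <= B) ->
  2^-1 < theta -> measurable_fun setT (fun tau => dsum (x tau) (y tau) theta 0).
Proof.
move=> mx [B hB] th.
apply: (@measurable_fun_cvg _ _ _ _
  (fun N tau => series (dterm (x tau) (y tau) theta 0) N)) => [N|tau _].
  rewrite /series/=; under eq_fun do under eq_bigr do rewrite dterm0.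
  by apply: measurable_sum => n; apply: measurable_funM => //; exact: mx.
by have := @is_cvg_dterm R (x tau) (y tau) B (hB tau) theta 0 th.
Qed.

Lemma measurable_Sre theta : 2^-1 < theta -> measurable_fun setT (Sre hF theta).
Proof.
have [B [hB _]] := term_energy hm p2 hF.
by apply: measurable_dsum; [move=> n; case: (cmfun_term n)|exists B].
Qed.

Lemma measurable_Sim theta : 2^-1 < theta -> measurable_fun setT (Sim hF theta).
Proof.
have [B [_ hB]] := term_energy hm p2 hF.
by apply: measurable_dsum; [move=> n; case: (cmfun_term n)|exists B].
Qed.

Lemma continuous_Sre tau (theta0 : R) : 2^-1 < theta0 ->
  Sre hF theta tau @[theta --> theta0] --> Sre hF theta0 tau.
Proof.
have [B [hB _]] := term_energy hm p2 hF.
exact: (@continuous_dsum R (term_re hF tau) (term_im hF tau) B (hB tau)).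
Qed.

Lemma continuous_Sim tau (theta0 : R) : 2^-1 < theta0 ->
  Sim hF theta tau @[theta --> theta0] --> Sim hF theta0 tau.
Proof.
have [B [_ hB]] := term_energy hm p2 hF.
exact: (@continuous_dsum R (term_im hF tau) (fun n => - term_re hF tau n) B (hB tau)).
Qed.

Lemma Sre_ae_orbit tau : {ae @lebesgue_measure R, forall t,
  cvg (Sre hF theta (kronecker t tau) @[theta --> (2^-1 : R)^'+])}.
Proof.
have [B [hB _]] := term_energy hm p2 hF.
apply: negligibleS (ae_cvg_dsumT (hB tau)) => t /=; apply: contra_not.
by under [in X in _ -> X]eq_fun do rewrite Sre_kronecker.
Qed.

Lemma Sim_ae_orbit tau : {ae @lebesgue_measure R, forall t,
  cvg (Sim hF theta (kronecker t tau) @[theta --> (2^-1 : R)^'+])}.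
Proof.
have [B [_ hB]] := term_energy hm p2 hF.
apply: negligibleS (ae_cvg_dsumT (hB tau)) => t /=; apply: contra_not.
by under [in X in _ -> X]eq_fun do rewrite Sim_kronecker.
Qed.

Definition boundary_re : torus -> R := radial (Sre hF).
Definition boundary_im : torus -> R := radial (Sim hF).
Definition boundary_value (tau : torus) : C := (boundary_re tau +i* boundary_im tau)%C.

Lemma cmfun_boundary_value : cmfun boundary_value.
Proof.
by split; apply: measurable_radial; [exact: measurable_Sre|exact: measurable_Sim].
Qed.

Lemma ae_radial : {ae m, forall tau,
  Sre hF theta tau @[theta --> (2^-1 : R)^'+] --> boundary_re tau /\
  Sim hF theta tau @[theta --> (2^-1 : R)^'+] --> boundary_im tau}.
Proof.
apply: negligibleS (negligibleU
  (radial_ae hm measurable_Sre continuous_Sre Sre_ae_orbit)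
  (radial_ae hm measurable_Sim continuous_Sim Sim_ae_orbit)) => tau /= h.
by apply/not_andP.
Qed.

Lemma ae_orbit_radial tau : {ae @lebesgue_measure R, forall t,
  Sre hF theta (kronecker t tau) @[theta --> (2^-1 : R)^'+] --> boundary_re (kronecker t tau) /\
  Sim hF theta (kronecker t tau) @[theta --> (2^-1 : R)^'+] --> boundary_im (kronecker t tau)}.
Proof.
apply: negligibleS (negligibleU
  (radial_ae_orbit Sre_ae_orbit tau) (radial_ae_orbit Sim_ae_orbit tau)) => t /= h.
by apply/not_andP.
Qed.

Lemma Hp_eval_cvg tau :
  Sre hF theta tau @[theta --> (2^-1 : R)^'+] --> boundary_re tau /\
  Sim hF theta tau @[theta --> (2^-1 : R)^'+] --> boundary_im tau ->
  (Hp_eval m p F (b_ theta tau) : C^o) @[theta --> (2^-1 : R)^'+] --> (boundary_value tau : C^o).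
Proof.
move=> [hr hi].
have near_half : \forall theta \near (2^-1 : R)^'+,
    Hp_eval m p F (b_ theta tau) = (Sre hF theta tau +i* Sim hF theta tau)%C.
  near=> theta; rewrite (Hp_evalE hm p2 hF)//; near: theta; exact: nbhs_right_gt.
apply: cvg_complex.
- apply: cvg_trans hr; apply: near_eq_cvg.
  by apply: filterS near_half => theta /= ->.
- apply: cvg_trans hi; apply: near_eq_cvg.
  by apply: filterS near_half => theta /= ->.
Unshelve. all: by end_near. Qed.

Definition interior_value theta tau : C := (Sre hF theta tau +i* Sim hF theta tau)%C.

Lemma cmfun_interior_value theta : 2^-1 < theta -> cmfun (interior_value theta).
Proof. by split; [exact: measurable_Sre|exact: measurable_Sim]. Qed.

Lemma cmfun_diff P theta (g : torus -> C) : cmfun g -> cmfun (fun t => peval P (b_ theta t) - g t).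
Proof. by apply: cmfunB; exact: cmfun_peval_b. Qed.

Lemma approx_cvg theta tau : 2^-1 < theta ->
  complex.Re (peval (approx hF k) (b_ theta tau)) @[k --> \oo] --> Sre hF theta tau /\
  complex.Im (peval (approx hF k) (b_ theta tau)) @[k --> \oo] --> Sim hF theta tau.
Proof.
move=> th; have hb k : _ := @eval_bound R m hm p p2 F hF theta tau (approx hF k) k.+1%:R^-1 th
  ltac:(by rewrite invr_gt0) (ltW (approxP hF k)).
have hZ : k.+1%:R^-1 * eval_const theta @[k --> \oo] --> (0 : R).
  by rewrite -[X in _ --> X](mul0r (eval_const theta)); apply: cvgMl; exact: cvg_harmonic.
split; apply/cvgrPdist_le => e e0; near=> k.
- rewrite distrC; apply: (le_trans (hb k).1); near: k; exact: (cvgr_le _ hZ e e0).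
- rewrite distrC; apply: (le_trans (hb k).2); near: k; exact: (cvgr_le _ hZ e e0).
Unshelve. all: by end_near. Qed.

(** Contractivity is known for polynomials only, so F is replaced by its approximants, whose values
    at [b_ theta] converge at every point. *)
Lemma Lpdist_interior_value P theta (e : R) : 2^-1 < theta -> 0 < e ->
  (Lpdist m p (on_torus P) F <= e%:E)%E ->
  (Lpdist m p (fun t => peval P (b_ theta t)) (interior_value theta) <= e%:E)%E.
Proof.
move=> th e0 h; apply/lee_addgt0Pr => d d0; rewrite -EFinD.
(* Starting the approximants at index [K] keeps their distance to F below [d], which is then
   arbitrary. *)
have [K _ hK] := near_invS d0.
apply: (@Lpnorm_fatou R m p p2
  (fun k t => peval P (b_ theta t) - peval (approx hF (k + K)%N) (b_ theta t))).
- by rewrite ltW// addr_gt0.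
- by move=> k; apply: cmfun_diff; exact: cmfun_peval_b.
- by apply: cmfun_diff; exact: cmfun_interior_value.
- move=> k; apply: le_trans (Lpdist_b hm p2 _ _ _) _; first lra.
  apply: le_trans (approx_dist p2 hF (k + K)%N h) _; rewrite lee_fin lerD2l.
  by apply: hK; exact: leq_addl.
- apply: aeW => tau; have [cr ci] := approx_cvg tau th; apply: cvg_normc.
  + rewrite cReB; under eq_fun do rewrite cReB; apply: cvgB; first exact: cvg_cst.
    by rewrite (cvg_shiftn K (fun k => complex.Re (peval (approx hF k) (b_ theta tau)))).
  + rewrite cImB; under eq_fun do rewrite cImB; apply: cvgB; first exact: cvg_cst.
    by rewrite (cvg_shiftn K (fun k => complex.Im (peval (approx hF k) (b_ theta tau)))).
Qed.

Lemma peval_b_cvg (P : cpoly R) (tau : torus) :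
  complex.Re (peval P (b_ (2^-1 + k.+1%:R^-1) tau)) @[k --> \oo] -->
    complex.Re (peval P (b_ 2^-1 tau)) /\
  complex.Im (peval P (b_ (2^-1 + k.+1%:R^-1) tau)) @[k --> \oo] -->
    complex.Im (peval P (b_ 2^-1 tau)).
Proof.
have h (u : nat -> R) : \sum_(0 <= n < bohr_bound P) expR (- ((2^-1 + k.+1%:R^-1) * lnS n)) * u n
    @[k --> \oo] --> \sum_(0 <= n < bohr_bound P) expR (- (2^-1 * lnS n)) * u n.
  apply: cvg_big => [|n _]; first exact: add_continuous.
  apply: cvgMl; apply: continuous_cvg; first exact: continuous_expR.
  apply: cvgN; apply: cvgMl; rewrite -[X in _ --> X]addr0; apply: cvgD; first exact: cvg_cst.
  exact: cvg_harmonic.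
split.
- rewrite peval_bE Re_dpoly_scale; under eq_fun do rewrite peval_bE Re_dpoly_scale; exact: h.
- rewrite peval_bE Im_dpoly_scale; under eq_fun do rewrite peval_bE Im_dpoly_scale; exact: h.
Qed.

(* Fatou twice: along polynomials tending to F at theta > 1/2, then along theta to 1/2. *)
Lemma Lpdist_boundary_value P (e : R) : 0 < e -> (Lpdist m p (on_torus P) F <= e%:E)%E ->
  (Lpdist m p (fun t => peval P (b_ 2^-1 t)) boundary_value <= e%:E)%E.
Proof.
move=> e0 h; have th k : (2^-1 : R) < 2^-1 + k.+1%:R^-1 by rewrite ltrDl.
apply: (@Lpnorm_fatou R m p p2
  (fun k t => peval P (b_ (2^-1 + k.+1%:R^-1) t) - interior_value (2^-1 + k.+1%:R^-1) t)).
- exact: ltW.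
- by move=> k; apply: cmfun_diff; exact: cmfun_interior_value.
- by apply: cmfun_diff; exact: cmfun_boundary_value.
- by move=> k; exact: Lpdist_interior_value.
- apply: negligibleS ae_radial => tau /=; apply: contra_not => -[hr hi].
  have [cr ci] := peval_b_cvg P tau; apply: cvg_normc.
  + rewrite cReB; under eq_fun do rewrite cReB; apply: cvgB; first exact: cr.
    exact: (cvg_comp _ _ (@cvg_half_right R) hr).
  + rewrite cImB; under eq_fun do rewrite cImB; apply: cvgB; first exact: ci.
    exact: (cvg_comp _ _ (@cvg_half_right R) hi).
Qed.

Lemma normc_dpoly_le c M (t : torus) : normc (dpoly c M t) <= \sum_(0 <= n < M) normc (c n).
Proof.
rewrite /dpoly; elim/big_rec2 : _ => [|n y x _ h]; first by rewrite normc0.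
by rewrite (le_trans (le_normcD _ _))// lerD// normcM normc_chi mulr1.
Qed.

Lemma Lpnorm_dpoly c M : exists B : R, (Lpnorm m p (dpoly c M) <= B%:E)%E.
Proof.
exists (\sum_(0 <= n < M) normc (c n)).
have B0 : 0 <= \sum_(0 <= n < M) normc (c n) by apply: sumr_ge0 => n _; exact: normc_ge0.
have p0 : 0 <= p by have := p2; lra.
rewrite Lpnorm_leP//.
apply: (@le_trans _ _ (\int[m]_t ((\sum_(0 <= n < M) normc (c n)) `^ p)%:E)%E).
  apply: ge0_le_integral => //.
  - by move=> t _; rewrite lee_fin powR_ge0.
  - apply/measurable_EFinP; apply: (measurableT_comp (measurable_powR _)) => //.
    exact: measurable_normc (cmfun_dpoly c M).
  - by move=> t _; rewrite lee_fin ge0_ler_powR ?nnegrE ?normc_ge0// normc_dpoly_le.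
by rewrite integral_cst// [X in (_ * X)%E](_ : _ = 1%E) ?mule1//; exact: probability_setT.
Qed.

Lemma is_restriction_boundary_value : is_restriction m p F boundary_value.
Proof.
split.
- split; first exact: cmfun_boundary_value.
  (* Finiteness of the norm: the boundary function is within distance 1 of a dilated polynomial,
     which is bounded on the torus. *)
  pose P := approx hF 0.
  have h : (Lpdist m p (on_torus P) F <= 1%:E)%E by have := ltW (approxP hF 0); rewrite invr1.
  have hG := Lpdist_boundary_value ltr01 h.
  have [B hB] : exists B : R, (Lpnorm m p (fun t => peval P (b_ 2^-1 t)) <= B%:E)%E.
    by rewrite (funext (peval_bE P 2^-1)); exact: Lpnorm_dpoly.
  apply: (@le_lt_trans _ _ (B + 1)%:E); last exact: ltry.
  rewrite EFinD; apply: le_trans (leeD hB hG); rewrite /Lpdist.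
  rewrite -[X in (_ <= _ + X)%E]/(Lpdist m p _ _) LpdistC /Lpdist.
  rewrite [X in (Lpnorm m p X <= _)%E](_ : _ =
    (fun t => peval P (b_ 2^-1 t) + (boundary_value t - peval P (b_ 2^-1 t)))).
    apply: LpnormD => //; first exact: cmfun_peval_b.
    by apply: cmfunB; [exact: cmfun_boundary_value|exact: cmfun_peval_b].
  by apply/funext => t; rewrite addrC subrK.
- have near_le (e : R) : 0 < e -> poly_near m p F
      [set P | (Lpdist m p (fun t => peval P (b_ 2^-1 t)) boundary_value <= e%:E)%E].
    by move=> e0; exists e => // P /= /ltW; exact: Lpdist_boundary_value.
  have PF := poly_near_Filter hF.
  apply/fine_cvgP; split.
    apply: filterS (near_le 1 ltr01) => P /= h.
    by rewrite ge0_fin_numE ?Lpnorm_ge0// (le_lt_trans h)// ltry.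
  apply/cvgrPdist_le => e e0; apply: filterS (near_le e e0) => P /= h.
  rewrite sub0r normrN ger0_norm ?fine_ge0 ?Lpnorm_ge0//.
  by rewrite -lee_fin fineK// ge0_fin_numE ?Lpnorm_ge0// (le_lt_trans h)// ltry.
Qed.

End Restriction.

Theorem theorem3 (R : realType) (m : probability (torus R) R)
    (hm : is_haar m) (p : R) (hp : 2 <= p)
    (F : torus R -> R[i]) (hF : Hp m p F) :
  exists G : torus R -> R[i],
    [/\ is_restriction m p F G,
        {ae m, forall tau : torus R,
          (Hp_eval m p F (b_ theta tau) : R[i]^o)
            @[theta --> (2^-1 : R)^'+] --> (G tau : R[i]^o)} &
        forall tau : torus R,
          {ae @lebesgue_measure R, forall t : R,
            (Hp_eval m p F (b_ theta (kronecker t tau)) : R[i]^o)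
              @[theta --> (2^-1 : R)^'+]
              --> (G (kronecker t tau) : R[i]^o)}].
Proof.
exists (boundary_value hF); split; first exact: is_restriction_boundary_value.
- apply: negligibleS (ae_radial hm hp hF) => tau /=; apply: contra_not.
  exact: Hp_eval_cvg.
- move=> tau; apply: negligibleS (ae_orbit_radial hm hp hF tau) => t /=.
  by apply: contra_not; exact: Hp_eval_cvg.
Qed.
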